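(* Let \[ s(z;\tau)=\sum_{n\geq 0}r_2(n)\,J_0(2\pi\sqrt{n}\,z)\,e^{\pi i n\tau}\qquad(\tau\in\mathbb H,\ z\in\mathbb C). \] Then $s$ has the expansion in powers of $z$ \[ s(z;\tau)=\theta(\tau)^2\exp\!\big(A(\tau)z^2\big)\sum_{n\geq 0}f_n(\tau)z^{2n}, \] where for every $n\ge 0$ the function $f_n(\tau)$ is a modular form of weight $2n$ with respect to $\Gamma(2)$, given explicitly by $f_n(\tau)=\pi^{2n}x(\tau)^n p_n(u(\tau))$. Here $p_n(u)$ are polynomials with rational coefficients determined by $p_{-1}(u)=0$, $p_0(u)=1$ and \[ (n+1)^2p_{n+1}(u)+p_n'(u)(u^2-u)-nu\,p_n(u)+\frac{u\,p_{n-1}(u)}{4}=0\qquad (n\geq 0). \]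
   Context: $\mathbb H=\{\tau\in\mathbb C:\mathrm{Im}\,\tau>0\}$. $r_2(n)=\#\{(a,b)\in\mathbb Z^2:a^2+b^2=n\}$. $J_0$ is the Bessel function, $J_0(2\sqrt{x})=\sum_{n\ge0}\frac{(-1)^nx^n}{n!^2}$ (an entire function of $x$, so $J_0(2\pi\sqrt n z)$ is unambiguous). $\theta(\tau)=\sum_{n\in\mathbb Z}e^{\pi i n^2\tau}$, $x(\tau)=-\big(\sum_{n\in\mathbb Z}(-1)^ne^{\pi i n^2\tau}\big)^4$, $y(\tau)=\big(\sum_{n\in\mathbb Z+\frac12}e^{\pi i n^2\tau}\big)^4$, $u(\tau)=y(\tau)/x(\tau)$. $t(\tau)=\frac{1}{2\pi i}\frac{\partial\log\theta(\tau)}{\partial\tau}$ and $A(\tau)=-4\pi^2t(\tau)=2\pi i\frac{\partial \log\theta}{\partial\tau}$. $\Gamma(2)=\{\gamma\in SL(2,\mathbb Z):\gamma\equiv I\pmod 2\}$. A modular form of weight $k$ for $\Gamma(2)$ is a holomorphic $f:\mathbb H\to\mathbb C$ with $f(\frac{a\tau+b}{c\tau+d})=(c\tau+d)^kf(\tau)$ for all $\begin{pmatrix}a&b\\c&d\end{pmatrix}\in\Gamma(2)$ and such that for every $r\in\mathbb Q$, $|f(r+iy)|$ grows at most polynomially in $y^{-1}$ as $y\to0^+$. *)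

(* Defs.v *)
From mathcomp Require Import all_boot all_algebra.
From mathcomp Require Import Rstruct.
From Stdlib Require Import Reals ZArith.
From Coquelicot Require Import Coquelicot.
Import GRing.Theory.

(* The standard real numbers own the key %R. *)
Delimit Scope ring_scope with ring.
Local Open Scope C_scope.

Definition Cexp (z : C) : C :=
  (exp (Re z) * cos (Im z), exp (Re z) * sin (Im z))%R.

(* The sum of the series when it converges; otherwise unspecified, like
   [Series]. *)
Definition CSeries (a : nat -> C) : C :=
  (Series (fun n => Re (a n)), Series (fun n => Im (a n))).

(* The sum over all integers, for families that are summable on each half
   line. *)
Definition CSeriesZ (a : Z -> C) : C :=
  CSeries (fun n => a (Z.of_nat n)) + CSeries (fun n => a (- Z.of_nat (S n))%Z).

Definition upper (tau : C) : Prop := (0 < Im tau)%R.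

(* A solution of a^2 + b^2 = n has |a|, |b| <= n: the pair (i, j) in
   {0, ..., 2 n}^2 stands for (a, b) = (i - n, j - n). *)
Definition r2 (n : nat) : nat :=
  #|[set ij : 'I_(n.*2.+1) * 'I_(n.*2.+1) |
      (((ij.1 : nat)%:Z - n%:Z) ^+ 2 + ((ij.2 : nat)%:Z - n%:Z) ^+ 2
        == n%:Z)%ring]|.

(* J_0(2 sqrt x) = \sum_k (-1)^k x^k / k!^2 at x = (w / 2)^2. *)
Definition J0 (w : C) : C :=
  CSeries (fun k => (-1) ^ k * ((w / 2) ^ 2) ^ k / RtoC (INR (fact k)) ^ 2).

Definition s_term (z tau : C) (n : nat) : C :=
  INR (r2 n) * J0 (2 * PI * sqrt (INR n) * z) * Cexp (PI * Ci * INR n * tau).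

Definition s_fun (z tau : C) : C := CSeries (s_term z tau).

Definition theta (tau : C) : C :=
  CSeriesZ (fun n => Cexp (PI * Ci * IZR n ^ 2 * tau)).

Definition x_fun (tau : C) : C :=
  - CSeriesZ (fun n => powerRZ (-1) n * Cexp (PI * Ci * IZR n ^ 2 * tau)) ^ 4.

Definition y_fun (tau : C) : C :=
  CSeriesZ (fun n => Cexp (PI * Ci * (IZR n + 1 / 2) ^ 2 * tau)) ^ 4.

Definition u_fun (tau : C) : C := y_fun tau / x_fun tau.

(* theta has no zero in the upper half plane, and the derivative of any local
   branch of log theta is theta' / theta. *)
Definition t_fun (tau : C) : C :=
  1 / (2 * PI * Ci) * (C_derive theta tau / theta tau).

Definition A_fun (tau : C) : C := - (4 * PI ^ 2) * t_fun tau.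

Definition in_Gamma2 (a b c d : Z) : Prop :=
  (a * d - b * c = 1)%Z /\
  (2 | a - 1)%Z /\ (2 | b)%Z /\ (2 | c)%Z /\ (2 | d - 1)%Z.

(* f is a function on the upper half plane: its values elsewhere are
   irrelevant. *)
Definition modular_form_Gamma2 (k : nat) (f : C -> C) : Prop :=
  (forall tau : C, upper tau -> @ex_derive C_AbsRing C_NormedModule f tau) /\
  (forall a b c d : Z, in_Gamma2 a b c d -> forall tau : C, upper tau ->
     f ((IZR a * tau + IZR b) / (IZR c * tau + IZR d))
     = (IZR c * tau + IZR d) ^ k * f tau) /\
  (forall r : rat, exists (K : R) (N : nat) (delta : R), (0 < delta)%R /\
     forall v : R, (0 < v < delta)%R ->
       (Cmod (f (RtoC (ratr r) + Ci * v)%C) <= K * (/ v) ^ N)%R).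

Definition peval (p : {poly rat}) (w : C) : C :=
  \big[Cplus/RtoC 0]_(k < size p) (RtoC (ratr p`_k%ring) * w ^ k).

(* Only the values at indices >= -1 are constrained. *)
Definition p_system (p : int -> {poly rat}) : Prop :=
  (p (-1) = 0 /\ p 0 = 1 /\
   forall n : nat,
     ((n%:R + 1) ^+ 2) *: p (n%:Z + 1) + (p n%:Z)^`() * ('X^2 - 'X)
     - n%:R *: ('X * p n%:Z) + 4%:R^-1 *: ('X * p (n%:Z - 1)) = 0)%ring.

Definition f_fun (p : int -> {poly rat}) (n : nat) (tau : C) : C :=
  PI ^ (2 * n)%nat * x_fun tau ^ n * peval (p (Posz n)) (u_fun tau).

(* Main.v *)
From HB Require Import structures.
Require Import Defs.
From mathcomp Require Import all_boot all_algebra zify ssrZ Rstruct.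
From Stdlib Require Import Reals ZArith Psatz ClassicalEpsilon.
From Coquelicot Require Import Coquelicot.

Set Implicit Arguments.
Unset Strict Implicit.
Unset Printing Implicit Defensive.

Local Open Scope C_scope.

(* Let theta_2, theta_3 = theta, theta_4 be Jacobi's theta constants, so that
   x = - theta_4^4 and y = theta_2^4, and put w_j = theta_j' / theta_j.
   Summing over the lattice Z^2 rotated by 45 degrees expresses products of
   theta constants at tau by products at 2 tau. An expression in them with a
   simple behaviour under tau -> 2 tau is therefore determined by its limit at
   i oo, and in this way one finds that the theta constants have no zeros, that
   theta_1'(0) = pi theta_2 theta_3 theta_4, and that
   w_3' = 2 (w_2 w_3 + w_3 w_4 - w_2 w_4) (Halphen). Since A = 2 pi i w_3, the
   last identity is the Riccati equation pi i A' - A^2 = - pi^4 x y / 4.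

   The coefficients c_k of s = \sum_k c_k z^(2k) satisfy c_0 = theta^2 and
   pi i c_k' = (k + 1)^2 c_(k+1). Multiplication of s by exp(- A z^2) and the
   Riccati equation turn this into
   (n + 1)^2 f_(n+1) = pi i f_n' - 2 n A f_n - pi^4 x y f_(n-1) / 4,
   which the functions pi^(2n) x^n p_n(u) satisfy by the definition of the p_n,
   because x' = 4 w_4 x and u' = pi i x (u^2 - u).

   As f_n is homogeneous of degree n in x and y, its modularity follows from
   x(- 1 / tau) = tau^2 y(tau). For sigma = - 1 / tau, the function
   \sum_n exp(pi i sigma (z + n)^2) of z is quasi-periodic for Z + Z tau, and
   such functions form a line; comparison of its values at 0 and 1 / 2 with
   those of \sum_n exp(pi i n^2 tau + 2 pi i n z) yields
   (theta_2 / theta_3)(- 1 / tau) = (theta_4 / theta_3)(tau), and the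
   logarithmic derivative of this is the formula for x. *)

(** The rotations of the lattice, the grouping of points by a^2 + b^2, the double series of Bessel
    terms and the Cauchy products are all rearrangements. Sums are therefore unconditional over an
    arbitrary index type and are compared with [CSeries] only at the ends. Complex analysis is
    reduced to termwise differentiation and two devices. Doubling pushes each point towards i oo, so
    an invariant quantity equals its limit there. The Halphen defect D only satisfies 4 D(2 tau) =
    D(tau), so Im(tau)^2 D is used instead, and the exponential decay at i oo beats the added
    factor. For inversion, Riemann sums over finite grids take the place of Fourier coefficients:
    for a periodic function their dependence on the base point is O(1 / N), which plays the part of
    moving a contour. Only the ratio of theta values at two points is compared, so the root sqrt(tau
    / i) of the usual transformation law never appears; the weight 2 comes from the chain rule for -
    1 / tau. *)

HB.instance Definition _ :=
  Monoid.isComLaw.Build C (RtoC 0) Cplus Cplus_assoc Cplus_comm Cplus_0_l.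

Notation "\csum_ ( i <- r ) F" := (\big[Cplus/RtoC 0]_(i <- r) F)
  (at level 36, F at level 36, i, r at level 50) : C_scope.
Notation "\csum_ ( m <= i < n ) F" := (\big[Cplus/RtoC 0]_(m <= i < n) F)
  (at level 36, F at level 36, i, m, n at level 50) : C_scope.
Notation "\rsum_ ( i <- r ) F" := (\big[Rplus/R0]_(i <- r) F)
  (at level 36, F at level 36, i, r at level 50) : R_scope.

(** * Finite and unconditional sums *)

Lemma Cmod_csum I (r : seq I) (f : I -> C) :
  (Cmod (\csum_(i <- r) f i)%C <= \rsum_(i <- r) Cmod (f i))%R.
Proof.
elim: r => [|i r IH]; first by rewrite !big_nil Cmod_0; lra.
rewrite !big_cons; have := Cmod_triangle (f i) (\csum_(i <- r) f i); lra.
Qed.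

Lemma csum_mull I (r : seq I) (a : C) (f : I -> C) :
  \csum_(i <- r) (a * f i) = a * \csum_(i <- r) f i.
Proof. elim: r => [|i r IH]; rewrite ?big_nil ?big_cons ?IH; ring. Qed.

Lemma rsum_mull I (r : seq I) (a : R) (f : I -> R) :
  (\rsum_(i <- r) (a * f i) = a * \rsum_(i <- r) f i)%R.
Proof. elim: r => [|i r IH]; rewrite ?big_nil ?big_cons ?IH; ring. Qed.

Lemma rsum_le I (r : seq I) (f g : I -> R) :
  (forall i, f i <= g i)%R -> (\rsum_(i <- r) f i <= \rsum_(i <- r) g i)%R.
Proof.
move=> fg; elim: r => [|i r IH]; rewrite ?big_nil ?big_cons; first lra.
by move: (fg i); lra.
Qed.

Lemma rsum_le_in (I : eqType) (r : seq I) (f g : I -> R) :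
  (forall i, i \in r -> f i <= g i)%R -> (\rsum_(i <- r) f i <= \rsum_(i <- r) g i)%R.
Proof.
elim: r => [|i r IH] fg; rewrite ?big_nil ?big_cons; first lra.
have h := fg i (mem_head _ _).
by have := IH (fun j hj => fg j ltac:(by rewrite in_cons hj orbT)); lra.
Qed.

Lemma rsum_ge0 I (r : seq I) (f : I -> R) :
  (forall i, 0 <= f i)%R -> (0 <= \rsum_(i <- r) f i)%R.
Proof.
move=> fg; elim: r => [|i r IH]; rewrite ?big_nil ?big_cons; first lra.
by move: (fg i); lra.
Qed.

Lemma INR_size_cons I (i : I) (r : seq I) :
  INR (size (i :: r)) = (INR (size r) + 1)%R.
Proof. by have -> : size (i :: r) = (size r).+1 by []; rewrite S_INR. Qed.

Lemma rsum_const I (r : seq I) (a : R) :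
  (\rsum_(i <- r) a = INR (size r) * a)%R.
Proof.
elim: r => [|i r IH]; rewrite ?big_nil ?big_cons ?IH; first by rewrite /=; lra.
by rewrite INR_size_cons; ring.
Qed.

Lemma csum_const I (r : seq I) (a : C) :
  \csum_(i <- r) a = RtoC (INR (size r)) * a.
Proof.
elim: r => [|i r IH]; rewrite ?big_nil ?big_cons ?IH; first by rewrite /=; ring.
by rewrite INR_size_cons RtoC_plus; ring.
Qed.

Lemma perm_sub_cat (I : eqType) (L0 L : seq I) :
  uniq L0 -> uniq L -> {subset L0 <= L} ->
  perm_eq L (L0 ++ [seq i <- L | i \notin L0]).
Proof.
move=> u0 u sub; apply: uniq_perm => //.
  rewrite cat_uniq u0 filter_uniq // andbT; apply/hasPn => x.
  by rewrite mem_filter => /andP[].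
move=> x; rewrite mem_cat mem_filter.
by case: (boolP (x \in L0)) => //= /sub.
Qed.

Lemma rsum_sub (I : eqType) (L0 L : seq I) (f : I -> R) :
  (forall i, 0 <= f i)%R -> uniq L0 -> uniq L -> {subset L0 <= L} ->
  (\rsum_(i <- L0) f i <= \rsum_(i <- L) f i)%R.
Proof.
move=> f0 u0 u sub; rewrite (perm_big _ (perm_sub_cat u0 u sub)) /= big_cat /=.
by have := @rsum_ge0 _ [seq i <- L | i \notin L0] _ f0; lra.
Qed.

(** Absolute convergence without an enumeration: one bound serves all duplicate-free finite lists.
    Integers, pairs and sum types are thus on the same footing. *)
Definition summable (I : eqType) (f : I -> C) : Prop :=
  exists M : R, forall L : seq I, uniq L -> (\rsum_(i <- L) Cmod (f i) <= M)%R.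

(** Convergence along the net of finite sets ordered by inclusion, which no bijection of the index
    type can affect. *)
Definition has_sum (I : eqType) (f : I -> C) (s : C) : Prop :=
  forall eps : R, (0 < eps)%R -> exists L0 : seq I, forall L : seq I,
    uniq L -> {subset L0 <= L} -> (Cmod (\csum_(i <- L) f i - s)%C < eps)%R.

Definition tsum (I : eqType) (f : I -> C) : C :=
  ClassicalEpsilon.epsilon (inhabits (RtoC 0)) (has_sum f).

Lemma Cmod_sub_sym (a b : C) : Cmod (a - b) = Cmod (b - a).
Proof. by rewrite -Cmod_opp; congr Cmod; ring. Qed.

Lemma Cmod_eq_of_small (a b : C) :
  (forall eps : R, (0 < eps)%R -> (Cmod (a - b)%C <= eps)%R) -> a = b.
Proof.
move=> H; have E : a - b = 0.
  apply: Cmod_eq_0; case: (Rle_lt_or_eq_dec _ _ (Cmod_ge_0 (a - b))) => // lt0.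
  by have := H (Cmod (a - b) / 2)%R; lra.
have -> : a = b + (a - b) by ring.
by rewrite E; ring.
Qed.

Lemma has_sum_unique (I : eqType) (f : I -> C) (s t : C) :
  has_sum f s -> has_sum f t -> s = t.
Proof.
move=> Hs Ht; apply: Cmod_eq_of_small => eps e0.
have [L1 H1] := Hs (eps / 2)%R ltac:(lra).
have [L2 H2] := Ht (eps / 2)%R ltac:(lra).
pose L := undup (L1 ++ L2).
have s1 : {subset L1 <= L} by move=> x h; rewrite mem_undup mem_cat h.
have s2 : {subset L2 <= L} by move=> x h; rewrite mem_undup mem_cat h orbT.
have := H1 L (undup_uniq _) s1; have := H2 L (undup_uniq _) s2.
set S := \csum_(i <- L) f i => h2 h1.
have -> : s - t = (S - t) + (s - S) by ring.
have := Cmod_triangle (S - t) (s - S); rewrite (Cmod_sub_sym s S); lra.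
Qed.

Lemma has_sum_ext (I : eqType) (f g : I -> C) (s : C) :
  (forall i, f i = g i) -> has_sum f s -> has_sum g s.
Proof.
move=> fg H eps e0; have [L0 HL] := H eps e0; exists L0 => L u sub.
have -> : \csum_(i <- L) g i = \csum_(i <- L) f i by apply: eq_bigr => i _.
exact: HL.
Qed.

Lemma summable_le (I : eqType) (f g : I -> C) :
  (forall i, Cmod (f i) <= Cmod (g i))%R -> summable g -> summable f.
Proof.
move=> fg [M H]; exists M => L /H; have := rsum_le L fg; lra.
Qed.

Lemma summable_ext (I : eqType) (f g : I -> C) :
  (forall i, f i = g i) -> summable f -> summable g.
Proof. by move=> fg; apply: summable_le => i; rewrite fg; lra. Qed.

Lemma summable_scal (I : eqType) (a : C) (f : I -> C) :
  summable f -> summable (fun i => a * f i).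
Proof.
move=> [M H]; exists (Cmod a * M)%R => L /H h.
rewrite (eq_bigr (fun i => Cmod a * Cmod (f i))%R) => [|i _]; last exact: Cmod_mult.
by rewrite rsum_mull; apply: Rmult_le_compat_l => //; apply: Cmod_ge_0.
Qed.

Lemma has_sum_add (I : eqType) (f g : I -> C) (s t : C) :
  has_sum f s -> has_sum g t -> has_sum (fun i => f i + g i) (s + t).
Proof.
move=> Hf Hg eps e0.
have [L1 H1] := Hf (eps / 2)%R ltac:(lra).
have [L2 H2] := Hg (eps / 2)%R ltac:(lra).
exists (L1 ++ L2) => L u sub.
have h1 := H1 L u (fun x h => sub x ltac:(by rewrite mem_cat h)).
have h2 := H2 L u (fun x h => sub x ltac:(by rewrite mem_cat h orbT)).
rewrite big_split /=; move: h1 h2.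
set S := \big[_/_]_(i <- L) f i; set T := \big[_/_]_(i <- L) g i => h1 h2.
have -> : S + T - (s + t) = (S - s) + (T - t) by ring.
have := Cmod_triangle (S - s) (T - t); lra.
Qed.

Lemma has_sum_scal (I : eqType) (a : C) (f : I -> C) (s : C) :
  has_sum f s -> has_sum (fun i => a * f i) (a * s).
Proof.
move=> H eps e0; have a0 := Cmod_ge_0 a.
have e1 : (0 < eps / (Cmod a + 1))%R by apply: Rdiv_lt_0_compat; lra.
have [L0 HL] := H _ e1; exists L0 => L u sub.
have h := HL L u sub; rewrite csum_mull.
have -> (S : C) : a * S - a * s = a * (S - s) by ring.
rewrite Cmod_mult; set X := Cmod _ in h *.
have X0 : (0 <= X)%R by apply: Cmod_ge_0.
have := Rmult_lt_compat_l (Cmod a + 1) _ _ ltac:(lra) h.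
have -> : ((Cmod a + 1) * (eps / (Cmod a + 1)) = eps)%R by field; lra.
nra.
Qed.

Lemma has_sum_sub (I : eqType) (f g : I -> C) (s t : C) :
  has_sum f s -> has_sum g t -> has_sum (fun i => f i - g i) (s - t).
Proof.
move=> Hf Hg; have := has_sum_add Hf (has_sum_scal (-1) Hg).
have -> : s + -1 * t = s - t by ring.
by apply: has_sum_ext => i; ring.
Qed.

(** The sum is the supremum of the finite subsums: a list that comes within [eps] of it can only get
    closer when enlarged. *)
Lemma nonneg_has_sum (I : eqType) (f : I -> R) (M : R) :
  (forall i, 0 <= f i)%R ->
  (forall L : seq I, uniq L -> (\rsum_(i <- L) f i <= M)%R) ->
  exists s : R, has_sum (fun i => RtoC (f i)) (RtoC s).
Proof.
move=> f0 H; pose E x := exists2 L : seq I, uniq L & x = (\rsum_(i <- L) f i)%R.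
have bE : bound E by exists M => x [L /H h ->].
have exE : exists x, E x by exists R0, [::] => //; rewrite big_nil.
have [s [ub lub]] := completeness E bE exE.
exists s => eps e0.
have [L0 u0 h0] : exists2 L0 : seq I, uniq L0 & (s - eps < \rsum_(i <- L0) f i)%R.
  case: (classic (exists2 L0 : seq I, uniq L0 & (s - eps < \rsum_(i <- L0) f i)%R)) => // N.
  have : (s <= s - eps)%R; last lra.
  apply: lub => x [L u ->]; case: (Rle_lt_dec (\rsum_(i <- L) f i) (s - eps)) => // h.
  by case: N; exists L.
exists L0 => L u sub.
have -> : \csum_(i <- L) RtoC (f i) = RtoC (\rsum_(i <- L) f i)%R.
  by elim: (L) => [|i r IH]; rewrite ?big_nil ?big_cons // IH RtoC_plus.
rewrite -RtoC_minus Cmod_R.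
have h1 : (\rsum_(i <- L) f i <= s)%R by apply: ub; exists L.
have h2 := rsum_sub f0 u0 u sub.
rewrite Rabs_left1; lra.
Qed.

Lemma real_has_sum (I : eqType) (f : I -> R) :
  summable (fun i => RtoC (f i)) -> exists s : C, has_sum (fun i => RtoC (f i)) s.
Proof.
move=> [M H].
have H' L (u : uniq L) : (\rsum_(i <- L) Rabs (f i) <= M)%R.
  by have := H L u; under eq_bigr do rewrite Cmod_R.
have [s Hs] := @nonneg_has_sum I (fun i => Rabs (f i)) M (fun i => Rabs_pos _) H'.
(* f is the difference of the nonnegative families |f| + f and |f|, the first of which is at most 2
   |f|. *)
have [|L u|t Ht] := @nonneg_has_sum I (fun i => Rabs (f i) + f i)%R (2 * M)%R.
- by move=> i; case: (Rabs_def2 (f i) (Rabs (f i) + 1)); split_Rabs; lra.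
- have : (\rsum_(i <- L) (Rabs (f i) + f i) <= \rsum_(i <- L) (2 * Rabs (f i)))%R.
    by apply: rsum_le => i; split_Rabs; lra.
  by rewrite rsum_mull; have := H' L u; lra.
- exists (RtoC t - RtoC s); apply: has_sum_ext (has_sum_sub Ht Hs) => i.
  by rewrite RtoC_plus; ring.
Qed.

Lemma Cmod_Re_le (z : C) : (Rabs (Re z) <= Cmod z)%R.
Proof. exact: re_le_Cmod. Qed.

Lemma Cmod_Im_le (z : C) : (Rabs (Im z) <= Cmod z)%R.
Proof.
apply: Rle_trans (Rmax_Cmod z); exact: Rmax_r.
Qed.

Lemma C_ReIm (z : C) : z = RtoC (Re z) + Ci * RtoC (Im z).
Proof. by case: z => a b; apply: injective_projections => /=; ring. Qed.

Lemma summable_has_sum (I : eqType) (f : I -> C) :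
  summable f -> exists s : C, has_sum f s.
Proof.
move=> Sf.
have [|s Hs] := @real_has_sum I (fun i => Re (f i)).
  by apply: summable_le Sf => i; rewrite Cmod_R; apply: Cmod_Re_le.
have [|t Ht] := @real_has_sum I (fun i => Im (f i)).
  by apply: summable_le Sf => i; rewrite Cmod_R; apply: Cmod_Im_le.
exists (s + Ci * t); apply: has_sum_ext (has_sum_add Hs (has_sum_scal Ci Ht)) => i.
by rewrite -C_ReIm.
Qed.

Lemma tsumP (I : eqType) (f : I -> C) : summable f -> has_sum f (tsum f).
Proof. by move=> /summable_has_sum Hf; apply: ClassicalEpsilon.epsilon_spec. Qed.

Lemma tsum_eq (I : eqType) (f : I -> C) (s : C) : has_sum f s -> tsum f = s.
Proof.
by move=> H; apply: (has_sum_unique _ H); apply: ClassicalEpsilon.epsilon_spec; exists s.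
Qed.

(** A termwise estimate on finite lists passes to the limit; this is how infinite sums are bounded
    from here on. *)
Lemma has_sum_Cmod_le (I : eqType) (f : I -> C) (s : C) (M : R) :
  has_sum f s -> (forall L : seq I, uniq L -> \rsum_(i <- L) Cmod (f i) <= M)%R ->
  (Cmod s <= M)%R.
Proof.
move=> H HM; apply: Rnot_lt_le => lt.
have [L0 HL] := H (Cmod s - M)%R ltac:(lra).
have sub : {subset L0 <= undup L0} by move=> x; rewrite mem_undup.
have h := HL _ (undup_uniq L0) sub.
have h1 := HM _ (undup_uniq L0); have h2 := Cmod_csum (undup L0) f.
move: h h2; set S := \big[Cplus/_]_(i <- _) _ => h h2.
have := Cmod_triangle (s - S) S; rewrite -Cmod_sub_sym in h.
have -> : s - S + S = s by ring.
lra.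
Qed.

Lemma map_inj_subset (I J : eqType) (p : J -> I) (q : I -> J) (L0 : seq I)
  (L : seq J) : cancel q p -> {subset map q L0 <= L} -> {subset L0 <= map p L}.
Proof.
move=> qp sub x x0; apply/mapP; exists (q x); rewrite ?qp //.
by apply: sub; apply: map_f.
Qed.

Lemma has_sum_reindex (I J : eqType) (p : J -> I) (q : I -> J) (f : I -> C) (s : C) :
  cancel p q -> cancel q p -> has_sum f s -> has_sum (fun j => f (p j)) s.
Proof.
move=> pq qp H eps e0; have [L0 HL] := H eps e0; exists (map q L0) => L u sub.
rewrite -(big_map p xpredT f); apply: HL.
  by rewrite map_inj_uniq //; apply: can_inj pq.
exact: map_inj_subset qp sub.
Qed.

Lemma summable_inj (I J : eqType) (p : J -> I) (f : I -> C) :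
  injective p -> summable f -> summable (fun j => f (p j)).
Proof.
move=> pi [M H]; exists M => L u.
rewrite -(big_map p xpredT (fun i => Cmod (f i))); apply: H.
by rewrite map_inj_uniq.
Qed.

Lemma has_sum_finite (I : eqType) (f : I -> C) (L0 : seq I) :
  uniq L0 -> (forall i, i \notin L0 -> f i = 0) ->
  has_sum f (\csum_(i <- L0) f i).
Proof.
move=> u0 f0 eps e0; exists L0 => L u sub.
rewrite (perm_big _ (perm_sub_cat u0 u sub)) /= big_cat /= big_filter.
rewrite [X in _ + X]big1 //.
have -> (S : C) : S + 0 - S = 0 by ring.
by rewrite Cmod_0.
Qed.

(** * Sums over disjoint unions, products and fibres *)

Definition lefts (I J : Type) (L : seq (I + J)) : seq I :=
  pmap (fun u => match u with inl i => Some i | _ => None end) L.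
Definition rights (I J : Type) (L : seq (I + J)) : seq J :=
  pmap (fun u => match u with inr i => Some i | _ => None end) L.

Lemma mem_lefts (I J : eqType) (L : seq (I + J)) i : (i \in lefts L) = (inl i \in L).
Proof.
by elim: L => //= -[x|x] L IH; rewrite ?in_cons ?IH //=.
Qed.

Lemma mem_rights (I J : eqType) (L : seq (I + J)) i : (i \in rights L) = (inr i \in L).
Proof.
by elim: L => //= -[x|x] L IH; rewrite ?in_cons ?IH //=.
Qed.

Lemma lefts_uniq (I J : eqType) (L : seq (I + J)) : uniq L -> uniq (lefts L).
Proof.
by elim: L => //= -[x|x] L IH /andP[h /IH u] //=; rewrite u mem_lefts h.
Qed.

Lemma rights_uniq (I J : eqType) (L : seq (I + J)) : uniq L -> uniq (rights L).
Proof.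
by elim: L => //= -[x|x] L IH /andP[h /IH u] //=; rewrite u mem_rights h.
Qed.

Lemma csum_lefts_rights (I J : Type) (f : I + J -> C) (L : seq (I + J)) :
  \csum_(k <- L) f k
  = \csum_(i <- lefts L) f (inl i) + \csum_(j <- rights L) f (inr j).
Proof.
elim: L => [|[x|x] L IH]; rewrite /= ?big_nil ?big_cons ?IH; ring.
Qed.

Lemma rsum_lefts_rights (I J : Type) (f : I + J -> R) (L : seq (I + J)) :
  (\rsum_(k <- L) f k
  = \rsum_(i <- lefts L) f (inl i) + \rsum_(j <- rights L) f (inr j))%R.
Proof.
elim: L => [|[x|x] L IH]; rewrite /= ?big_nil ?big_cons ?IH; ring.
Qed.

Lemma has_sum_sum (I J : eqType) (f : I + J -> C) (s t : C) :
  has_sum (fun i => f (inl i)) s -> has_sum (fun j => f (inr j)) t ->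
  has_sum f (s + t).
Proof.
move=> H1 H2 eps e0.
have [L1 h1] := H1 (eps / 2)%R ltac:(lra).
have [L2 h2] := H2 (eps / 2)%R ltac:(lra).
exists (map inl L1 ++ map inr L2) => L u sub.
have s1 : {subset L1 <= lefts L}.
  by move=> x hx; rewrite mem_lefts; apply: sub; rewrite mem_cat (map_f inl hx).
have s2 : {subset L2 <= rights L}.
  by move=> x hx; rewrite mem_rights; apply: sub; rewrite mem_cat (map_f inr hx) orbT.
rewrite csum_lefts_rights; move: (h1 _ (lefts_uniq u) s1) (h2 _ (rights_uniq u) s2).
set S := \big[_/_]_(i <- _) _; set T := \big[_/_]_(i <- _) _ => k1 k2.
have -> : S + T - (s + t) = (S - s) + (T - t) by ring.
have := Cmod_triangle (S - s) (T - t); lra.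
Qed.

Lemma summable_sum (I J : eqType) (f : I + J -> C) :
  summable (fun i => f (inl i)) -> summable (fun j => f (inr j)) -> summable f.
Proof.
move=> [M H] [N K]; exists (M + N)%R => L u; rewrite rsum_lefts_rights.
have := H _ (lefts_uniq u); have := K _ (rights_uniq u); lra.
Qed.

Lemma csum_allpairs (I J : Type) (f : I * J -> C) (L : seq I) (K : seq J) :
  \csum_(k <- [seq (i, j) | i <- L, j <- K]) f k
  = \csum_(i <- L) \csum_(j <- K) f (i, j).
Proof. by rewrite big_allpairs. Qed.

(** Finitely many rows allow a common list of columns; this produces the rectangles for the Fubini
    lemmas. *)
Lemma common_inner (I J : eqType) (f : I * J -> C) (g : I -> C) (eps : R) (L : seq I)
  (K0 : seq J) :
  (forall i, has_sum (fun j => f (i, j)) (g i)) -> (0 < eps)%R ->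
  exists K : seq J, [/\ uniq K, {subset K0 <= K} &
    forall i, i \in L -> (Cmod (\csum_(j <- K) f (i, j) - g i)%C < eps)%R].
Proof.
move=> H e0.
suff [K1 h] : exists K1 : seq J, forall K, uniq K -> {subset K1 <= K} ->
    forall i, i \in L -> (Cmod (\csum_(j <- K) f (i, j) - g i)%C < eps)%R.
  exists (undup (K0 ++ K1)); split; first exact: undup_uniq.
    by move=> x hx; rewrite mem_undup mem_cat hx.
  apply: h; first exact: undup_uniq.
  by move=> x hx; rewrite mem_undup mem_cat hx orbT.
elim: L => [|i L [K1 IH]]; first by exists [::].
have [K2 h2] := H i eps e0; exists (K1 ++ K2) => K u sub j.
rewrite in_cons => /orP[/eqP ->|jL].
  by apply: h2 => // x hx; apply: sub; rewrite mem_cat hx orbT.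
by apply: IH => // x hx; apply: sub; rewrite mem_cat hx.
Qed.

Lemma allpairs_uniq_pair (I J : eqType) (L : seq I) (K : seq J) :
  uniq L -> uniq K -> uniq [seq (i, j) | i <- L, j <- K].
Proof. by move=> uL uK; apply: allpairs_uniq => // -[a b] [c d] _ _. Qed.

Lemma csum_small (I : eqType) (L : seq I) (f g : I -> C) (eps : R) :
  (forall i, i \in L -> Cmod (f i - g i)%C < eps)%R ->
  (Cmod (\csum_(i <- L) f i - \csum_(i <- L) g i)%C <= INR (size L) * eps)%R.
Proof.
elim: L => [|i L IH] H.
  rewrite !big_nil (_ : 0 - 0 = 0); last ring.
  by rewrite Cmod_0 /=; lra.
rewrite !big_cons INR_size_cons.
have h1 := H i (mem_head _ _).
have h2 := IH (fun j hj => H j ltac:(by rewrite in_cons hj orbT)).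
move: h2; set S := \big[_/_]_(i <- _) _; set T := \big[_/_]_(i <- _) _ => h2.
have -> : f i + S - (g i + T) = (f i - g i) + (S - T) by ring.
have := Cmod_triangle (f i - g i) (S - T); lra.
Qed.

(** A rectangle that contains [L0] has a sum close to [s]; it is also close to the sum of [g] over
    [L], because each row is within [d] of its own sum. *)
Lemma has_sum_fubini (I J : eqType) (f : I * J -> C) (g : I -> C) (s : C) :
  has_sum f s -> (forall i, has_sum (fun j => f (i, j)) (g i)) -> has_sum g s.
Proof.
move=> H Hg eps e0; have [L0 h0] := H (eps / 2)%R ltac:(lra).
exists (map fst L0) => L u sub.
(* The rows together contribute less than [eps / 2]; the [+ 1] covers the empty list. *)
pose d := (eps / 2 / (INR (size L) + 1))%R; have n0 := pos_INR (size L).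
have d0 : (0 < d)%R by apply: Rdiv_lt_0_compat; lra.
have [K [uK sK hK]] := common_inner L (map snd L0) Hg d0.
have sub0 : {subset L0 <= [seq (i, j) | i <- L, j <- K]}.
  move=> [a b] hx; apply/allpairsP; exists (a, b); split=> //=.
    by apply: sub; apply: (map_f fst hx).
  by apply: sK; apply: (map_f snd hx).
have := csum_small hK; move: (h0 _ (allpairs_uniq_pair u uK) sub0).
rewrite csum_allpairs.
set S := \big[_/_]_(i <- _) _; set T := \big[_/_]_(i <- _) _ => h1 h2.
have -> : T - s = (S - s) + (T - S) by ring.
have := Cmod_triangle (S - s) (T - S); rewrite (Cmod_sub_sym T S).
have : (INR (size L) * d < eps / 2)%R; last lra.
have -> : (eps / 2 = (INR (size L) + 1) * d)%R by rewrite /d; field; lra.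
nra.
Qed.

Lemma summable_fubini (I J : eqType) (f : I * J -> C) (g : I -> C) :
  summable f -> (forall i, has_sum (fun j => f (i, j)) (g i)) -> summable g.
Proof.
(* The additional 1 pays for replacing the row sums by finite ones. *)
move=> [M H] Hg; exists (M + 1)%R => L u.
pose d := (1 / (INR (size L) + 1))%R; have n0 := pos_INR (size L).
have d0 : (0 < d)%R by apply: Rdiv_lt_0_compat; lra.
have [K [uK _ hK]] := common_inner L [::] Hg d0.
have := H _ (allpairs_uniq_pair u uK); rewrite big_allpairs /= => h.
have h2 : (\rsum_(i <- L) Cmod (g i) <= \rsum_(i <- L) (\rsum_(j <- K) Cmod (f (i, j))
    + d))%R.
  apply: rsum_le_in => i /hK; set S := \big[_/_]_(j <- _) _ => hS.
  have := Cmod_triangle (g i - S) S; rewrite (Cmod_sub_sym (g i)).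
  have -> : g i - S + S = g i by ring.
  have := Cmod_csum K (fun j => f (i, j)); rewrite -/S; lra.
rewrite big_split /= rsum_const in h2.
have : (INR (size L) * d <= 1)%R; last lra.
have -> : (1 = (INR (size L) + 1) * d)%R by rewrite /d; field; lra.
nra.
Qed.

Lemma rsum_prod (I J : Type) (f : I -> R) (g : J -> R) (L : seq I) (K : seq J) :
  (\rsum_(k <- [seq (i, j) | i <- L, j <- K]) (f k.1 * g k.2)
   = (\rsum_(i <- L) f i) * (\rsum_(j <- K) g j))%R.
Proof.
rewrite big_allpairs /=; elim: L => [|i L IH]; rewrite ?big_nil ?big_cons ?IH.
  by rewrite Rmult_0_l.
by rewrite rsum_mull; ring.
Qed.

Lemma summable_prod (I J : eqType) (f : I -> C) (g : J -> C) :
  summable f -> summable g -> summable (fun k : I * J => f k.1 * g k.2).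
Proof.
move=> [M H] [N K]; exists (M * N)%R => L u.
pose L1 := undup (map fst L); pose L2 := undup (map snd L).
have h1 := H L1 (undup_uniq _); have h2 := K L2 (undup_uniq _).
have p1 := @rsum_ge0 _ L1 (fun i => Cmod (f i)) (fun i => Cmod_ge_0 _).
have p2 := @rsum_ge0 _ L2 (fun i => Cmod (g i)) (fun i => Cmod_ge_0 _).
apply: Rle_trans (Rmult_le_compat _ _ _ _ p1 p2 h1 h2).
rewrite -rsum_prod.
have -> : (\rsum_(k <- L) Cmod (f k.1 * g k.2)%C
           = \rsum_(k <- L) (Cmod (f k.1) * Cmod (g k.2)))%R.
  by apply: eq_bigr => i _; rewrite Cmod_mult.
apply: rsum_sub => //.
- by move=> i; apply: Rmult_le_pos; apply: Cmod_ge_0.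
- by apply: allpairs_uniq_pair; apply: undup_uniq.
- move=> [a b] hx; apply/allpairsP; exists (a, b).
  by rewrite !mem_undup (map_f fst hx) (map_f snd hx).
Qed.

Lemma has_sum_prod (I J : eqType) (f : I -> C) (g : J -> C) (s t : C) :
  summable f -> summable g -> has_sum f s -> has_sum g t ->
  has_sum (fun k : I * J => f k.1 * g k.2) (s * t).
Proof.
move=> Sf Sg Hf Hg; have := tsumP (summable_prod Sf Sg).
set r := tsum _ => Hr.
have := has_sum_fubini Hr (fun i => has_sum_scal (f i) Hg) => H1.
have H2 : has_sum (fun i => f i * t) (s * t).
  by rewrite Cmult_comm; apply: has_sum_ext (has_sum_scal t Hf) => i; ring.
by rewrite (has_sum_unique H2 H1).
Qed.

Lemma has_sum_swap (I J : eqType) (f : I * J -> C) (s : C) :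
  has_sum f s -> has_sum (fun k : J * I => f (k.2, k.1)) s.
Proof.
by apply: (@has_sum_reindex (I * J)%type (J * I)%type (fun k => (k.2, k.1)) (fun k => (k.2, k.1)));
  case.
Qed.

Lemma summable_swap (I J : eqType) (f : I * J -> C) :
  summable f -> summable (fun k : J * I => f (k.2, k.1)).
Proof. by apply: (@summable_inj (I * J)%type (J * I)%type) => -[a b] [c d] [-> ->]. Qed.

(** The family lives on the graph of [p], where each [i] occurs exactly once. *)
Lemma fiber_summable (I J : eqType) (p : I -> J) (f : I -> C) :
  summable f ->
  summable (fun k : J * I => if p k.2 == k.1 then f k.2 else 0).
Proof.
move=> [M H]; exists M => L u.
pose K := [seq k <- L | p k.2 == k.1].
have -> : (\rsum_(k <- L) Cmod (if p k.2 == k.1 then f k.2 else 0)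
  = \rsum_(i <- map snd K) Cmod (f i))%R.
  rewrite big_map /K; elim: (L) => [|k r IH]; rewrite ?big_nil // big_cons IH /=.
  by case: ifP => h; rewrite ?big_cons ?h ?Cmod_0 ?Rplus_0_l.
apply: H; rewrite map_inj_in_uniq ?filter_uniq // => -[a b] [c d] /=.
by rewrite !mem_filter => /andP[/= /eqP <- _] /andP[/= /eqP <- _] ->.
Qed.

(** Fubini in both orders over the graph of [p]: summation over [i] first gives [g], summation over
    [j] first gives [f] back. Grouping by i + j yields Cauchy products, grouping by a^2 + b^2 yields
    [r2]. *)
Lemma has_sum_fiber (I J : eqType) (p : I -> J) (f : I -> C) (g : J -> C) (s : C) :
  summable f -> has_sum f s ->
  (forall j, has_sum (fun i => if p i == j then f i else 0) (g j)) ->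
  has_sum g s.
Proof.
move=> Sf Hf Hg; have S := fiber_summable p Sf.
have := tsumP S; set r := tsum _ => Hr.
have H1 := has_sum_fubini Hr Hg.
have H2 : has_sum f r.
  apply: has_sum_fubini (has_sum_swap Hr) _ => i /=.
  have := @has_sum_finite _ (fun j => if p i == j then f i else 0) [:: p i] isT.
  rewrite big_seq1 eqxx; apply=> j.
  by rewrite inE eq_sym => /negbTE ->.
by rewrite (has_sum_unique Hf H2).
Qed.

Lemma Cmod_minus_triangle (a b : C) : (Cmod (a - b) <= Cmod a + Cmod b)%R.
Proof. by have := Cmod_triangle a (- b); rewrite Cmod_opp. Qed.

Lemma csum_add I (r : seq I) (f g : I -> C) :
  \csum_(i <- r) (f i + g i) = \csum_(i <- r) f i + \csum_(i <- r) g i.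
Proof. exact: big_split. Qed.

Lemma csum_recr (f : nat -> C) (n : nat) :
  \csum_(0 <= i < n.+1) f i = \csum_(0 <= i < n) f i + f n.
Proof. exact: big_nat_recr. Qed.

Lemma csum_recl (f : nat -> C) (n : nat) :
  \csum_(0 <= i < n.+1) f i = f 0%nat + \csum_(0 <= i < n) f i.+1.
Proof. exact: big_nat_recl. Qed.

Lemma rsum_recr (f : nat -> R) (n : nat) :
  (\big[Rplus/R0]_(0 <= i < n.+1) f i = \big[Rplus/R0]_(0 <= i < n) f i + f n)%R.
Proof. exact: big_nat_recr. Qed.

(** * Comparison with the series of the definitions, and basic summable families *)

Lemma sum_n_csum (f : nat -> C) (n : nat) :
  @sum_n C_AbelianMonoid f n = \csum_(0 <= i < n.+1) f i.
Proof.
elim: n => [|n IH]; first by rewrite sum_O big_nat1.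
by rewrite csum_recr sum_Sn IH.
Qed.

Lemma uniq_index_iota m n : uniq (index_iota m n).
Proof. exact: iota_uniq. Qed.

Lemma sub_iota_bound (L : seq nat) : exists N, forall n, (N <= n)%nat ->
  {subset L <= index_iota 0 n}.
Proof.
elim: L => [|x L [N H]]; first by exists 0%nat.
exists (maxn x.+1 N) => n; rewrite geq_max => /andP[h1 h2] y.
rewrite in_cons => /orP[/eqP ->|]; last exact: H.
by rewrite mem_index_iota.
Qed.

Lemma has_sum_is_series (f : nat -> C) (s : C) :
  has_sum f s -> @is_series C_AbsRing C_NormedModule f s.
Proof.
move=> H; apply/filterlim_locally_ball_norm => eps.
have [L0 HL] := H eps (cond_pos eps); have [N HN] := sub_iota_bound L0.
exists N => n hn; change (Cmod (sum_n f n - s) < eps)%R.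
have := HL (index_iota 0 n.+1) (uniq_index_iota _ _) (HN n.+1 ltac:(lia)).
by rewrite -sum_n_csum.
Qed.

Lemma has_sum_Re_series (f : nat -> C) (s : C) :
  has_sum f s -> is_series (fun n => Re (f n)) (Re s).
Proof.
move=> /has_sum_is_series H.
have /filterlim_locally_ball_norm {}H := H.
apply/filterlim_locally_ball_norm => eps; have [N HN] := H eps; exists N => n /HN.
move=> h; have {h} : (Cmod (sum_n f n - s) < eps)%R by [].
apply: Rle_lt_trans; apply: Rle_trans (Cmod_Re_le _).
change (Rabs (sum_n (fun k => Re (f k)) n - Re s) <= Rabs (Re (sum_n f n - s)%C))%R.
suff -> : sum_n (fun k => Re (f k)) n = Re (sum_n f n) by exact: Rle_refl.
elim: (n) => [|m IH]; first by rewrite !sum_O.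
by rewrite !sum_Sn IH.
Qed.

Lemma has_sum_Im_series (f : nat -> C) (s : C) :
  has_sum f s -> is_series (fun n => Im (f n)) (Im s).
Proof.
move=> H; have := has_sum_Re_series (has_sum_scal (- Ci) H).
have E (z : C) : Re (- Ci * z) = Im z by case: z => a b /=; ring.
rewrite E; apply: is_series_ext => n; exact: E.
Qed.

Lemma has_sum_CSeries (f : nat -> C) (s : C) : has_sum f s -> CSeries f = s.
Proof.
move=> H; rewrite /CSeries (is_series_unique _ _ (has_sum_Re_series H)).
by rewrite (is_series_unique _ _ (has_sum_Im_series H)); case: (s).
Qed.

Definition Z_of_halves (u : nat + nat) : Z :=
  match u with inl n => Z.of_nat n | inr n => (- Z.of_nat (S n))%Z end.
Definition halves_of_Z (z : Z) : nat + nat :=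
  if (0 <=? z)%Z then inl (Z.to_nat z) else inr (Z.to_nat (- z - 1)).

Lemma Z_of_halvesK : cancel Z_of_halves halves_of_Z.
Proof.
case=> n; rewrite /Z_of_halves /halves_of_Z; case: Z.leb_spec => h.
- by congr inl; lia.
- by exfalso; lia.
- by exfalso; lia.
- by congr inr; lia.
Qed.

Lemma halves_of_ZK : cancel halves_of_Z Z_of_halves.
Proof. by move=> z; rewrite /halves_of_Z; case: Z.leb_spec => h /=; lia. Qed.

Lemma has_sum_CSeriesZ (f : Z -> C) (s : C) :
  summable f -> has_sum f s -> CSeriesZ f = s.
Proof.
move=> Sf Hf.
have Sh := summable_inj (can_inj Z_of_halvesK) Sf.
have inl_inj : injective (@inl nat nat) by move=> a b [].
have inr_inj : injective (@inr nat nat) by move=> a b [].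
have H1 := tsumP (summable_inj inl_inj Sh).
have H2 := tsumP (summable_inj inr_inj Sh).
rewrite /CSeriesZ (has_sum_CSeries H1) (has_sum_CSeries H2).
apply: has_sum_unique (has_sum_sum (f := fun u => f (Z_of_halves u)) H1 H2) _.
exact: has_sum_reindex Z_of_halvesK halves_of_ZK Hf.
Qed.

Lemma summable_Z (f : Z -> C) :
  summable (fun n => f (Z.of_nat n)) -> summable (fun n => f (- Z.of_nat (S n))%Z) ->
  summable f.
Proof.
move=> S1 S2; pose g u := f (Z_of_halves u).
have Sg : summable g by apply: summable_sum.
apply: summable_ext (summable_inj (can_inj halves_of_ZK) Sg) => z.
by rewrite /g halves_of_ZK.
Qed.

Lemma summable_nat (f : nat -> C) (M : R) :
  (forall n, (\big[Rplus/R0]_(0 <= i < n) Cmod (f i) <= M)%R) -> summable f.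
Proof.
move=> H; exists M => L u; have [N HN] := sub_iota_bound L.
apply: Rle_trans (H N); apply: rsum_sub (HN N (leqnn N)) => //.
- by move=> i; apply: Cmod_ge_0.
- exact: uniq_index_iota.
Qed.

(** Telescoping against 3 / (n + 1): the inequality 1 / (1 + n^2) <= 3 / ((n + 1) (n + 2)) amounts
    to (2 n - 1) (n - 1) >= 0, which holds at every natural number. *)
Lemma summable_inv_sq_nat : summable (fun n : nat => RtoC (/ (1 + INR n ^ 2))).
Proof.
apply: (@summable_nat _ 3) => n.
suff : (\big[Rplus/R0]_(0 <= i < n) Cmod (RtoC (/ (1 + INR i ^ 2))) <=
        3 - 3 / (INR n + 1))%R.
  have n0 := pos_INR n; have h : (0 < 3 / (INR n + 1))%R.
    by apply: Rdiv_lt_0_compat; lra.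
  lra.
elim: n => [|n IH]; first by rewrite big_geq /=; [lra|].
rewrite rsum_recr Cmod_R.
have n0 := pos_INR n.
have h : (0 < 1 + INR n ^ 2)%R by nra.
rewrite Rabs_pos_eq; last by apply/Rlt_le/Rinv_0_lt_compat.
have -> : INR n.+1 = (INR n + 1)%R by rewrite S_INR.
suff : (/ (1 + INR n ^ 2) <= 3 / (INR n + 1) - 3 / (INR n + 1 + 1))%R by lra.
have -> : (3 / (INR n + 1) - 3 / (INR n + 1 + 1) = / ((INR n + 1) * (INR n + 2) / 3))%R.
  by field; lra.
apply: Rinv_le_contravar; first by nra.
have : (0 <= (2 * INR n - 1) * (INR n - 1))%R; last nra.
case: n {IH h n0} => [|[|n]]; rewrite /= ?S_INR; [lra|lra|].
by have := pos_INR n; set t := INR n; case: (n) => *; nra.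
Qed.

Lemma summable_inv_sq_Z : summable (fun n : Z => RtoC (/ (1 + IZR n ^ 2))).
Proof.
apply: summable_Z.
  by apply: summable_ext summable_inv_sq_nat => n; rewrite -INR_IZR_INZ.
have Si : injective S by move=> a b [].
apply: summable_ext (summable_inj Si summable_inv_sq_nat) => n.
by rewrite opp_IZR -INR_IZR_INZ; congr RtoC; congr Rinv; ring.
Qed.

Lemma series_has_sum (f : nat -> R) (s : R) :
  summable (fun n => RtoC (f n)) -> is_series f s ->
  has_sum (fun n => RtoC (f n)) (RtoC s).
Proof.
move=> Sf Hs; have H := tsumP Sf; set t := tsum _ in H.
have h1 := is_series_unique _ _ (has_sum_Re_series H).
have h2 := is_series_unique _ _ (has_sum_Im_series H).
suff -> : RtoC s = t by [].
rewrite /= (is_series_unique _ _ Hs) in h1.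
rewrite [t]C_ReIm -h1 -h2 /=.
have -> : Series (fun _ : nat => 0%R) = 0%R.
  rewrite -[RHS](Rmult_0_l (Series (fun=> 0%R))) -Series_scal_l.
  by apply: Series_ext => n; rewrite Rmult_0_l.
ring.
Qed.

Lemma has_sum_cauchy (a b : nat -> C) (s t : C) :
  summable a -> summable b -> has_sum a s -> has_sum b t ->
  has_sum (fun n => \csum_(0 <= i < n.+1) (a i * b (n - i)%nat)) (s * t).
Proof.
move=> Sa Sb Ha Hb.
apply: (@has_sum_fiber _ _ (fun k : nat * nat => (k.1 + k.2)%nat) _ _ _
  (summable_prod Sa Sb) (has_sum_prod Sa Sb Ha Hb)) => n.
pose L := [seq (i, n - i)%nat | i <- index_iota 0 n.+1].
have uL : uniq L.
  by rewrite map_inj_uniq ?iota_uniq // => i j [].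
have := @has_sum_finite _ (fun k : nat * nat =>
  if (k.1 + k.2)%nat == n then a k.1 * b k.2 else 0) L uL.
rewrite big_map (eq_big_nat _ _ (F2 := fun i => a i * b (n - i)%nat)) /=.
  apply=> -[i j] /= h; case: eqP => // e; case/negP: h.
  by apply/mapP; exists i; rewrite ?mem_index_iota; [lia|congr pair; lia].
by move=> i hi; rewrite subnKC // eqxx.
Qed.

(** Divided powers turn the binomial theorem into a convolution without binomial coefficients. *)
Definition divpow (w : C) (n : nat) : C := w ^ n / RtoC (INR (fact n)).

(** * The complex exponential *)

Lemma INR_fact_C_neq0 (n : nat) : RtoC (INR (fact n)) <> 0.
Proof. by move=> /RtoC_inj; apply: INR_fact_neq_0. Qed.

Lemma INR_S_C_neq0 (n : nat) : RtoC (INR n.+1) <> 0.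
Proof. by move=> /RtoC_inj; apply: not_0_INR. Qed.

Lemma RtoC_INR_S (n : nat) : RtoC (INR n.+1) = RtoC (INR n) + 1.
Proof. by rewrite S_INR RtoC_plus. Qed.

Lemma RtoC_fact_S (n : nat) :
  RtoC (INR (fact n.+1)) = RtoC (INR n.+1) * RtoC (INR (fact n)).
Proof. by rewrite fact_simpl mult_INR RtoC_mult. Qed.

Lemma divpow_S (w : C) (n : nat) : RtoC (INR n.+1) * divpow w n.+1 = w * divpow w n.
Proof.
rewrite /divpow RtoC_fact_S Cpow_S; field; split.
  exact: INR_fact_C_neq0.
exact: INR_S_C_neq0.
Qed.

Lemma divpow_0 (w : C) : divpow w 0 = 1.
Proof. by rewrite /divpow /=; field. Qed.

Lemma Cmod_divpow (w : C) (n : nat) :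
  Cmod (divpow w n) = (Cmod w ^ n / INR (fact n))%R.
Proof.
rewrite /divpow Cmod_div; last exact: INR_fact_C_neq0.
by rewrite Cmod_pow Cmod_R Rabs_pos_eq //; apply: pos_INR.
Qed.

Lemma divpow_partial (x : R) (n : nat) : (0 <= x)%R ->
  (\big[Rplus/R0]_(0 <= i < n) (x ^ i / INR (fact i)) <= exp x)%R.
Proof.
move=> x0; case: n => [|n].
  by rewrite big_geq //; apply/Rlt_le/exp_pos.
suff -> : \big[Rplus/R0]_(0 <= i < n.+1) (x ^ i / INR (fact i))%R
          = sum_f_R0 (fun k => (x ^ k / INR (fact k))%R) n by exact: exp_ge_taylor.
elim: n => [|n IH]; first by rewrite big_nat1.
by rewrite rsum_recr IH.
Qed.

Lemma divpow_sum_le (w : C) (L : seq nat) : uniq L ->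
  (\rsum_(i <- L) Cmod (divpow w i) <= exp (Cmod w))%R.
Proof.
move=> u; have [N HN] := sub_iota_bound L.
apply: Rle_trans (divpow_partial N (Cmod_ge_0 w)).
rewrite (eq_bigr (fun i => Cmod w ^ i / INR (fact i))%R); last first.
  by move=> i _; exact: Cmod_divpow.
apply: rsum_sub u _ (HN N (leqnn N)); last exact: uniq_index_iota.
by move=> i; rewrite -Cmod_divpow; apply: Cmod_ge_0.
Qed.

Lemma summable_divpow (w : C) : summable (divpow w).
Proof. by exists (exp (Cmod w)) => L; apply: divpow_sum_le. Qed.

(** Induction after multiplication by n + 1 = i + (n + 1 - i): by [divpow_S] each part lowers one of
    the two exponents. *)
Lemma divpow_add (x y : C) (n : nat) :
  \csum_(0 <= i < n.+1) (divpow x i * divpow y (n - i)%nat)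
  = divpow (x + y) n.
Proof.
elim: n => [|n IH]; first by rewrite big_nat1 !divpow_0; ring.
set D := bigop _ _ _.
suff H : RtoC (INR n.+1) * D = RtoC (INR n.+1) * divpow (x + y) n.+1.
  have n0 := @INR_S_C_neq0 n.
  by rewrite -[D]Cmult_1_l -(Cinv_l _ n0) -Cmult_assoc H Cmult_assoc Cinv_l // Cmult_1_l.
rewrite divpow_S -IH Cmult_plus_distr_r.
have -> : RtoC (INR n.+1) * D =
  \csum_(0 <= i < n.+2) (RtoC (INR i) * divpow x i * divpow y (n.+1 - i)%nat)
  + \csum_(0 <= i < n.+2) (divpow x i * (RtoC (INR (n.+1 - i)%nat) * divpow y (n.+1 - i)%nat)).
  rewrite -csum_add -csum_mull; apply: eq_big_nat => i /andP[_ hi].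
  rewrite minus_INR; last by lia.
  by rewrite RtoC_minus; ring.
congr (_ + _).
  rewrite csum_recl /= -csum_mull.
  rewrite (_ : RtoC 0 * _ * _ = RtoC 0) ?Cplus_0_l; last ring.
  by apply: eq_bigr => i _; rewrite subSS -Cmult_assoc Cmult_assoc divpow_S; ring.
rewrite csum_recr subnn /= -csum_mull.
rewrite (_ : _ * (RtoC 0 * _) = RtoC 0) ?Cplus_0_r; last ring.
apply: eq_big_nat => i /andP[_ hi]; rewrite subSn // divpow_S; ring.
Qed.

Lemma has_sum_divpow_real (x : R) : has_sum (divpow (RtoC x)) (Cexp (RtoC x)).
Proof.
have E n : RtoC (x ^ n / INR (fact n))%R = divpow (RtoC x) n.
  by rewrite /divpow RtoC_div ?RtoC_pow //; apply: INR_fact_neq_0.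
have -> : Cexp (RtoC x) = RtoC (exp x).
  by rewrite /Cexp /= cos_0 sin_0 Rmult_1_r Rmult_0_r.
apply: (has_sum_ext E); apply: series_has_sum.
  by apply: summable_ext (summable_divpow (RtoC x)) => n; rewrite E.
have /is_pseries_R := is_exp_Reals x.
by apply: is_series_ext => n; rewrite Rmult_comm.
Qed.

Definition nat_of_parity (u : nat + nat) : nat :=
  match u with inl n => n.*2 | inr n => n.*2.+1 end.
Definition parity_of_nat (n : nat) : nat + nat :=
  if odd n then inr n./2 else inl n./2.
Lemma nat_of_parityK : cancel nat_of_parity parity_of_nat.
Proof.
by case=> n; rewrite /parity_of_nat /= ?odd_double //= ?doubleK ?uphalf_double.
Qed.

Lemma parity_of_natK : cancel parity_of_nat nat_of_parity.
Proof.
move=> n; rewrite /parity_of_nat; case: ifP => h /=; have := odd_double_half n; rewrite h; lia.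
Qed.

Lemma Ci_mul_sq (y : R) : (Ci * RtoC y) * (Ci * RtoC y) = RtoC (- (y * y)).
Proof. by apply: injective_projections => /=; ring. Qed.

Lemma divpow_even (y : R) (n : nat) :
  divpow (Ci * RtoC y) n.*2 = RtoC (cos_n n * (y²) ^ n)%R.
Proof.
rewrite /divpow /cos_n -mul2n Cpow_mult_r.
have -> : (Ci * RtoC y) ^ 2 = RtoC (- (y * y)).
  by rewrite -Ci_mul_sq; ring.
have -> : (- (y * y) = -1 * y²)%R by rewrite /Rsqr; ring.
rewrite -RtoC_pow -RtoC_div; last exact: INR_fact_neq_0.
rewrite Rpow_mult_distr; congr RtoC; rewrite /Rdiv -multE; ring.
Qed.

Lemma divpow_odd (y : R) (n : nat) :
  divpow (Ci * RtoC y) n.*2.+1 = Ci * RtoC y * RtoC (sin_n n * (y²) ^ n)%R.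
Proof.
rewrite /divpow /sin_n Cpow_S -mul2n Cpow_mult_r.
have -> : (Ci * RtoC y) ^ 2 = RtoC (- (y * y)).
  by rewrite -Ci_mul_sq; ring.
have -> : (- (y * y) = -1 * y²)%R by rewrite /Rsqr; ring.
have -> : ((2 * n)%coq_nat + 1)%coq_nat = (2 * n).+1 by lia.
have f0 := INR_fact_neq_0 (2 * n).+1.
rewrite /Cdiv -Cmult_assoc; congr (_ * _).
rewrite -RtoC_pow -/(Cdiv _ _) -RtoC_div //.
rewrite Rpow_mult_distr; congr RtoC; rewrite /Rdiv; ring.
Qed.

Lemma has_sum_divpow_imag (y : R) :
  has_sum (divpow (Ci * RtoC y)) (RtoC (cos y) + Ci * RtoC (sin y)).
Proof.
have Sp := summable_inj (can_inj nat_of_parityK) (summable_divpow (Ci * RtoC y)).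
suff H : has_sum (fun u => divpow (Ci * RtoC y) (nat_of_parity u))
    (RtoC (cos y) + Ci * RtoC (sin y)).
  have := has_sum_reindex (p := parity_of_nat) (q := nat_of_parity)
    parity_of_natK nat_of_parityK H.
  by apply: has_sum_ext => n; rewrite parity_of_natK.
have inl_inj : injective (@inl nat nat) by move=> a b [].
have inr_inj : injective (@inr nat nat) by move=> a b [].
have S1 := summable_inj inl_inj Sp; have S2 := summable_inj inr_inj Sp.
apply: has_sum_sum.
  have S1' : summable (fun n => RtoC (cos_n n * (y²) ^ n)%R).
    by apply: summable_ext S1 => n; exact: divpow_even.
  have : is_series (fun n => (cos_n n * (y²) ^ n)%R) (cos y).
    by rewrite /cos; case: exist_cos => a Ha /=; apply/is_series_Reals.
  move=> /(series_has_sum S1'); apply: has_sum_ext => n.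
  by rewrite -divpow_even.
(* The sine series is y times a series in y^2, whose summability is obtained by dividing by
   [Ci * y]; hence y = 0 is treated apart. *)
have [y0|y0] := Req_dec y 0.
  rewrite {}y0.
  rewrite sin_0 Cmult_0_r.
  have := @has_sum_finite nat (fun=> RtoC 0) [::] isT (fun _ _ => erefl).
  by rewrite big_nil; apply: has_sum_ext => n; rewrite /divpow [nat_of_parity _]/= Cpow_S /Cdiv !Cmult_0_l.
have iy0 : Ci * RtoC y <> 0.
  by move=> [_ h]; apply: y0; move: h; rewrite /=; lra.
have S2' : summable (fun n => RtoC (sin_n n * (y²) ^ n)%R).
  have := summable_scal (/ (Ci * RtoC y)) S2; apply: summable_ext => n.
  by rewrite [divpow _ _]divpow_odd Cmult_assoc Cinv_l // Cmult_1_l.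
have [a Ha Ea] : exists2 a, is_series (fun n => (sin_n n * (y²) ^ n)%R) a & sin y = (y * a)%R.
  rewrite /sin; case: exist_sin => a Ha /=; exists a => //; exact/is_series_Reals.
rewrite Ea RtoC_mult Cmult_assoc.
move: Ha => /(series_has_sum S2') /(has_sum_scal (Ci * RtoC y)); apply: has_sum_ext => n.
by rewrite -divpow_odd.
Qed.

(** Ties the definition by exp, cos and sin to the power series: w is split into its real and
    imaginary parts, and the two series are multiplied. *)
Lemma has_sum_Cexp (w : C) : has_sum (divpow w) (Cexp w).
Proof.
have -> : Cexp w = Cexp (RtoC (Re w)) * (RtoC (cos (Im w)) + Ci * RtoC (sin (Im w))).
  apply: injective_projections; rewrite /= cos_0 sin_0; ring.
have := has_sum_cauchy (summable_divpow _) (summable_divpow _)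
  (has_sum_divpow_real (Re w)) (has_sum_divpow_imag (Im w)).
by apply: has_sum_ext => n; rewrite divpow_add -C_ReIm.
Qed.

Lemma Cexp_add (a b : C) : Cexp (a + b) = Cexp a * Cexp b.
Proof.
have := has_sum_cauchy (summable_divpow _) (summable_divpow _)
  (has_sum_Cexp a) (has_sum_Cexp b).
move/(has_sum_ext (divpow_add a b)) => H.
exact: has_sum_unique (has_sum_Cexp _) H.
Qed.

Lemma Cexp_0 : Cexp 0 = 1.
Proof. by rewrite /Cexp /= exp_0 cos_0 sin_0 Rmult_1_r Rmult_0_r. Qed.

Lemma Cmod_Cexp (w : C) : Cmod (Cexp w) = exp (Re w).
Proof.
rewrite /Cmod /Cexp /=.
have -> : (exp (Re w) * cos (Im w) * (exp (Re w) * cos (Im w) * 1) +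
  exp (Re w) * sin (Im w) * (exp (Re w) * sin (Im w) * 1) =
  exp (Re w) * exp (Re w) * ((sin (Im w))² + (cos (Im w))²))%R by rewrite /Rsqr; ring.
rewrite sin2_cos2 Rmult_1_r; apply: sqrt_square; exact/Rlt_le/exp_pos.
Qed.

Lemma Cexp_neq0 (w : C) : Cexp w <> 0.
Proof. by move=> /(congr1 Cmod); rewrite Cmod_Cexp Cmod_0; have := exp_pos (Re w); lra. Qed.

Lemma Cexp_opp (w : C) : Cexp (- w) = / Cexp w.
Proof.
have h := @Cexp_neq0 w; have : Cexp (- w) * Cexp w = 1.
  rewrite -Cexp_add; have -> : - w + w = 0 by ring.
  exact: Cexp_0.
by move=> H; rewrite -[LHS]Cmult_1_r -(Cinv_r _ h) Cmult_assoc H Cmult_1_l.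
Qed.

Lemma Cexp_pow (w : C) (n : nat) : Cexp w ^ n = Cexp (RtoC (INR n) * w).
Proof.
elim: n => [|n IH]; first by rewrite /= Cmult_0_l Cexp_0.
by rewrite Cpow_S IH RtoC_INR_S -Cexp_add; congr Cexp; ring.
Qed.

Lemma has_sum_shift (f : nat -> C) (s : C) :
  has_sum f s -> has_sum (fun n => f n.+1) (s - f 0%nat).
Proof.
move=> H eps e0; have [L0 HL] := H eps e0.
exists (map predn L0) => L u sub.
have := HL (0%nat :: map S L) _ _; rewrite big_cons big_map.
have -> : f 0%nat + \csum_(i <- L) f i.+1 - s = \csum_(i <- L) f i.+1 - (s - f 0%nat) by ring.
apply.
  rewrite /= map_inj_uniq ?u ?andbT; last by move=> a b [].
  by apply/negP => /mapP[].
case=> [|x] hx; rewrite in_cons ?eqxx //; apply/orP; right.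
by apply: map_f; apply: sub; apply: (map_f predn hx).
Qed.

(** The tail beyond the linear term is w^2 times a series dominated by that of exp |w|, since n! <=
    (n + 2)!. *)
Lemma Cexp_taylor (w : C) :
  (Cmod (Cexp w - 1 - w) <= Cmod w ^ 2 * exp (Cmod w))%R.
Proof.
have := has_sum_shift (has_sum_shift (has_sum_Cexp w)); rewrite divpow_0.
have -> : divpow w 1 = w by rewrite /divpow /=; field.
move=> H; apply: (has_sum_Cmod_le H) => L u.
have := divpow_sum_le w u => h.
apply: Rle_trans (Rmult_le_compat_l (Cmod w ^ 2) _ _ (pow2_ge_0 _) h).
rewrite -rsum_mull; apply: rsum_le => n; rewrite !Cmod_divpow.
have f0 := INR_fact_lt_0 n; have w0 := Cmod_ge_0 w.
have -> : (Cmod w ^ n.+2 / INR (fact n.+2) = Cmod w ^ 2 * (Cmod w ^ n / INR (fact n.+2)))%R.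
  by rewrite /Rdiv -Rmult_assoc; congr (_ * _)%R; rewrite /=; ring.
apply: Rmult_le_compat_l; first exact: pow2_ge_0.
apply: Rmult_le_compat_l; first exact: pow_le.
apply: Rinv_le_contravar => //; apply: le_INR; rewrite !fact_simpl.
have : (0 < fact n)%coq_nat by exact: lt_O_fact.
nia.
Qed.

(** * Complex derivatives *)

Definition Cderiv (f : C -> C) (z l : C) : Prop :=
  @is_derive C_AbsRing C_NormedModule f z l.

Lemma CderivP (f : C -> C) (z l : C) :
  Cderiv f z l <->
  forall eps : R, (0 < eps)%R -> exists2 d : R, (0 < d)%R &
    forall h : C, (Cmod h < d)%R -> (Cmod (f (z + h) - f z - l * h)%C <= eps * Cmod h)%R.
Proof.
split=> [[_ H] eps e0 | H].
  have [d Hd] := H z (fun P HP => HP) (mkposreal eps e0).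
  exists d; first exact: cond_pos.
  move=> h hd; have E : minus (z + h : AbsRing_NormedModule C_AbsRing) z = h.
    by rewrite /minus /plus /opp /=; ring.
  have hb : ball (z : AbsRing_UniformSpace C_AbsRing) d (z + h).
    by move: hd; rewrite -{1}E.
  have := Hd _ hb; rewrite E (Cmult_comm l); exact.
split; first exact: is_linear_scal_l.
move=> x /(@is_filter_lim_locally_unique C_AbsRing (AbsRing_NormedModule C_AbsRing)) <- eps.
have [d d0 Hd] := H eps (cond_pos eps).
exists (mkposreal d d0) => y hy; have := Hd (y - z) hy.
have -> : z + (y - z) = y by ring.
by rewrite (Cmult_comm l).
Qed.

(** Passage between two module structures on [C]: the product rule and the inner function of a
    composition use that of the ring over itself, while the theorem is stated for
    [C_NormedModule]. *)
Lemma Cderiv_AbsRing (f : C -> C) (z l : C) :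
  Cderiv f z l <-> @is_derive C_AbsRing (AbsRing_NormedModule C_AbsRing) f z l.
Proof. by split=> -[_ H]; split => //; exact: is_linear_scal_l. Qed.

Lemma Cderiv_ext_all (f g : C -> C) (z l : C) :
  (forall t, f t = g t) -> Cderiv f z l -> Cderiv g z l.
Proof. by move=> fg; apply: is_derive_ext. Qed.

Lemma Cderiv_unique (f : C -> C) (z l m : C) : Cderiv f z l -> Cderiv f z m -> l = m.
Proof. by move=> /is_C_derive_unique <- /is_C_derive_unique <-. Qed.

Lemma Cderiv_eq (f : C -> C) (z l m : C) : l = m -> Cderiv f z l -> Cderiv f z m.
Proof. by move=> ->. Qed.

Lemma upper_near (tau : C) (h : C) : (Cmod h < Im tau)%R -> upper (tau + h).
Proof.
move=> hh; rewrite /upper; have := Cmod_Im_le h.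
rewrite (_ : Im (tau + h) = Im tau + Im h)%R //; split_Rabs; lra.
Qed.

(** Identities between theta functions are available on [upper] only; they can be differentiated
    because it is open. *)
Lemma Cderiv_ext (f g : C -> C) (tau l : C) : upper tau ->
  (forall t, upper t -> f t = g t) -> Cderiv f tau l -> Cderiv g tau l.
Proof.
move=> ut fg /CderivP H; apply/CderivP => eps e0.
have [d d0 Hd] := H eps e0; exists (Rmin d (Im tau)); first exact: Rmin_pos.
move=> h hh; have m1 := Rmin_l d (Im tau); have m2 := Rmin_r d (Im tau).
rewrite -!fg //; last by apply: upper_near; lra.
apply: Hd; lra.
Qed.

Lemma Cderiv_const (a z : C) : Cderiv (fun=> a) z 0.
Proof. exact: (@is_derive_const C_AbsRing C_NormedModule). Qed.

Lemma Cderiv_id (z : C) : Cderiv (fun x => x) z 1.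
Proof. by apply/Cderiv_AbsRing; exact: is_derive_id. Qed.

Lemma Cderiv_add (f g : C -> C) (z l m : C) :
  Cderiv f z l -> Cderiv g z m -> Cderiv (fun x => f x + g x) z (l + m).
Proof. exact: (@is_derive_plus C_AbsRing C_NormedModule). Qed.

Lemma Cderiv_mul (f g : C -> C) (z l m : C) :
  Cderiv f z l -> Cderiv g z m -> Cderiv (fun x => f x * g x) z (l * g z + f z * m).
Proof.
move=> /Cderiv_AbsRing Hf /Cderiv_AbsRing Hg; apply/Cderiv_AbsRing.
exact: (is_derive_mult _ _ _ _ _ Hf Hg Cmult_comm).
Qed.

Lemma Cderiv_scal (a : C) (f : C -> C) (z l : C) :
  Cderiv f z l -> Cderiv (fun x => a * f x) z (a * l).
Proof.
move=> H; apply: Cderiv_eq (Cderiv_mul (Cderiv_const a z) H); ring.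
Qed.

Lemma Cderiv_opp (f : C -> C) (z l : C) :
  Cderiv f z l -> Cderiv (fun x => - f x) z (- l).
Proof.
move=> H; apply: Cderiv_ext_all (Cderiv_eq _ (Cderiv_scal (-1) H)); last ring.
by move=> t /=; ring.
Qed.

Lemma Cderiv_sub (f g : C -> C) (z l m : C) :
  Cderiv f z l -> Cderiv g z m -> Cderiv (fun x => f x - g x) z (l - m).
Proof. by move=> Hf Hg; apply: Cderiv_add Hf (Cderiv_opp Hg). Qed.

Lemma Cderiv_pow (f : C -> C) (z l : C) (n : nat) :
  Cderiv f z l -> Cderiv (fun x => f x ^ n) z (RtoC (INR n) * f z ^ n.-1 * l).
Proof.
move=> H; elim: n => [|n IH].
  by apply: Cderiv_eq (Cderiv_const 1 z); rewrite /=; ring.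
have E t : f t * f t ^ n = f t ^ n.+1 by rewrite Cpow_S.
apply: (Cderiv_ext_all E); apply: Cderiv_eq (Cderiv_mul H IH).
case: n {IH E} => [|n]; first by rewrite /=; ring.
by rewrite [_.-1]/= [_.-1]/= (RtoC_INR_S n.+1) Cpow_S; ring.
Qed.

Lemma Cderiv_comp (f g : C -> C) (z l m : C) :
  Cderiv f (g z) l -> Cderiv g z m -> Cderiv (fun x => f (g x)) z (l * m).
Proof.
move=> Hf Hg; rewrite Cmult_comm.
exact: (@is_derive_comp C_AbsRing C_NormedModule _ _ _ _ _ Hf (proj1 (Cderiv_AbsRing _ _ _) Hg)).
Qed.

Lemma Cderiv_Cinv (z : C) : z <> 0 -> Cderiv Cinv z (- / (z * z)).
Proof.
move=> z0; apply/CderivP => eps e0; have mz := proj1 (Cmod_gt_0 z) z0.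
(* [r / 2] keeps z + h at distance at least r / 2 from 0; [eps * r ^ 3 / 2] then makes |h|^2 / (r^2
   r / 2) at most eps |h|. *)
set r := Cmod z in mz; exists (Rmin (r / 2) (eps * r ^ 3 / 2)).
  by apply: Rmin_pos; [lra | apply: Rdiv_lt_0_compat; [apply: Rmult_lt_0_compat => //; apply: pow_lt|lra]].
move=> h hh; have m1 := Rmin_l (r / 2) (eps * r ^ 3 / 2).
have m2 := Rmin_r (r / 2) (eps * r ^ 3 / 2); have h0 := Cmod_ge_0 h.
have lb : (r / 2 <= Cmod (z + h))%R.
  have := Cmod_minus_triangle (z + h) h; have -> : z + h - h = z by ring.
  by rewrite -/r; lra.
have zh0 : z + h <> 0 by move=> E; rewrite E Cmod_0 in lb; lra.
have -> : / (z + h) - / z - - / (z * z) * h = h * h / (z * z * (z + h)) by field.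
rewrite Cmod_div; last by do 2 (apply: Cmult_neq_0 => //); apply: Cmult_neq_0.
rewrite !Cmod_mult -/r.
have p1 : (0 < r * r * (r / 2))%R by do 2 (apply: Rmult_lt_0_compat; try lra).
have p2 : (r * r * (r / 2) <= r * r * Cmod (z + h))%R by apply: Rmult_le_compat_l; nra.
apply: (Rle_trans _ (Cmod h * Cmod h / (r * r * (r / 2)))).
  apply: Rmult_le_compat_l; first nra.
  exact: Rinv_le_contravar.
have -> : (Cmod h * Cmod h / (r * r * (r / 2)) = Cmod h * (Cmod h / (r * r * (r / 2))))%R.
  by rewrite /Rdiv; ring.
rewrite Rmult_comm; apply: Rmult_le_compat_r => //.
apply/Rle_div_l; [lra | nra].
Qed.

Lemma Cderiv_inv (f : C -> C) (z l : C) : f z <> 0 ->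
  Cderiv f z l -> Cderiv (fun x => / f x) z (- l / (f z * f z)).
Proof.
move=> z0 H; apply: Cderiv_eq (Cderiv_comp (Cderiv_Cinv z0) H).
by field.
Qed.

Lemma Cderiv_div (f g : C -> C) (z l m : C) : g z <> 0 ->
  Cderiv f z l -> Cderiv g z m ->
  Cderiv (fun x => f x / g x) z ((l * g z - f z * m) / (g z * g z)).
Proof.
move=> z0 Hf Hg; apply: Cderiv_eq (Cderiv_mul Hf (Cderiv_inv z0 Hg)).
by field.
Qed.

Lemma Cderiv_csum (F G : nat -> C -> C) (z : C) (m n : nat) :
  (forall i, (m <= i < n)%nat -> Cderiv (F i) z (G i z)) ->
  Cderiv (fun x => \csum_(m <= i < n) F i x) z
    (\csum_(m <= i < n) G i z).
Proof.
move=> H; suff K L : {subset L <= index_iota m n} ->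
   Cderiv (fun x => \csum_(i <- L) F i x) z (\csum_(i <- L) G i z) by exact: K.
elim: L => [|i L IH] sub.
  apply: Cderiv_ext_all (Cderiv_eq _ (Cderiv_const 0 z)); first by move=> t; rewrite big_nil.
  by rewrite big_nil.
apply: Cderiv_ext_all (Cderiv_eq _ (Cderiv_add (H i _) (IH _))).
- by move=> t; rewrite big_cons.
- by rewrite big_cons.
- by have := sub i (mem_head _ _); rewrite mem_index_iota.
- by move=> x hx; apply: sub; rewrite in_cons hx orbT.
Qed.

(** * Exponential sums on the upper half plane *)

Definition eterm (l : R) (tau : C) : C := Cexp (RtoC PI * Ci * RtoC l * tau).

Lemma Cmod_eterm (l : R) (tau : C) : Cmod (eterm l tau) = exp (- PI * l * Im tau).
Proof. by rewrite Cmod_Cexp; congr exp; case: tau => a b /=; ring. Qed.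

Lemma eterm_mul (l m : R) (tau : C) : eterm l tau * eterm m tau = eterm (l + m) tau.
Proof. by rewrite /eterm -Cexp_add RtoC_plus; congr Cexp; ring. Qed.

Lemma eterm_0 (tau : C) : eterm 0 tau = 1.
Proof. by rewrite /eterm -Cexp_0; congr Cexp; ring. Qed.

Lemma exp_le (x y : R) : (x <= y)%R -> (exp x <= exp y)%R.
Proof. by case=> [/exp_increasing /Rlt_le|->] //; apply: Rle_refl. Qed.

(** The remainder carries exp(pi l |h|). As |h| <= Im tau / 2, half of the decay of the term absorbs
    it, and h remains in the bound through |h|^2 only. *)
Lemma eterm_taylor (l : R) (tau h : C) : (0 <= l)%R -> (Cmod h <= Im tau / 2)%R ->
  (Cmod (eterm l (tau + h) - eterm l tau - RtoC PI * Ci * RtoC l * eterm l tau * h)%C <=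
   Cmod h ^ 2 * ((PI * l) ^ 2 * exp (- PI * l * (Im tau / 2))))%R.
Proof.
move=> l0 hh; have P := PI_RGT_0; set w := RtoC PI * Ci * RtoC l * h.
have -> : eterm l (tau + h) - eterm l tau - RtoC PI * Ci * RtoC l * eterm l tau * h
   = eterm l tau * (Cexp w - 1 - w).
  have -> : eterm l (tau + h) = eterm l tau * Cexp w.
    by rewrite /eterm -Cexp_add; congr Cexp; rewrite /w; ring.
  by rewrite /w; ring.
rewrite Cmod_mult Cmod_eterm.
have Ew : Cmod w = (PI * l * Cmod h)%R.
  by rewrite /w !Cmod_mult Cmod_Ci !Cmod_R !Rabs_pos_eq //; lra.
have T := Cexp_taylor w; rewrite Ew in T.
apply: Rle_trans (Rmult_le_compat_l _ _ _ (Rlt_le _ _ (exp_pos _)) T) _.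
have -> : (exp (- PI * l * Im tau) * ((PI * l * Cmod h) ^ 2 * exp (PI * l * Cmod h)) =
  Cmod h ^ 2 * ((PI * l) ^ 2 * exp (- PI * l * Im tau + PI * l * Cmod h)))%R.
  by rewrite exp_plus; ring.
apply: Rmult_le_compat_l; first exact: pow2_ge_0.
apply: Rmult_le_compat_l; first exact: pow2_ge_0.
apply: exp_le; have : (0 <= PI * l)%R by apply: Rmult_le_pos; lra.
nra.
Qed.

(* The families whose exponential sum converges normally on every half plane
   [Im tau >= v > 0]. *)
Definition good (I : eqType) (c : I -> C) (lam : I -> R) : Prop :=
  (forall i, 0 <= lam i)%R /\
  forall v : R, (0 < v)%R -> summable (fun i => c i * RtoC (exp (- PI * lam i * v))).

Definition ES (I : eqType) (c : I -> C) (lam : I -> R) (tau : C) : C :=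
  tsum (fun i => c i * eterm (lam i) tau).

(** Coefficients of the termwise derivative with respect to tau. *)
Definition Dc (I : Type) (c : I -> C) (lam : I -> R) (i : I) : C :=
  RtoC PI * Ci * RtoC (lam i) * c i.

Lemma Cmod_RtoC_exp (x : R) : Cmod (RtoC (exp x)) = exp x.
Proof. by rewrite Cmod_R Rabs_pos_eq //; apply/Rlt_le/exp_pos. Qed.

Lemma good_summable (I : eqType) (c : I -> C) (lam : I -> R) (tau : C) :
  good c lam -> upper tau -> summable (fun i => c i * eterm (lam i) tau).
Proof.
move=> [_ H] ut; apply: summable_le (H _ ut) => i.
by rewrite !Cmod_mult Cmod_eterm Cmod_RtoC_exp; apply: Rle_refl.
Qed.

Lemma ES_has_sum (I : eqType) (c : I -> C) (lam : I -> R) (tau : C) :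
  good c lam -> upper tau -> has_sum (fun i => c i * eterm (lam i) tau) (ES c lam tau).
Proof. by move=> g ut; apply/tsumP/good_summable. Qed.

(** The new factor costs half of the decay: x exp(- x v / 2) <= 2 / v for x = pi lam. *)
Lemma good_Dc (I : eqType) (c : I -> C) (lam : I -> R) : good c lam -> good (Dc c lam) lam.
Proof.
move=> [l0 H]; split=> // v v0; have P := PI_RGT_0.
have := summable_scal (RtoC (2 / v)) (H (v / 2)%R ltac:(lra)).
apply: summable_le => i; rewrite !Cmod_mult Cmod_Ci !Cmod_RtoC_exp !Cmod_R.
have p2 : (0 < 2 / v)%R by apply: Rdiv_lt_0_compat; lra.
rewrite !Rabs_pos_eq //; try lra.
have x0 : (0 <= PI * lam i)%R by apply: Rmult_le_pos; [lra | exact: l0].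
have -> : (- PI * lam i * v = - PI * lam i * (v / 2) + - (PI * lam i * (v / 2)))%R by field.
rewrite exp_plus; set E := exp (- PI * lam i * (v / 2)).
have E0 : (0 <= E)%R by apply/Rlt_le/exp_pos.
have c0 := Cmod_ge_0 (c i).
suff K : (PI * lam i * exp (- (PI * lam i * (v / 2))) <= 2 / v)%R.
  have := Rmult_le_compat_l (Cmod (c i) * E) _ _ (Rmult_le_pos _ _ c0 E0) K; lra.
rewrite exp_Ropp; have e0 := exp_pos (PI * lam i * (v / 2)).
apply/Rle_div_l => //.
have := exp_ineq1_le (PI * lam i * (v / 2)) => K.
have : (2 / v * (PI * lam i * (v / 2)) <= 2 / v * exp (PI * lam i * (v / 2)))%R.
  by apply: Rmult_le_compat_l; lra.
have -> : (2 / v * (PI * lam i * (v / 2)) = PI * lam i)%R by field; lra.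
lra.
Qed.

(** The remainders of [eterm_taylor] add up to at most M |h|^2, where M bounds the twice
    differentiated family at height Im tau / 2. *)
Lemma ES_deriv (I : eqType) (c : I -> C) (lam : I -> R) (tau : C) :
  good c lam -> upper tau -> Cderiv (ES c lam) tau (ES (Dc c lam) lam tau).
Proof.
move=> g ut; have gD := good_Dc g; have [l0 H2] := good_Dc gD.
have [M HM] := H2 (Im tau / 2)%R ltac:(rewrite /upper in ut; lra).
have M0 : (0 <= M)%R by have := HM [::] isT; rewrite big_nil.
apply/CderivP => eps e0.
have q0 : (0 < eps / (M + 1))%R by apply: Rdiv_lt_0_compat; lra.
exists (Rmin (Im tau / 2) (eps / (M + 1))).
  by apply: Rmin_pos => //; rewrite /upper in ut; lra.
move=> h hh; have m1 := Rmin_l (Im tau / 2) (eps / (M + 1)).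
have m2 := Rmin_r (Im tau / 2) (eps / (M + 1)); have h0 := Cmod_ge_0 h.
have uth : upper (tau + h) by apply: upper_near; rewrite /upper in ut; lra.
have HS := has_sum_sub (has_sum_sub (ES_has_sum g uth) (ES_has_sum g ut))
   (has_sum_scal h (ES_has_sum gD ut)).
rewrite (Cmult_comm _ h).
apply: (Rle_trans _ (Cmod h ^ 2 * M)).
  apply: (has_sum_Cmod_le HS) => L u.
  apply: Rle_trans (Rmult_le_compat_l _ _ _ (pow2_ge_0 _) (HM L u)).
  rewrite -rsum_mull; apply: rsum_le => i.
  have -> : c i * eterm (lam i) (tau + h) - c i * eterm (lam i) tau -
     h * (Dc c lam i * eterm (lam i) tau) =
    c i * (eterm (lam i) (tau + h) - eterm (lam i) tau -
       RtoC PI * Ci * RtoC (lam i) * eterm (lam i) tau * h) by rewrite /Dc; ring.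
  rewrite Cmod_mult; have := eterm_taylor (l0 i) (tau := tau) (h := h) ltac:(lra) => T.
  apply: Rle_trans (Rmult_le_compat_l _ _ _ (Cmod_ge_0 _) T) _.
  have P := PI_RGT_0.
  rewrite /Dc !Cmod_mult Cmod_Ci Cmod_RtoC_exp !Cmod_R (Rabs_pos_eq PI) ?(Rabs_pos_eq (lam i)) //; try lra.
have : (Cmod h * M <= eps)%R.
  have : (Cmod h * (M + 1) <= eps / (M + 1) * (M + 1))%R by apply: Rmult_le_compat_r; lra.
  have -> : (eps / (M + 1) * (M + 1) = eps)%R by field; lra.
  lra.
nra.
Qed.

(** The terms with exponent 0 form the limit. For the others (lam - 1) (Im tau - 1) >= 0 separates
    the factor exp(- pi Im tau) from the convergent sum at height 1. *)
Lemma ES_asymptotic (I : eqType) (c : I -> C) (lam : I -> R) (L0 : seq I) :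
  good c lam -> uniq L0 -> (forall i, i \in L0 -> lam i = 0%R) ->
  (forall i, i \notin L0 -> c i = 0 \/ (1 <= lam i)%R) ->
  exists K : R, forall tau : C, (1 <= Im tau)%R ->
    (Cmod (ES c lam tau - \csum_(i <- L0) c i)%C <= K * exp (- PI * Im tau))%R.
Proof.
move=> g u0 H0 H1; have [l0 H] := g; have [M HM] := H 1%R ltac:(lra).
exists (exp PI * M)%R => tau t1.
have ut : upper tau by rewrite /upper; lra.
have HF : has_sum (fun i => if i \in L0 then c i else 0) (\csum_(i <- L0) c i).
  have -> : \csum_(i <- L0) c i = \csum_(i <- L0) (if i \in L0 then c i else 0).
    by rewrite big_seq [in RHS]big_seq; apply: eq_bigr => i ->.
  by apply: has_sum_finite => // i /negbTE ->.
have HS := has_sum_sub (ES_has_sum g ut) HF.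
apply: (has_sum_Cmod_le HS) => L u.
have P := PI_RGT_0.
have -> : (exp PI * M * exp (- PI * Im tau) = exp (PI + - PI * Im tau) * M)%R.
  by rewrite exp_plus; ring.
apply: Rle_trans (Rmult_le_compat_l _ _ _ (Rlt_le _ _ (exp_pos _)) (HM L u)).
rewrite -rsum_mull; apply: rsum_le => i; case: ifP => hi.
  rewrite H0 // eterm_0 (_ : c i * 1 - c i = 0) ?Cmod_0; last ring.
  apply: Rmult_le_pos (Cmod_ge_0 _); exact/Rlt_le/exp_pos.
rewrite (_ : _ - 0 = c i * eterm (lam i) tau); last ring.
rewrite !Cmod_mult Cmod_eterm Cmod_RtoC_exp.
have [->|h1] := H1 i (negbT hi).
  by rewrite Cmod_0 !Rmult_0_l Rmult_0_r; apply: Rle_refl.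
have -> : (exp (PI + - PI * Im tau) * (Cmod (c i) * exp (- PI * lam i * 1)) =
  Cmod (c i) * (exp (PI + - PI * Im tau + - PI * lam i * 1)))%R.
  by rewrite [in RHS]exp_plus; ring.
apply: Rmult_le_compat_l; first exact: Cmod_ge_0.
apply: exp_le.
have : (0 <= PI * (lam i - 1) * (Im tau - 1))%R.
  by apply: Rmult_le_pos; [apply: Rmult_le_pos|]; lra.
lra.
Qed.

(** After taking k-th roots this is 1 + x <= (1 + k / v) (1 + x v / k), whose last factor is at most
    exp(x v / k). *)
Lemma one_plus_pow_exp (x v : R) (k : nat) : (0 <= x)%R -> (0 < v)%R ->
  ((1 + x) ^ k * exp (- (x * v)) <= (1 + INR k / v) ^ k)%R.
Proof.
move=> x0 v0; case: k => [|k].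
  rewrite /= !Rmult_1_l -exp_0; apply: exp_le; nra.
have k0 : (0 < INR k.+1)%R by apply: lt_0_INR; lia.
have -> : exp (- (x * v)) = (exp (- (x * v / INR k.+1)) ^ k.+1)%R.
  rewrite -Rpower_pow ?/Rpower ?ln_exp; last exact: exp_pos.
  by congr exp; field; lra.
rewrite -Rpow_mult_distr; apply: pow_incr; split.
  by apply: Rmult_le_pos; [lra | apply/Rlt_le/exp_pos].
rewrite exp_Ropp; apply/Rle_div_l; first exact: exp_pos.
have p : (0 < INR k.+1 / v)%R by apply: Rdiv_lt_0_compat.
have := exp_ineq1_le (x * v / INR k.+1) => K.
apply: Rle_trans (Rmult_le_compat_l _ _ _ _ K); last lra.
have -> : ((1 + INR k.+1 / v) * (1 + x * v / INR k.+1)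
  = 1 + INR k.+1 / v + x * v / INR k.+1 + x)%R by field; lra.
have : (0 <= x * v / INR k.+1)%R.
  by apply: Rmult_le_pos; [nra | apply/Rlt_le/Rinv_0_lt_compat].
lra.
Qed.

Lemma good_weight (I : eqType) (c : I -> C) (lam : I -> R) (W : I -> C) (b : R) (k : nat) :
  summable W -> (forall i, 0 <= lam i)%R ->
  (forall i, Cmod (c i) <= b * (1 + lam i) ^ k * Cmod (W i))%R -> good c lam.
Proof.
move=> SW l0 H; split=> // v v0; have P := PI_RGT_0.
have pv : (0 < PI * v)%R by apply: Rmult_lt_0_compat.
have B0 : (0 <= (1 + INR k / (PI * v)) ^ k)%R.
  apply: pow_le; have := pos_INR k => k0.
  have : (0 <= INR k / (PI * v))%R by apply: Rmult_le_pos => //; apply/Rlt_le/Rinv_0_lt_compat.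
  lra.
have := summable_scal (RtoC (Rabs b * (1 + INR k / (PI * v)) ^ k)) SW.
apply: summable_le => i; rewrite !Cmod_mult Cmod_RtoC_exp Cmod_R (Rabs_pos_eq (_ * _)); last first.
  by apply: Rmult_le_pos => //; apply: Rabs_pos.
have K := one_plus_pow_exp k (l0 i) pv.
have -> : (- PI * lam i * v = - (lam i * (PI * v)))%R by ring.
have e0 := exp_pos (- (lam i * (PI * v))).
apply: Rle_trans (Rmult_le_compat_r _ _ _ (Rlt_le _ _ e0) (H i)) _.
have W0 := Cmod_ge_0 (W i); have ba := Rle_abs b; have b0 := Rabs_pos b.
have X0 : (0 <= (1 + lam i) ^ k * exp (- (lam i * (PI * v))))%R.
  by apply: Rmult_le_pos; [apply: pow_le; have := l0 i; lra | lra].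
have : (b * ((1 + lam i) ^ k * exp (- (lam i * (PI * v)))) <=
  Rabs b * (1 + INR k / (PI * v)) ^ k)%R.
  apply: Rle_trans (Rmult_le_compat_r _ _ _ X0 ba) _.
  exact: Rmult_le_compat_l.
move/(Rmult_le_compat_r _ _ _ W0); lra.
Qed.

Lemma good_Z (c : Z -> C) (lam : Z -> R) (a b : R) : (0 <= b)%R ->
  (forall n, 0 <= lam n)%R ->
  (forall n, 1 + IZR n ^ 2 <= a * (1 + lam n))%R ->
  (forall n, Cmod (c n) <= b * (1 + lam n))%R -> good c lam.
Proof.
move=> b0 l0 Ha Hb; apply: (@good_weight _ _ _ _ (a * b) 2 summable_inv_sq_Z) => // n.
have n0 : (0 < 1 + IZR n ^ 2)%R by have := pow2_ge_0 (IZR n); lra.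
rewrite Cmod_R Rabs_pos_eq; last by apply/Rlt_le/Rinv_0_lt_compat.
apply/Rle_div_r => //; apply: Rle_trans (Rmult_le_compat_r _ _ _ (Rlt_le _ _ n0) (Hb n)) _.
have L := l0 n.
have := Rmult_le_compat_l (b * (1 + lam n)) _ _ ltac:(apply: Rmult_le_pos; lra) (Ha n).
lra.
Qed.

(** * Theta constants and their doubling identities *)

Definition one_c (n : Z) : C := 1.
Definition sgn (n : Z) : C := RtoC (powerRZ (-1) n).
Definition sgn_odd (n : Z) : C := sgn n * RtoC (2 * IZR n + 1).
Definition sq (n : Z) : R := (IZR n ^ 2)%R.
Definition hsq (n : Z) : R := ((IZR n + 1 / 2) ^ 2)%R.

Definition T3 : C -> C := ES one_c sq.
Definition T4 : C -> C := ES sgn sq.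
Definition T2 : C -> C := ES one_c hsq.
(* [theta_1'(0) / pi] in Jacobi's notation. *)
Definition T1' : C -> C := ES sgn_odd hsq.

Lemma sgn_add m n : sgn (m + n) = sgn m * sgn n.
Proof. by rewrite /sgn powerRZ_add ?RtoC_mult //; lra. Qed.

Lemma sgn_sq n : sgn n * sgn n = 1.
Proof.
rewrite /sgn -RtoC_mult -powerRZ_mult Rmult_opp_opp Rmult_1_l; congr RtoC.
by case: n => //= p; rewrite pow1 ?Rinv_1.
Qed.

Lemma sgn_opp n : sgn (- n) = sgn n.
Proof.
have h : sgn (- n) * sgn n = 1 by rewrite -sgn_add Z.add_opp_diag_l.
by rewrite -[LHS]Cmult_1_r -(sgn_sq n) Cmult_assoc h Cmult_1_l.
Qed.

Lemma sgn_1 : sgn 1 = -1.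
Proof. by rewrite /sgn /= Rmult_1_r. Qed.

Lemma sgn_sub m n : sgn (m - n) = sgn m * sgn n.
Proof. by rewrite -Z.add_opp_r sgn_add sgn_opp. Qed.

Lemma Cmod_sgn n : Cmod (sgn n) = 1%R.
Proof.
have := congr1 Cmod (sgn_sq n); rewrite Cmod_mult Cmod_1.
have := Cmod_ge_0 (sgn n); nra.
Qed.

Lemma sq_ge0 n : (0 <= sq n)%R. Proof. exact: pow2_ge_0. Qed.
Lemma hsq_ge0 n : (0 <= hsq n)%R. Proof. exact: pow2_ge_0. Qed.

Lemma hsq_weight n : (1 + IZR n ^ 2 <= 4 * (1 + hsq n))%R.
Proof. by rewrite /hsq; have := pow2_ge_0 (3 * IZR n + 2); nra. Qed.

Lemma good_sq (c : Z -> C) (b : R) : (0 <= b)%R ->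
  (forall n, Cmod (c n) <= b * (1 + sq n))%R -> good c sq.
Proof. move=> b0; apply: (@good_Z _ _ 1) => //; [exact: sq_ge0 | rewrite /sq => n; lra]. Qed.

Lemma good_hsq (c : Z -> C) (b : R) : (0 <= b)%R ->
  (forall n, Cmod (c n) <= b * (1 + hsq n))%R -> good c hsq.
Proof. move=> b0; apply: (@good_Z _ _ 4) => //; [exact: hsq_ge0 | exact: hsq_weight]. Qed.

Lemma good3 : good one_c sq.
Proof.
apply: (@good_sq _ 1) => [|n]; first lra.
by rewrite Cmod_1; have := sq_ge0 n; lra.
Qed.

Lemma good4 : good sgn sq.
Proof.
apply: (@good_sq _ 1) => [|n]; first lra.
by rewrite Cmod_sgn; have := sq_ge0 n; lra.
Qed.

Lemma good2 : good one_c hsq.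
Proof.
apply: (@good_hsq _ 1) => [|n]; first lra.
by rewrite Cmod_1; have := hsq_ge0 n; lra.
Qed.

Lemma good1 : good sgn hsq.
Proof.
apply: (@good_hsq _ 1) => [|n]; first lra.
by rewrite Cmod_sgn; have := hsq_ge0 n; lra.
Qed.

Lemma good1' : good sgn_odd hsq.
Proof.
apply: (@good_hsq _ 2) => [|n]; first lra.
rewrite Cmod_mult Cmod_sgn Cmod_R /hsq.
have := pow2_ge_0 (IZR n - 1 / 2); have := pow2_ge_0 (IZR n + 3 / 2).
split_Rabs; nra.
Qed.

Lemma good_lin : good (fun n => sgn n * RtoC (IZR n)) sq.
Proof.
apply: (@good_sq _ 1) => [|n]; first lra.
rewrite Cmod_mult Cmod_sgn Cmod_R /sq.
have := pow2_ge_0 (IZR n - 1 / 2); have := pow2_ge_0 (IZR n + 1 / 2).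
split_Rabs; nra.
Qed.

Lemma ES_reindex (I J : eqType) (p : J -> I) (q : I -> J) (c : I -> C) (lam : I -> R)
  (tau : C) : cancel p q -> cancel q p -> good c lam -> upper tau ->
  has_sum (fun j => c (p j) * eterm (lam (p j)) tau) (ES c lam tau).
Proof. by move=> pq qp g ut; exact: has_sum_reindex pq qp (ES_has_sum g ut). Qed.

Lemma ES_antisym (c : Z -> C) (lam : Z -> R) (p : Z -> Z) (tau : C) :
  cancel p p -> good c lam -> upper tau ->
  (forall n, c (p n) = - c n) -> (forall n, lam (p n) = lam n) -> ES c lam tau = 0.
Proof.
move=> pp g ut Hc Hl; have H := ES_has_sum g ut.
have H1 := has_sum_scal (-1) H.
have H2 : has_sum (fun i => -1 * (c i * eterm (lam i) tau)) (ES c lam tau).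
  by apply: has_sum_ext (ES_reindex pp pp g ut) => n; rewrite Hc Hl; ring.
have E := has_sum_unique H1 H2; set s := ES c lam tau in E *.
have -> : s = (s - -1 * s) / 2 by field.
rewrite E; field.
Qed.

(** This is theta_1(0) = 0. Odd sums of this kind make the unwanted cosets and cross terms vanish
    when the lattice is rotated. *)
Lemma T1_0 tau : upper tau -> ES sgn hsq tau = 0.
Proof.
move=> ut; apply: (@ES_antisym _ _ (fun n => -1 - n)%Z) => //.
- by move=> n; lia.
- exact: good1.
- by move=> n; rewrite sgn_sub (_ : (-1)%Z = (- (1))%Z) // sgn_opp sgn_1; ring.
- by move=> n; rewrite /hsq minus_IZR; field.
Qed.

Lemma Tlin_0 tau : upper tau -> ES (fun n => sgn n * RtoC (IZR n)) sq tau = 0.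
Proof.
move=> ut; apply: (@ES_antisym _ _ Z.opp) => //.
- by move=> n; lia.
- exact: good_lin.
- by move=> n; rewrite sgn_opp opp_IZR RtoC_opp; ring.
- by move=> n; rewrite /sq opp_IZR; ring.
Qed.

Definition diag_of (u : Z * Z + Z * Z) : Z * Z :=
  match u with
  | inl k => (k.1 + k.2, k.1 - k.2)%Z
  | inr k => (k.1 + k.2 + 1, k.1 - k.2)%Z
  end.
(** When m + n is odd, so is m - n, and the halves rounded down are exactly the indices k and l of
    the second coset. *)
Definition diag_inv (m : Z * Z) : Z * Z + Z * Z :=
  let k := ((m.1 + m.2) / 2, (m.1 - m.2) / 2)%Z in
  if Z.even (m.1 + m.2) then inl k else inr k.

Lemma diag_ofK : cancel diag_of diag_inv.
Proof.
case=> -[k l]; rewrite /diag_of /diag_inv /=.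
- have -> : (k + l + (k - l) = 2 * k)%Z by ring.
  have -> : (k + l - (k - l) = 2 * l)%Z by ring.
  by rewrite Z.even_mul [orb _ _]/= !(Z.mul_comm 2) !Z.div_mul.
- have -> : (k + l + 1 + (k - l) = 1 + k * 2)%Z by ring.
  have -> : (k + l + 1 - (k - l) = 1 + l * 2)%Z by ring.
  have -> : Z.even (1 + k * 2) = false by rewrite Z.even_add Z.even_mul Bool.orb_true_r.
  by rewrite !Z.div_add.
Qed.

Lemma diag_invK : cancel diag_inv diag_of.
Proof.
case=> m n; rewrite /diag_inv /diag_of /=.
case E: (Z.even (m + n)).
- have /Z.even_spec [j hj] := E.
  have -> : (m + n = j * 2)%Z by lia.
  have -> : (m - n = (j - n) * 2)%Z by lia.
  by rewrite !Z.div_mul //=; congr pair; lia.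
- have : Z.odd (m + n) = true by rewrite -Z.negb_even E.
  move=> /Z.odd_spec [j hj].
  have -> : (m + n = 1 + j * 2)%Z by lia.
  have -> : (m - n = 1 + (j - n) * 2)%Z by lia.
  by rewrite !Z.div_add // [(1 / 2)%Z]/=; congr pair => /=; lia.
Qed.

(* Rotation of the summation lattice by 45 degrees: Z^2 is the union of the
   points (k + l, k - l) and of the points (k + l + 1, k - l). *)
Lemma has_sum_diag (f : Z * Z -> C) (s t : C) :
  has_sum (fun k => f (k.1 + k.2, k.1 - k.2)%Z) s ->
  has_sum (fun k => f (k.1 + k.2 + 1, k.1 - k.2)%Z) t -> has_sum f (s + t).
Proof.
move=> H1 H2; have H := has_sum_sum (f := fun u => f (diag_of u)) H1 H2.
apply: has_sum_ext (has_sum_reindex diag_invK diag_ofK H) => k.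
by rewrite diag_invK.
Qed.

Lemma ES_mul (I J : eqType) (c : I -> C) (lam : I -> R) (d : J -> C) (mu : J -> R) tau :
  good c lam -> good d mu -> upper tau ->
  has_sum (fun k => c k.1 * d k.2 * eterm (lam k.1 + mu k.2) tau)
    (ES c lam tau * ES d mu tau).
Proof.
move=> gc gd ut.
have := has_sum_prod (good_summable gc ut) (good_summable gd ut)
  (ES_has_sum gc ut) (ES_has_sum gd ut).
by apply: has_sum_ext => k; rewrite -eterm_mul; ring.
Qed.

Lemma upper_double tau : upper tau -> upper (2 * tau).
Proof. by rewrite /upper; case: tau => a b /=; lra. Qed.

Lemma eterm_double l tau : eterm l (2 * tau) = eterm (2 * l) tau.
Proof. by rewrite /eterm RtoC_mult; congr Cexp; ring. Qed.

Lemma ES_mul_double (I J : eqType) (c : I -> C) (lam : I -> R) (d : J -> C) (mu : J -> R) tau :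
  good c lam -> good d mu -> upper tau ->
  has_sum (fun k => c k.1 * d k.2 * eterm (2 * (lam k.1 + mu k.2)) tau)
    (ES c lam (2 * tau) * ES d mu (2 * tau)).
Proof.
move=> gc gd ut; apply: has_sum_ext (ES_mul gc gd (upper_double ut)) => k.
by rewrite eterm_double.
Qed.

Lemma ES_mul_diag (c : Z -> C) (lam : Z -> R) (d : Z -> C) (mu : Z -> R) tau s t :
  good c lam -> good d mu -> upper tau ->
  has_sum (fun k : Z * Z => c (k.1 + k.2)%Z * d (k.1 - k.2)%Z *
     eterm (lam (k.1 + k.2)%Z + mu (k.1 - k.2)%Z) tau) s ->
  has_sum (fun k : Z * Z => c (k.1 + k.2 + 1)%Z * d (k.1 - k.2)%Z *
     eterm (lam (k.1 + k.2 + 1)%Z + mu (k.1 - k.2)%Z) tau) t ->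
  ES c lam tau * ES d mu tau = s + t.
Proof.
move=> gc gd ut H1 H2; apply: has_sum_unique (ES_mul gc gd ut) _.
exact: (has_sum_diag (f := fun k => c k.1 * d k.2 * eterm (lam k.1 + mu k.2) tau)).
Qed.

(** On one coset (k + l)^2 + (k - l)^2 = 2 (k^2 + l^2); on the other (k + l + 1)^2 + (k - l)^2 = 2
    ((k + 1/2)^2 + (l + 1/2)^2). The first gives integral squares at 2 tau, the second half-integral
    ones. *)
Lemma T3_sq tau : upper tau ->
  T3 tau * T3 tau = T3 (2 * tau) * T3 (2 * tau) + T2 (2 * tau) * T2 (2 * tau).
Proof.
move=> ut; apply: (ES_mul_diag good3 good3 ut).
  apply: has_sum_ext (ES_mul_double good3 good3 ut) => -[k l] /=.
  congr (_ * eterm _ _); rewrite /sq plus_IZR minus_IZR; ring.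
apply: has_sum_ext (ES_mul_double good2 good2 ut) => -[k l] /=.
by congr (_ * eterm _ _); rewrite /sq /hsq minus_IZR !plus_IZR; field.
Qed.

Lemma T4_sq tau : upper tau ->
  T4 tau * T4 tau = T3 (2 * tau) * T3 (2 * tau) - T2 (2 * tau) * T2 (2 * tau).
Proof.
move=> ut; apply: (ES_mul_diag good4 good4 ut).
  apply: has_sum_ext (ES_mul_double good3 good3 ut) => -[k l] /=.
  congr (_ * eterm _ _); last by rewrite /sq plus_IZR minus_IZR; ring.
  rewrite sgn_add sgn_sub (_ : _ * _ * _ = (sgn k * sgn k) * (sgn l * sgn l)); last ring.
  by rewrite !sgn_sq.
(* On the second coset (k + l + 1) + (k - l) is odd, so the product of the two signs is -1. *)
have := has_sum_scal (-1) (ES_mul_double good2 good2 ut).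
rewrite (_ : -1 * _ = - (T2 (2 * tau) * T2 (2 * tau))); last by rewrite /T2; ring.
apply: has_sum_ext => -[k l] /=.
rewrite sgn_sub !sgn_add sgn_1 (_ : _ * _ * -1 * _ = -1 * ((sgn k * sgn k) * (sgn l * sgn l))); last ring.
rewrite !sgn_sq /one_c !Cmult_assoc !Cmult_1_r.
by congr (_ * eterm _ _); rewrite /sq /hsq minus_IZR !plus_IZR; field.
Qed.

(** Only the sign of k - l remains and it factors over k and l, so the second coset gives
    theta_1(0)^2 = 0. *)
Lemma T3_T4 tau : upper tau -> T3 tau * T4 tau = T4 (2 * tau) * T4 (2 * tau).
Proof.
move=> ut; rewrite -[RHS]Cplus_0_r; apply: (ES_mul_diag good3 good4 ut).
  apply: has_sum_ext (ES_mul_double good4 good4 ut) => -[k l] /=.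
  congr (_ * eterm _ _); last by rewrite /sq plus_IZR minus_IZR; ring.
  by rewrite sgn_sub /one_c Cmult_1_l.
have := ES_mul_double good1 good1 ut; rewrite T1_0 ?Cmult_0_l; last exact: upper_double.
apply: has_sum_ext => -[k l] /=.
congr (_ * eterm _ _); first by rewrite sgn_sub /one_c Cmult_1_l.
by rewrite /sq /hsq minus_IZR !plus_IZR; field.
Qed.

Lemma succK : cancel (fun n : Z => n + 1)%Z (fun n : Z => n - 1)%Z.
Proof. by move=> n; lia. Qed.
Lemma predK : cancel (fun n : Z => n - 1)%Z (fun n : Z => n + 1)%Z.
Proof. by move=> n; lia. Qed.

Lemma has_sum_succ1 (f : Z * Z -> C) s :
  has_sum f s -> has_sum (fun k => f (k.1 + 1, k.2)%Z) s.
Proof.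
apply: (@has_sum_reindex _ _ (fun k : Z * Z => (k.1 + 1, k.2)%Z) (fun k => (k.1 - 1, k.2)%Z)).
  by case=> a b /=; congr pair; lia.
by case=> a b /=; congr pair; lia.
Qed.

(** Both cosets give the same product. In the second the integral index appears as k + 1, hence
    [has_sum_succ1]. *)
Lemma T2_sq tau : upper tau -> T2 tau * T2 tau = 2 * (T2 (2 * tau) * T3 (2 * tau)).
Proof.
move=> ut; have -> (a : C) : 2 * a = a + a by ring.
apply: (ES_mul_diag good2 good2 ut).
  apply: has_sum_ext (ES_mul_double good2 good3 ut) => -[k l] /=.
  by congr (_ * eterm _ _); rewrite /sq /hsq plus_IZR minus_IZR; field.
rewrite [T2 _ * _]Cmult_comm.
apply: has_sum_ext (has_sum_succ1 (ES_mul_double good3 good2 ut)) => -[k l] /=.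
by congr (_ * eterm _ _); rewrite /sq /hsq minus_IZR !plus_IZR; field.
Qed.

Lemma T1'_T2 tau : upper tau -> T1' tau * T2 tau = 2 * (T1' (2 * tau) * T4 (2 * tau)).
Proof.
move=> ut; have ut2 := upper_double ut; have -> (a : C) : 2 * a = a + a by ring.
apply: (ES_mul_diag good1' good2 ut).
  (* 2 (k + l) + 1 = (2 k + 1) + 2 l, and the part with 2 l has the factor theta_1(0) = 0. *)
  have := has_sum_add (ES_mul_double good1' good4 ut)
    (has_sum_scal 2 (ES_mul_double good1 good_lin ut)).
  rewrite T1_0 // Cmult_0_l Cmult_0_r Cplus_0_r.
  apply: has_sum_ext => -[k l] /=.
  have -> : (hsq (k + l) + hsq (k - l) = 2 * (hsq k + sq l))%R.
    by rewrite /sq /hsq plus_IZR minus_IZR; field.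
  rewrite /sgn_odd sgn_add plus_IZR /one_c !RtoC_plus !RtoC_mult !RtoC_plus; ring.
have := has_sum_add (ES_mul_double good4 good1' ut)
    (has_sum_scal 2 (ES_mul_double good_lin good1 ut)).
rewrite T1_0 // !Cmult_0_r Cplus_0_r [ES sgn _ _ * _]Cmult_comm => /has_sum_succ1.
apply: has_sum_ext => -[k l] /=.
have -> : (hsq (k + l + 1) + hsq (k - l) = 2 * (sq (k + 1) + hsq l))%R.
  by rewrite /sq /hsq minus_IZR !plus_IZR; field.
rewrite /sgn_odd !sgn_add sgn_1 !plus_IZR /one_c !RtoC_plus !RtoC_mult !RtoC_plus; ring.
Qed.

Definition dT3 : C -> C := ES (Dc one_c sq) sq.
Definition dT4 : C -> C := ES (Dc sgn sq) sq.
Definition dT2 : C -> C := ES (Dc one_c hsq) hsq.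

(** Up to sign, the coefficient of a term is pi i times a difference of squares. On the first coset
    this is 4 k l, whose sum is a product of two vanishing odd sums; on the second it is (2 k + 1)
    (2 l + 1), which gives the square of [T1']. *)
Lemma wronskian34 tau : upper tau ->
  dT3 tau * T4 tau - dT4 tau * T3 tau = RtoC PI * Ci * (T1' (2 * tau) * T1' (2 * tau)).
Proof.
move=> ut; have ut2 := upper_double ut.
have H1 := ES_mul (good_Dc good3) good4 ut.
have H2 := ES_mul good3 (good_Dc good4) ut.
have H := has_sum_sub H1 H2; rewrite (Cmult_comm (dT4 tau)).
apply: has_sum_unique H _; rewrite -[X in has_sum _ X]Cplus_0_l.
apply: has_sum_diag.
  have := has_sum_scal (4 * RtoC PI * Ci) (ES_mul_double good_lin good_lin ut).
  rewrite Tlin_0 // Cmult_0_l Cmult_0_r.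
  apply: has_sum_ext => -[k l] /=.
  have -> : (sq (k + l) + sq (k - l) = 2 * (sq k + sq l))%R.
    by rewrite /sq plus_IZR minus_IZR; ring.
  rewrite /Dc /one_c sgn_sub /sq plus_IZR minus_IZR !RtoC_pow RtoC_plus RtoC_minus; ring.
have := has_sum_scal (RtoC PI * Ci) (ES_mul_double good1' good1' ut).
apply: has_sum_ext => -[k l] /=.
have -> : (sq (k + l + 1) + sq (k - l) = 2 * (hsq k + hsq l))%R.
  by rewrite /sq /hsq minus_IZR !plus_IZR; field.
rewrite /Dc /one_c /sgn_odd sgn_sub /sq minus_IZR !plus_IZR !RtoC_pow RtoC_minus !RtoC_plus !RtoC_mult; ring.
Qed.

(** * Invariance under doubling *)

Lemma Im_double tau : Im (2 * tau) = (2 * Im tau)%R.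
Proof. by case: tau => a b /=; ring. Qed.

Definition dbl (n : nat) (tau : C) : C := RtoC (2 ^ n) * tau.

Lemma dbl_S (n : nat) (tau : C) : dbl n.+1 tau = 2 * dbl n tau.
Proof. by rewrite /dbl -tech_pow_Rmult RtoC_mult; ring. Qed.

Lemma dbl_Im (n : nat) tau : Im (dbl n tau) = (2 ^ n * Im tau)%R.
Proof.
by case: tau => a b; rewrite /dbl /=; ring.
Qed.

Lemma pow2_ge_INR (n : nat) : (INR n <= 2 ^ n)%R.
Proof.
elim: n => [|n IH]; first by rewrite /=; lra.
by rewrite S_INR -tech_pow_Rmult; have := pow_R1_Rle 2 n ltac:(lra); lra.
Qed.

Lemma dbl_large B tau : upper tau -> exists n, (B <= Im (dbl n tau))%R.
Proof.
rewrite /upper => ut; have [n hn] := INR_unbounded (B / Im tau)%R.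
exists n; rewrite dbl_Im; apply/Rlt_le/(Rmult_lt_reg_r (/ Im tau)).
  exact: Rinv_0_lt_compat.
rewrite Rmult_assoc Rinv_r; last lra.
have := pow2_ge_INR n; rewrite /Rdiv in hn; lra.
Qed.

Lemma upper_dbl (n : nat) tau : upper tau -> upper (dbl n tau).
Proof.
move=> ut; elim: n => [|n IH]; last by rewrite dbl_S; apply: upper_double.
by rewrite /dbl /= Cmult_1_l.
Qed.

Lemma doubling_ind (P : C -> Prop) (B : R) :
  (forall t, upper t -> P (2 * t) -> P t) -> (forall t, (B <= Im t)%R -> P t) ->
  forall t, upper t -> P t.
Proof.
move=> step large t ut; have [n /large] := dbl_large B ut.
elim: n => [|n IH]; rewrite ?dbl_S; first by rewrite /dbl /= Cmult_1_l.
move=> h; apply: IH.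
by apply: step => //; apply: upper_dbl.
Qed.

(** * Limits at i oo *)

Definition tends (f : C -> C) (a : C) : Prop :=
  forall eps : R, (0 < eps)%R -> exists B : R, forall t : C, (B <= Im t)%R ->
    (Cmod (f t - a)%C < eps)%R.

(** f(tau) = f(2^n tau), and Im(2^n tau) exceeds every bound. *)
Lemma doubling_const (f : C -> C) (a : C) :
  (forall t, upper t -> f (2 * t) = f t) -> tends f a -> forall t, upper t -> f t = a.
Proof.
move=> inv lim t ut; apply: Cmod_eq_of_small => eps e0; have [B HB] := lim eps e0.
apply/Rlt_le; move: t ut.
apply: (@doubling_ind (fun t => Cmod (f t - a)%C < eps)%R B) => [t ut|]; last exact: HB.
by rewrite inv.
Qed.

Lemma tends_ext (f g : C -> C) (a : C) :
  (forall t, upper t -> f t = g t) -> tends f a -> tends g a.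
Proof.
move=> fg H eps e0; have [B HB] := H eps e0; exists (Rmax 1 B) => t ht.
have m1 := Rmax_l 1 B; have m2 := Rmax_r 1 B.
by rewrite -fg; [apply: HB; lra | rewrite /upper; lra].
Qed.

Lemma tends_const a : tends (fun=> a) a.
Proof.
move=> eps e0; exists 0%R => t _.
by rewrite (_ : a - a = 0) ?Cmod_0 //; ring.
Qed.

Lemma tends_add f g a b : tends f a -> tends g b -> tends (fun t => f t + g t) (a + b).
Proof.
move=> Hf Hg eps e0; have [B1 H1] := Hf (eps / 2)%R ltac:(lra).
have [B2 H2] := Hg (eps / 2)%R ltac:(lra); exists (Rmax B1 B2) => t ht.
have m1 := Rmax_l B1 B2; have m2 := Rmax_r B1 B2.
have h1 := H1 t ltac:(lra); have h2 := H2 t ltac:(lra).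
have -> : f t + g t - (a + b) = (f t - a) + (g t - b) by ring.
by have := Cmod_triangle (f t - a) (g t - b); lra.
Qed.

Lemma tends_mul f g a b : tends f a -> tends g b -> tends (fun t => f t * g t) (a * b).
Proof.
move=> Hf Hg eps e0; have A0 := Cmod_ge_0 a; have B0 := Cmod_ge_0 b.
pose d := Rmin 1 (eps / (Cmod a + Cmod b + 2))%R.
have q0 : (0 < eps / (Cmod a + Cmod b + 2))%R by apply: Rdiv_lt_0_compat; lra.
have d0 : (0 < d)%R by apply: Rmin_pos; lra.
have d1 := Rmin_l 1 (eps / (Cmod a + Cmod b + 2)); have d2 := Rmin_r 1 (eps / (Cmod a + Cmod b + 2)).
rewrite -/d in d1 d2.
have [B1 H1] := Hf d d0; have [B2 H2] := Hg d d0; exists (Rmax B1 B2) => t ht.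
have m1 := Rmax_l B1 B2; have m2 := Rmax_r B1 B2.
have h1 := H1 t ltac:(lra); have h2 := H2 t ltac:(lra).
have -> : f t * g t - a * b = (f t - a) * (g t - b) + (f t - a) * b + a * (g t - b) by ring.
have t1 := Cmod_triangle ((f t - a) * (g t - b) + (f t - a) * b) (a * (g t - b)).
have t2 := Cmod_triangle ((f t - a) * (g t - b)) ((f t - a) * b).
rewrite !Cmod_mult in t1 t2.
have k1 := Cmod_ge_0 (f t - a); have k2 := Cmod_ge_0 (g t - b).
have : (d * (Cmod a + Cmod b + 2) <= eps)%R by apply/Rle_div_r; lra.
nra.
Qed.

Lemma tends_inv (f : C -> C) (a : C) : a <> 0 -> tends f a -> tends (fun t => / f t) (/ a).
Proof.
move=> a0 H eps e0; have A0 := proj1 (Cmod_gt_0 a) a0.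
have q0 : (0 < eps * Cmod a ^ 2 / 2)%R.
  by apply: Rdiv_lt_0_compat; [apply: Rmult_lt_0_compat => //; apply: pow_lt | lra].
have [B HB] := H (Rmin (Cmod a / 2) (eps * Cmod a ^ 2 / 2)) ltac:(apply: Rmin_pos; lra).
exists B => t /HB h.
have m1 := Rmin_l (Cmod a / 2) (eps * Cmod a ^ 2 / 2).
have m2 := Rmin_r (Cmod a / 2) (eps * Cmod a ^ 2 / 2).
have lb : (Cmod a / 2 < Cmod (f t))%R.
  have := Cmod_minus_triangle (f t) (f t - a); have -> : f t - (f t - a) = a by ring.
  lra.
have f0 : f t <> 0 by move=> E; rewrite E Cmod_0 in lb; lra.
have -> : / f t - / a = - (f t - a) / (f t * a) by field.
rewrite Cmod_div; last exact: Cmult_neq_0.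
rewrite Cmod_opp Cmod_mult; apply/Rlt_div_l; first by apply: Rmult_lt_0_compat; lra.
have : (eps * (Cmod a / 2 * Cmod a) < eps * (Cmod (f t) * Cmod a))%R; last lra.
by apply: Rmult_lt_compat_l => //; apply: Rmult_lt_compat_r; lra.
Qed.

Lemma exp_decay (K eps : R) : (0 < eps)%R -> exists2 B : R, (1 <= B)%R &
  forall v, (B <= v)%R -> (v ^ 2 * (K * exp (- PI * v)) < eps)%R.
Proof.
(* 64 = (1 + 3)^3 comes from [one_plus_pow_exp] with k = 3 and v = 1. It bounds v^3 exp(- pi v), and
   compared with v^2 one factor v is left to beat K / eps. *)
move=> e0; exists (Rmax 1 (64 * (Rabs K + 1) / eps))%R; first exact: Rmax_l.
move=> v hv; have m1 := Rmax_l 1 (64 * (Rabs K + 1) / eps).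
have m2 := Rmax_r 1 (64 * (Rabs K + 1) / eps).
have P := PI2_3_2; have kk := Rle_abs K; have k0 := Rabs_pos K.
have H := @one_plus_pow_exp v 1 3 ltac:(lra) ltac:(lra).
have E : (exp (- PI * v) <= exp (- (v * 1)))%R by apply: exp_le; nra.
have e1 := exp_pos (- PI * v); have e2 := exp_pos (- (v * 1)).
have H3 : (v ^ 3 * exp (- PI * v) <= 64)%R.
  have -> : (64 = (1 + INR 3 / 1) ^ 3)%R by rewrite /=; field.
  apply: Rle_trans H; apply: Rmult_le_compat => //; [apply: pow_le; lra | lra |].
  by apply: pow_incr; lra.
have : (v * (v ^ 2 * (K * exp (- PI * v))) < v * eps)%R; last by apply: Rmult_lt_reg_l; lra.
have -> : (v * (v ^ 2 * (K * exp (- PI * v))) = K * (v ^ 3 * exp (- PI * v)))%R by ring.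
have X0 : (0 <= v ^ 3 * exp (- PI * v))%R by apply: Rmult_le_pos; [apply: pow_le; lra | lra].
have : (64 * (Rabs K + 1) <= v * eps)%R by apply/Rle_div_l => //; lra.
nra.
Qed.

(** The weight [Im t ^ 2] is the one that makes the Halphen defect invariant under doubling. *)
Lemma ES_tends (I : eqType) (c : I -> C) (lam : I -> R) (L0 : seq I) :
  good c lam -> uniq L0 -> (forall i, i \in L0 -> lam i = 0%R) ->
  (forall i, i \notin L0 -> c i = 0 \/ (1 <= lam i)%R) ->
  tends (fun t => RtoC (Im t ^ 2) * (ES c lam t - \csum_(i <- L0) c i)) 0 /\
  tends (ES c lam) (\csum_(i <- L0) c i).
Proof.
move=> g u H0 H1; have [K HK] := ES_asymptotic g u H0 H1.
suff H eps : (0 < eps)%R -> exists2 B : R, (1 <= B)%R & forall t, (B <= Im t)%R ->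
    (Cmod (RtoC (Im t ^ 2) * (ES c lam t - \csum_(i <- L0) c i))%C < eps)%R.
  split=> eps e0; have [B B1 HB] := H eps e0; exists B => t ht; have := HB t ht.
    by rewrite (_ : _ - 0 = RtoC (Im t ^ 2) * (ES c lam t - \csum_(i <- L0) c i)) //; ring.
  rewrite Cmod_mult Cmod_R Rabs_pos_eq; last exact: pow2_ge_0.
  have i1 : (1 <= Im t ^ 2)%R by nra.
  by have := Rmult_le_compat_r _ _ _ (Cmod_ge_0 (ES c lam t - \csum_(i <- L0) c i)) i1; lra.
move=> e0; have [B B1 HB] := exp_decay K e0; exists B => // t ht.
rewrite Cmod_mult Cmod_R Rabs_pos_eq; last exact: pow2_ge_0.
apply: Rle_lt_trans (HB _ ht); apply: Rmult_le_compat_l; first exact: pow2_ge_0.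
by apply: HK; lra.
Qed.

Lemma sq_ge1 (n : Z) : n \notin [:: 0%Z] -> (1 <= sq n)%R.
Proof.
rewrite inE => /eqP h; have : (1 <= n ^ 2)%Z by nia.
by move=> /IZR_le; rewrite /sq pow_IZR.
Qed.

(** The exponents (n + 1/2)^2 lowered by 1/4. They vanish at n = 0 and n = -1, so division by exp(pi
    i tau / 4) leaves half-integral sums with a nonzero limit at i oo, as the doubling arguments
    require. *)
Definition qsq (n : Z) : R := (IZR n ^ 2 + IZR n)%R.

Lemma qsq_ge0 n : (0 <= qsq n)%R.
Proof.
have : (0 <= n * n + n)%Z by nia.
by move=> /IZR_le; rewrite plus_IZR mult_IZR /qsq; nra.
Qed.

Lemma qsq_weight n : (1 + IZR n ^ 2 <= 4 * (1 + qsq n))%R.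
Proof. by rewrite /qsq; have := pow2_ge_0 (3 * IZR n + 2); nra. Qed.

Lemma qsq_0 n : n \in [:: 0; -1]%Z -> qsq n = 0%R.
Proof. by rewrite !inE => /orP[] /eqP ->; rewrite /qsq /=; ring. Qed.

Lemma qsq_ge1 n : n \notin [:: 0; -1]%Z -> (1 <= qsq n)%R.
Proof.
rewrite !inE => /norP[/eqP h1 /eqP h2]; have : (1 <= n * n + n)%Z by nia.
by move=> /IZR_le; rewrite plus_IZR mult_IZR /qsq; nra.
Qed.

Lemma hsq_qsq n : hsq n = (1 / 4 + qsq n)%R.
Proof. by rewrite /hsq /qsq; field. Qed.

Lemma good_qsq (c : Z -> C) (b : R) : (0 <= b)%R ->
  (forall n, Cmod (c n) <= b * (1 + qsq n))%R -> good c qsq.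
Proof. move=> b0; apply: (@good_Z _ _ 4) => //; [exact: qsq_ge0 | exact: qsq_weight]. Qed.

Lemma good2h : good one_c qsq.
Proof.
apply: (@good_qsq _ 1) => [|n]; first lra.
by rewrite Cmod_1; have := qsq_ge0 n; lra.
Qed.

Lemma good1h : good sgn_odd qsq.
Proof.
apply: (@good_qsq _ 4) => [|n]; first lra.
rewrite Cmod_mult Cmod_sgn Cmod_R /qsq.
have := pow2_ge_0 (IZR n - 1 / 2); have := pow2_ge_0 (IZR n + 3 / 2).
split_Rabs; nra.
Qed.

Lemma ES_hsq (c : Z -> C) tau : good c hsq -> good c qsq -> upper tau ->
  ES c hsq tau = eterm (1 / 4) tau * ES c qsq tau.
Proof.
move=> g1 g2 ut; apply: has_sum_unique (ES_has_sum g1 ut) _.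
apply: has_sum_ext (has_sum_scal (eterm (1 / 4) tau) (ES_has_sum g2 ut)) => n.
by rewrite hsq_qsq -eterm_mul; ring.
Qed.

Lemma eterm_neq0 l tau : eterm l tau <> 0.
Proof. exact: Cexp_neq0. Qed.

Lemma tends_neq0 (f : C -> C) (a : C) : a <> 0 -> tends f a ->
  exists B : R, forall t, (B <= Im t)%R -> f t <> 0.
Proof.
move=> /Cmod_gt_0 a0 H; have [B HB] := H _ a0; exists B => t /HB h E.
rewrite E in h; rewrite (_ : 0 - a = - a) ?Cmod_opp in h; [lra | ring].
Qed.

Lemma C1_neq0 : RtoC 1 <> 0.
Proof. by move=> /RtoC_inj; lra. Qed.
Lemma C2_neq0 : RtoC 2 <> 0.
Proof. by move=> /RtoC_inj; lra. Qed.

Lemma T3_tends : tends T3 1.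
Proof.
have [|n|n h|_] := @ES_tends _ one_c sq [:: 0%Z] good3 => //.
- by rewrite inE => /eqP ->; rewrite /sq /=; ring.
- by right; apply: sq_ge1.
- by rewrite big_seq1.
Qed.

Lemma T4_tends : tends T4 1.
Proof.
have [|n|n h|_] := @ES_tends _ sgn sq [:: 0%Z] good4 => //.
- by rewrite inE => /eqP ->; rewrite /sq /=; ring.
- by right; apply: sq_ge1.
- by rewrite big_seq1.
Qed.

Lemma T2h_tends : tends (ES one_c qsq) 2.
Proof.
have [|n|n h|_] := @ES_tends _ one_c qsq [:: 0; -1]%Z good2h => //.
- exact: qsq_0.
- by right; apply: qsq_ge1.
- rewrite big_cons big_seq1 /one_c (_ : 1 + 1 = 2) //; ring.
Qed.

Lemma T1h_tends : tends (ES sgn_odd qsq) 2.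
Proof.
have [|n|n h|_] := @ES_tends _ sgn_odd qsq [:: 0; -1]%Z good1h => //.
- exact: qsq_0.
- by right; apply: qsq_ge1.
- rewrite big_cons big_seq1 /sgn_odd /sgn /=.
  have -> : (-1 * 1 = -1)%R by ring.
  have -> : (/ -1 = -1)%R by field.
  by have -> : RtoC 1 * RtoC (2 * 0 + 1)%R + RtoC (-1) * RtoC (2 * -1 + 1)%R = 2
    by rewrite -!RtoC_mult -RtoC_plus; congr RtoC; ring.
Qed.

Lemma Cmult_neq0_inv (a b : C) : a * b <> 0 -> a <> 0 /\ b <> 0.
Proof. by move=> h; split=> E; apply: h; rewrite E; ring. Qed.

(** By [T3_T4], the value of [T4] at 2 tau controls both [T3] and [T4] at tau. *)
Lemma T34_neq0 tau : upper tau -> T3 tau <> 0 /\ T4 tau <> 0.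
Proof.
have [B3 H3] := tends_neq0 C1_neq0 T3_tends.
have [B4 H4] := tends_neq0 C1_neq0 T4_tends.
move: tau; apply: (@doubling_ind (fun t => T3 t <> 0 /\ T4 t <> 0) (Rmax B3 B4)).
  move=> t ut [_ h]; apply: Cmult_neq0_inv; rewrite T3_T4 //.
  exact: Cmult_neq_0.
move=> t ht; have m1 := Rmax_l B3 B4; have m2 := Rmax_r B3 B4.
by split; [apply: H3; lra | apply: H4; lra].
Qed.

Lemma T3_neq0 tau : upper tau -> T3 tau <> 0. Proof. by case/T34_neq0. Qed.
Lemma T4_neq0 tau : upper tau -> T4 tau <> 0. Proof. by case/T34_neq0. Qed.

Lemma T2_eq tau : upper tau -> T2 tau = eterm (1 / 4) tau * ES one_c qsq tau.
Proof. exact: ES_hsq good2 good2h. Qed.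

Lemma T2_neq0 tau : upper tau -> T2 tau <> 0.
Proof.
have [B H] := tends_neq0 C2_neq0 T2h_tends.
move: tau; apply: (@doubling_ind (fun t => T2 t <> 0) (Rmax 1 B)).
  move=> t ut h; suff : T2 t * T2 t <> 0 by case/Cmult_neq0_inv.
  rewrite T2_sq //; apply: Cmult_neq_0; first exact: C2_neq0.
  by apply: Cmult_neq_0 => //; apply/T3_neq0/upper_double.
move=> t ht; have m1 := Rmax_l 1 B; have m2 := Rmax_r 1 B.
rewrite T2_eq; last by rewrite /upper; lra.
by apply: Cmult_neq_0; [exact: eterm_neq0 | apply: H; lra].
Qed.

Lemma T2h_neq0 tau : upper tau -> ES one_c qsq tau <> 0.
Proof. by move=> ut; have := T2_neq0 ut; rewrite T2_eq // => /Cmult_neq0_inv []. Qed.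

(* The ratio of the two sides is invariant under tau -> 2 tau and tends to 1. *)
Lemma jacobi_derivative tau : upper tau -> T1' tau = T2 tau * T3 tau * T4 tau.
Proof.
move=> ut; pose R t := T1' t * / (T2 t * T3 t * T4 t).
have den t : upper t -> T2 t * T3 t * T4 t <> 0.
  move=> h; apply: Cmult_neq_0; last exact: T4_neq0.
  by apply: Cmult_neq_0; [exact: T2_neq0|exact: T3_neq0].
suff H : R tau = 1.
  have d := den _ ut; rewrite -[RHS]Cmult_1_l -H /R -Cmult_assoc Cinv_l // Cmult_1_r //.
apply: (@doubling_const R 1) ut => [t ut|].
  have n2 := T2_neq0 ut; have n3 := T3_neq0 ut; have n4 := T4_neq0 ut.
  have ut2 := upper_double ut.
  have m2 := T2_neq0 ut2; have m3 := T3_neq0 ut2; have m4 := T4_neq0 ut2.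
  have -> : R t = T1' t * T2 t / (T2 t * T2 t * (T3 t * T4 t)) by rewrite /R; field.
  rewrite T1'_T2 // T2_sq // T3_T4 // /R; field; do !split => //; exact: C2_neq0.
have H := tends_mul T1h_tends (tends_inv _ (tends_mul (tends_mul T2h_tends T3_tends) T4_tends)).
have -> : RtoC 1 = 2 * / (2 * 1 * 1) by field.
have h2 : 2 * 1 * 1 <> 0 by rewrite !Cmult_1_r; exact: C2_neq0.
apply: tends_ext (H h2) => t u.
have n3 := T3_neq0 u; have n4 := T4_neq0 u; have n2 := T2h_neq0 u.
have E1 : T1' t = eterm (1 / 4) t * ES sgn_odd qsq t := ES_hsq good1' good1h u.
rewrite /R E1 T2_eq //.
by field; do !split => //; exact: eterm_neq0.
Qed.

(** With a and b the values of [T3] and [T2] at 2 tau, it is (a^2 + b^2)^2 = (2 a b)^2 + (a^2 -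
    b^2)^2. *)
Lemma jacobi_quartic tau : upper tau -> T3 tau ^ 4 = T2 tau ^ 4 + T4 tau ^ 4.
Proof.
move=> ut; have E (a : C) : a ^ 4 = (a * a) * (a * a) by ring.
by rewrite !E (T3_sq ut) (T4_sq ut) (T2_sq ut); ring.
Qed.

(** * Logarithmic derivatives of the theta constants *)

Lemma T3_deriv tau : upper tau -> Cderiv T3 tau (dT3 tau).
Proof. exact: ES_deriv good3. Qed.
Lemma T4_deriv tau : upper tau -> Cderiv T4 tau (dT4 tau).
Proof. exact: ES_deriv good4. Qed.
Lemma T2_deriv tau : upper tau -> Cderiv T2 tau (dT2 tau).
Proof. exact: ES_deriv good2. Qed.

Definition w3 (tau : C) : C := dT3 tau / T3 tau.
Definition w4 (tau : C) : C := dT4 tau / T4 tau.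
Definition w2 (tau : C) : C := dT2 tau / T2 tau.
(** The common constant in the three differences of logarithmic derivatives, and also the limit of
    [w2] at i oo, because [T2] behaves there like 2 exp(pi i tau / 4). *)
Definition kappa : C := RtoC PI * Ci / 4.

Lemma dT3_w tau : upper tau -> dT3 tau = w3 tau * T3 tau.
Proof. by move=> /T3_neq0 h; rewrite /w3; field. Qed.
Lemma dT4_w tau : upper tau -> dT4 tau = w4 tau * T4 tau.
Proof. by move=> /T4_neq0 h; rewrite /w4; field. Qed.
Lemma dT2_w tau : upper tau -> dT2 tau = w2 tau * T2 tau.
Proof. by move=> /T2_neq0 h; rewrite /w2; field. Qed.

(** The Wronskian divided by T3 T4: [jacobi_derivative] at 2 tau and the doubling identities for
    T2^2 and T3 T4 bring the quotient back to tau. *)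
Lemma w34 tau : upper tau -> w3 tau - w4 tau = kappa * T2 tau ^ 4.
Proof.
move=> ut; have ut2 := upper_double ut.
have n3 := T3_neq0 ut; have n4 := T4_neq0 ut.
have -> : w3 tau - w4 tau = (dT3 tau * T4 tau - dT4 tau * T3 tau) / (T3 tau * T4 tau).
  by rewrite /w3 /w4; field.
rewrite wronskian34 // jacobi_derivative //.
have -> : T2 tau ^ 4 = (T2 tau * T2 tau) * (T2 tau * T2 tau) by ring.
rewrite T2_sq // T3_T4 // /kappa; field; exact: T4_neq0.
Qed.

Lemma Csub_eq0 (a b : C) : a - b = 0 -> a = b.
Proof.
move=> H; have -> : a = (a - b) + b by ring.
by rewrite H Cplus_0_l.
Qed.

Lemma Ceq_mul_reg (c a b : C) : c <> 0 -> c * a = c * b -> a = b.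
Proof.
by move=> c0 H; rewrite -[a]Cmult_1_l -[b]Cmult_1_l -(Cinv_l _ c0) -!Cmult_assoc H.
Qed.

Lemma w24_w23 tau : upper tau ->
  w2 tau - w4 tau = kappa * T3 tau ^ 4 /\ w2 tau - w3 tau = kappa * T4 tau ^ 4.
Proof.
move=> ut; have n2 := T2_neq0 ut; have J := jacobi_quartic ut.
have D3 := Cderiv_pow 4 (T3_deriv ut).
have D24 := Cderiv_add (Cderiv_pow 4 (T2_deriv ut)) (Cderiv_pow 4 (T4_deriv ut)).
(* The differentiated quartic identity is a second linear relation between the logarithmic
   derivatives; with [w34] it determines the other two differences. *)
have E : w3 tau * T3 tau ^ 4 = w2 tau * T2 tau ^ 4 + w4 tau * T4 tau ^ 4.
  have := Cderiv_unique (Cderiv_ext ut (fun t h => jacobi_quartic h) D3) D24.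
  rewrite dT3_w // dT2_w // dT4_w //.
  have -> : RtoC (INR 4) = 4 by congr RtoC; rewrite /=; ring.
  rewrite [_.-1]/= => H; apply: (@Ceq_mul_reg 4); first by move=> /RtoC_inj; lra.
  by transitivity (4 * T3 tau ^ 3 * (w3 tau * T3 tau)); [ring | rewrite H; ring].
have W := w34 ut.
have F : w2 tau - w3 tau = kappa * T4 tau ^ 4.
  apply: (@Ceq_mul_reg (T2 tau ^ 4)); first exact: Cpow_nz.
  have -> : T2 tau ^ 4 * (w2 tau - w3 tau) = w2 tau * T2 tau ^ 4 - w3 tau * T2 tau ^ 4 by ring.
  have -> : w2 tau * T2 tau ^ 4 = w3 tau * T3 tau ^ 4 - w4 tau * T4 tau ^ 4 by rewrite E; ring.
  have -> : T2 tau ^ 4 * (kappa * T4 tau ^ 4) = (w3 tau - w4 tau) * T4 tau ^ 4 by rewrite W; ring.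
  by rewrite J; ring.
split=> //.
have -> : w2 tau - w4 tau = (w2 tau - w3 tau) + (w3 tau - w4 tau) by ring.
by rewrite F W J; ring.
Qed.

Lemma double_deriv tau : Cderiv (fun t => 2 * t) tau 2.
Proof. by apply: Cderiv_eq (Cderiv_scal 2 (Cderiv_id tau)); ring. Qed.

Lemma w34_double tau : upper tau -> w3 tau + w4 tau = 4 * w4 (2 * tau).
Proof.
move=> ut; have ut2 := upper_double ut.
have n3 := T3_neq0 ut; have n4 := T4_neq0 ut; have m4 := T4_neq0 ut2.
have D1 := Cderiv_mul (T3_deriv ut) (T4_deriv ut).
have D2 := Cderiv_comp (T4_deriv ut2) (double_deriv tau).
have := Cderiv_unique (Cderiv_ext ut (fun t h => T3_T4 h) D1) (Cderiv_mul D2 D2).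
rewrite dT3_w // !dT4_w // => H; apply: (@Ceq_mul_reg (T3 tau * T4 tau)).
  exact: Cmult_neq_0.
transitivity (w3 tau * T3 tau * T4 tau + T3 tau * (w4 tau * T4 tau)); first ring.
by rewrite H T3_T4 //; ring.
Qed.

Lemma w2_double tau : upper tau -> w2 tau = w2 (2 * tau) + w3 (2 * tau).
Proof.
move=> ut; have ut2 := upper_double ut.
have n2 := T2_neq0 ut; have m2 := T2_neq0 ut2; have m3 := T3_neq0 ut2.
have D1 := Cderiv_mul (T2_deriv ut) (T2_deriv ut).
have D2 := Cderiv_comp (T2_deriv ut2) (double_deriv tau).
have D3 := Cderiv_comp (T3_deriv ut2) (double_deriv tau).
have := Cderiv_unique (Cderiv_ext ut (fun t h => T2_sq h) D1) (Cderiv_scal 2 (Cderiv_mul D2 D3)).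
rewrite !dT2_w // dT3_w // => H; apply: (@Ceq_mul_reg (2 * (T2 tau * T2 tau))).
  by apply: Cmult_neq_0; [exact: C2_neq0 | exact: Cmult_neq_0].
transitivity (w2 tau * T2 tau * T2 tau + T2 tau * (w2 tau * T2 tau)); first ring.
by rewrite H T2_sq //; ring.
Qed.

(** * Halphen's equation for the derivative of [w3] *)

Definition dw3 (tau : C) : C :=
  (ES (Dc (Dc one_c sq) sq) sq tau * T3 tau - dT3 tau * dT3 tau) / (T3 tau * T3 tau).
Definition dw4 (tau : C) : C :=
  (ES (Dc (Dc sgn sq) sq) sq tau * T4 tau - dT4 tau * dT4 tau) / (T4 tau * T4 tau).

Lemma w3_deriv tau : upper tau -> Cderiv w3 tau (dw3 tau).
Proof.
move=> ut; apply: Cderiv_div (T3_deriv ut); first exact: T3_neq0.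
exact: ES_deriv (good_Dc good3) ut.
Qed.

Lemma w4_deriv tau : upper tau -> Cderiv w4 tau (dw4 tau).
Proof.
move=> ut; apply: Cderiv_div (T4_deriv ut); first exact: T4_neq0.
exact: ES_deriv (good_Dc good4) ut.
Qed.

Lemma dw34 tau : upper tau -> dw3 tau - dw4 tau = 4 * w2 tau * (w3 tau - w4 tau).
Proof.
move=> ut; have D := Cderiv_sub (w3_deriv ut) (w4_deriv ut).
have D2 := Cderiv_scal kappa (Cderiv_pow 4 (T2_deriv ut)).
rewrite (Cderiv_unique (Cderiv_ext ut (fun t h => w34 h) D) D2) w34 // dT2_w //.
have -> : RtoC (INR 4) = 4 by congr RtoC; rewrite /=; ring.
by rewrite [_.-1]/=; ring.
Qed.

Lemma dw34_double tau : upper tau -> dw3 tau + dw4 tau = 8 * dw4 (2 * tau).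
Proof.
move=> ut; have ut2 := upper_double ut.
have D := Cderiv_add (w3_deriv ut) (w4_deriv ut).
have D2 := Cderiv_scal 4 (Cderiv_comp (w4_deriv ut2) (double_deriv tau)).
rewrite (Cderiv_unique (Cderiv_ext ut (fun t h => w34_double h) D) D2).
ring.
Qed.

Definition halphen_defect (tau : C) : C :=
  dw3 tau - 2 * (w2 tau * w3 tau + w3 tau * w4 tau - w2 tau * w4 tau).

(** All relations but one are linear and serve for elimination. The product w2 w3 at 2 tau is found
    from the sum and the difference of its factors: the sum is [w2 tau], and the square of the
    difference is known from theta values. *)
Lemma halphen_defect_double tau : upper tau ->
  4 * halphen_defect (2 * tau) = halphen_defect tau.
Proof.
move=> ut; have ut2 := upper_double ut; rewrite /halphen_defect.
have h1 := dw34 ut; have h2 := dw34 ut2; have h3 := dw34_double ut.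
have h4 := w34_double ut; have h5 := w2_double ut.
have [k24 k23] := w24_w23 ut; have [_ k23'] := w24_w23 ut2.
(* Both sides equal kappa^2 (T3 T4)^4 at tau, because T4 (2 tau)^2 = T3 T4. *)
have h6 : (w2 (2 * tau) - w3 (2 * tau)) * (w2 (2 * tau) - w3 (2 * tau))
   = (w2 tau - w4 tau) * (w2 tau - w3 tau).
  rewrite k24 k23 k23'.
  have -> : T4 (2 * tau) ^ 4 = (T4 (2 * tau) * T4 (2 * tau)) * (T4 (2 * tau) * T4 (2 * tau)) by ring.
  by rewrite -T3_T4 //; ring.
move: h1 h2 h3 h4 h5 h6.
move: (dw3 tau) (dw4 tau) (dw3 (2 * tau)) (dw4 (2 * tau)) (w2 tau) (w3 tau) (w4 tau)
  (w2 (2 * tau)) (w3 (2 * tau)) (w4 (2 * tau)) => d3 d4 D3 D4 a2 a3 a4 b2 b3 b4 h1 h2 h3 h4 h5 h6.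
have E3 : D3 = D4 + 4 * b2 * (b3 - b4) by rewrite -h2; ring.
have E4 : D4 = (d3 + d4) / 8 by rewrite h3; field.
have F4 : b4 = (a3 + a4) / 4 by rewrite h4; field.
have F3 : d4 = d3 - 4 * a2 * (a3 - a4) by rewrite -h1; ring.
have P : 4 * (b2 * b3) = a2 * a2 - (a2 - a4) * (a2 - a3) by rewrite -h6 h5; ring.
have -> : 4 * (D3 - 2 * (b2 * b3 + b3 * b4 - b2 * b4)) =
  4 * D4 + 2 * (4 * (b2 * b3)) - 8 * (b4 * (b2 + b3)) by rewrite E3; ring.
by rewrite P -h5 E4 F4 F3; field.
Qed.

Lemma Dc_sq_tends (c : Z -> C) : good c sq ->
  tends (fun t => RtoC (Im t ^ 2) * ES (Dc c sq) sq t) 0 /\ tends (ES (Dc c sq) sq) 0.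
Proof.
move=> g; have [|//|n _|A B] := @ES_tends _ (Dc c sq) sq [::] (good_Dc g) => //.
  have [->|n0] := eqVneq n 0%Z; first by left; rewrite /Dc /sq /= Rmult_0_l Cmult_0_r Cmult_0_l.
  by right; apply: sq_ge1; rewrite inE.
rewrite big_nil in A B; split=> //; apply: tends_ext A => t _; ring.
Qed.

Lemma w2_tends : tends w2 kappa.
Proof.
have [|n|n _|_ B] := @ES_tends _ (Dc one_c qsq) qsq [::] (good_Dc good2h) => //.
  have [h|h] := boolP (n \in [:: 0; -1]%Z); last by right; apply: qsq_ge1.
  by left; rewrite /Dc qsq_0 // Cmult_0_r Cmult_0_l.
rewrite big_nil in B.
have H := tends_add (tends_const kappa) (tends_mul B (tends_inv C2_neq0 T2h_tends)).
have -> : kappa = kappa + 0 * / 2 by ring.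
apply: tends_ext H => t ut; rewrite /w2 T2_eq //.
have -> : dT2 t = eterm (1 / 4) t * (kappa * ES one_c qsq t + ES (Dc one_c qsq) qsq t).
  apply: has_sum_unique (ES_has_sum (good_Dc good2) ut) _.
  have H1 := has_sum_scal kappa (ES_has_sum good2h ut).
  have := has_sum_scal (eterm (1 / 4) t) (has_sum_add H1 (ES_has_sum (good_Dc good2h) ut)).
  apply: has_sum_ext => n; rewrite /Dc hsq_qsq -eterm_mul /kappa !RtoC_plus RtoC_div; last lra.
  by rewrite /one_c; field.
have n2 := T2h_neq0 ut; field; split=> //; exact: eterm_neq0.
Qed.

Lemma halphen_defect_0 tau : upper tau -> halphen_defect tau = 0.
Proof.
move=> ut; suff H : RtoC (Im tau ^ 2) * halphen_defect tau = 0.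
  apply: (@Ceq_mul_reg (RtoC (Im tau ^ 2))); last by rewrite H; ring.
  move=> /RtoC_inj; rewrite /upper in ut; nra.
apply: (@doubling_const (fun t => RtoC (Im t ^ 2) * halphen_defect t) 0) ut.
  move=> t ut; rewrite -(halphen_defect_double ut) Im_double.
  have -> : ((2 * Im t) ^ 2 = 4 * Im t ^ 2)%R by ring.
  by rewrite RtoC_mult; ring.
(* Each monomial of the defect contains a derivative of [T3] or [T4], which tends to 0 even after
   multiplication by [Im t ^ 2]; the other factors converge. *)
have [A3 B3] := Dc_sq_tends good3; have [A4 B4] := Dc_sq_tends good4.
have [A33 _] := Dc_sq_tends (good_Dc good3).
have I3 := tends_inv C1_neq0 T3_tends; have I4 := tends_inv C1_neq0 T4_tends.
have I33 := tends_mul I3 I3.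
have V3 := tends_mul A3 I3; have V4 := tends_mul A4 I4.
have W3 := tends_mul B3 I3; have W4 := tends_mul B4 I4.
have X1 := tends_mul A33 I3.
have X2 := tends_mul (tends_mul A3 B3) I33.
have X3 := tends_mul w2_tends V3.
have X4 := tends_mul V3 W4.
have X5 := tends_mul w2_tends V4.
have m1 := tends_const (-1); have m2 := tends_const (-2); have p2 := tends_const 2.
have := tends_add (tends_add (tends_add (tends_add X1 (tends_mul m1 X2))
  (tends_mul m2 X3)) (tends_mul m2 X4)) (tends_mul p2 X5).
set a := (X in tends _ X); have -> : a = 0 by rewrite /a; field.
apply: tends_ext => t ut; have n3 := T3_neq0 ut; have n4 := T4_neq0 ut.
rewrite /halphen_defect /dw3 /w3 /w4 /dT3 /dT4.
move: (RtoC (Im t ^ 2)%R) (w2 t) (ES (Dc (Dc one_c sq) sq) sq t) (ES (Dc one_c sq) sq t)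
  (ES (Dc sgn sq) sq t) n3 n4 => v a2 d33 d3 d4; move: (T3 t) (T4 t) => t3 t4 n3 n4.
by field.
Qed.

Lemma halphen tau : upper tau ->
  dw3 tau = 2 * (w2 tau * w3 tau + w3 tau * w4 tau - w2 tau * w4 tau).
Proof.
by move=> /halphen_defect_0 H; apply: Csub_eq0.
Qed.

(** * Discrete Fourier analysis of quasi-periodic functions *)

(* What the discrete Fourier argument needs of holomorphy. *)
Definition tay (F : C -> C) : Prop :=
  exists F' : C -> C, forall r : R, (0 < r)%R -> exists2 K : R, (0 <= K)%R &
    forall z h : C, (Cmod z <= r)%R -> (Cmod h <= r)%R ->
      [/\ (Cmod (F z) <= K)%R, (Cmod (F' z) <= K)%R &
          (Cmod (F (z + h) - F z - F' z * h)%C <= K * Cmod h ^ 2)%R].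

Lemma tay_mul (F G : C -> C) : tay F -> tay G -> tay (fun z => F z * G z).
Proof.
move=> [F' HF] [G' HG]; exists (fun z => F' z * G z + F z * G' z) => r r0.
(* The radius is doubled because [F] must also be bounded at z + h. *)
have [K K0 HK] := HF (2 * r)%R ltac:(lra); have [M M0 HM] := HG (2 * r)%R ltac:(lra).
have KM : (0 <= K * M)%R by nra.
exists (2 * (K * M) + K * M * (2 + r))%R => [|z h hz hh]; first nra.
have [f0 f1 f2] := HK z h ltac:(lra) ltac:(lra); have [g0 g1 g2] := HM z h ltac:(lra) ltac:(lra).
have zh : (Cmod (z + h) <= 2 * r)%R by have := Cmod_triangle z h; lra.
have [k0 _ _] := HK (z + h) h zh ltac:(lra).
have h0 := Cmod_ge_0 h; have h2 := pow2_ge_0 (Cmod h).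
have p1 (a b : C) : (Cmod a <= K)%R -> (Cmod b <= M)%R -> (Cmod a * Cmod b <= K * M)%R.
  by move=> ha hb; apply: Rmult_le_compat => //; apply: Cmod_ge_0.
split.
- by rewrite Cmod_mult; have := p1 _ _ f0 g0; nra.
- have := Cmod_triangle (F' z * G z) (F z * G' z); rewrite !Cmod_mult.
  by have := p1 _ _ f1 g0; have := p1 _ _ f0 g1; nra.
- have -> : F (z + h) * G (z + h) - F z * G z - (F' z * G z + F z * G' z) * h
    = F (z + h) * (G (z + h) - G z - G' z * h)
      + ((F (z + h) - F z - F' z * h) * (G z + G' z * h) + F' z * G' z * (h * h)) by ring.
  apply: Rle_trans (Cmod_triangle _ _) _.
  have := Cmod_triangle ((F (z + h) - F z - F' z * h) * (G z + G' z * h)) (F' z * G' z * (h * h)).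
  have := Cmod_triangle (G z) (G' z * h); rewrite !Cmod_mult.
  have q1 : (Cmod (F (z + h)%C) * Cmod (G (z + h) - G z - G' z * h)%C <= K * M * Cmod h ^ 2)%R.
    rewrite Rmult_assoc; apply: Rmult_le_compat => //; apply: Cmod_ge_0.
  have q2 : (Cmod (G' z) * Cmod h <= M * r)%R by apply: Rmult_le_compat => //; apply: Cmod_ge_0.
  move=> q3 q4.
  have q5 : (Cmod (F (z + h) - F z - F' z * h)%C * Cmod (G z + G' z * h)%C
     <= K * Cmod h ^ 2 * (M + M * r))%R.
    by apply: Rmult_le_compat => //; try apply: Cmod_ge_0; lra.
  have q6 : (Cmod (F' z) * Cmod (G' z) * (Cmod h * Cmod h) <= K * M * Cmod h ^ 2)%R.
    have -> : (Cmod h ^ 2 = Cmod h * Cmod h)%R by ring.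
    by apply: Rmult_le_compat_r; [nra | apply: p1].
  nra.
Qed.

Lemma exp_sq_bound (m : R) : (0 <= m)%R -> (m ^ 2 <= 2 * exp m)%R.
Proof.
move=> m0; have := exp_ge_taylor m 2 m0; rewrite /= => H.
have : (m * (m * 1) / (1 + 1) <= exp m)%R; first lra.
nra.
Qed.

Lemma Cexp_le (w : C) : (Cmod (Cexp w) <= exp (Cmod w))%R.
Proof.
rewrite Cmod_Cexp; apply: exp_le; apply: Rle_trans (Rle_abs _) (Cmod_Re_le w).
Qed.

Lemma tay_exp (a : C) : tay (fun z => Cexp (a * z)).
Proof.
exists (fun z => a * Cexp (a * z)) => r r0; have a0 := Cmod_ge_0 a.
pose E := exp (Cmod a * r); have E1 : (0 < E)%R := exp_pos _.
have X1 : (0 <= Cmod a * E)%R by apply: Rmult_le_pos; lra.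
have X2 : (0 <= E * (Cmod a ^ 2 * E))%R.
  by apply: Rmult_le_pos; [lra | apply: Rmult_le_pos; [exact: pow2_ge_0 | lra]].
exists (E + Cmod a * E + E * (Cmod a ^ 2 * E))%R => [|z h hz hh]; first lra.
have B (y : C) : (Cmod y <= r)%R -> (exp (Cmod (a * y)%C) <= E)%R.
  by move=> hy; apply: exp_le; rewrite Cmod_mult; apply: Rmult_le_compat_l.
have hE : (Cmod (Cexp (a * z)) <= E)%R := Rle_trans _ _ _ (Cexp_le _) (B z hz).
split.
- lra.
- by rewrite Cmod_mult; have := Rmult_le_compat_l _ _ _ a0 hE; lra.
- have -> : Cexp (a * (z + h)) - Cexp (a * z) - a * Cexp (a * z) * h
     = Cexp (a * z) * (Cexp (a * h) - 1 - a * h).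
    by rewrite Cmult_plus_distr_l Cexp_add; ring.
  have h2 := pow2_ge_0 (Cmod h).
  apply: (Rle_trans _ (E * (Cmod a ^ 2 * E) * Cmod h ^ 2)); last first.
    by apply: Rmult_le_compat_r => //; lra.
  rewrite Cmod_mult; have T := Cexp_taylor (a * h).
  have T2 : (Cmod (Cexp (a * h) - 1 - a * h)%C <= Cmod a ^ 2 * E * Cmod h ^ 2)%R.
    apply: Rle_trans T _; rewrite Cmod_mult.
    have -> : ((Cmod a * Cmod h) ^ 2 = Cmod a ^ 2 * Cmod h ^ 2)%R by ring.
    have -> : (Cmod a ^ 2 * E * Cmod h ^ 2 = Cmod a ^ 2 * Cmod h ^ 2 * E)%R by ring.
    apply: Rmult_le_compat_l; first by apply: Rmult_le_pos => //; exact: pow2_ge_0.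
    by have := B h hh; rewrite Cmod_mult.
  rewrite Rmult_assoc; apply: Rmult_le_compat hE T2; exact: Cmod_ge_0.
Qed.

(** A Riemann sum for the integral over the segment from z to z + 1; applied to a function times a
    character, it stands for a Fourier coefficient. *)
Definition avg (N : nat) (F : C -> C) (z : C) : C :=
  \csum_(0 <= j < N) F (z + RtoC (INR j / INR N)) / RtoC (INR N).

Lemma cyclic_shift (F : C -> C) (z : C) (N : nat) : (0 < N)%nat ->
  (forall w, F (w + 1) = F w) ->
  \csum_(0 <= j < N) F (z + RtoC (INR j.+1 / INR N))
  = \csum_(0 <= j < N) F (z + RtoC (INR j / INR N)).
Proof.
case: N => // N _ per; pose f j := F (z + RtoC (INR j / INR N.+1)).
have n0 : INR N.+1 <> 0%R by apply: not_0_INR.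
have E : f N.+1 = f 0%nat.
  rewrite /f /Rdiv Rinv_r // Rmult_0_l -(per (z + 0)); congr F; ring.
have H := csum_recl f N.+1; rewrite csum_recr E Cplus_comm in H.
have {}H : \csum_(0 <= i < N.+1) f i = \csum_(0 <= i < N.+1) f i.+1.
  move: H; set a := bigop _ _ _; set b := bigop _ _ _ => H.
  have -> : a = (f 0%nat + a) - f 0%nat by ring.
  by rewrite H; ring.
by rewrite -/(bigop _ _ _) -[RHS]/(\csum_(0 <= i < N.+1) f i) H.
Qed.

Lemma csum_bound (N : nat) (f : nat -> C) (K : R) :
  (forall j, (j < N)%nat -> (Cmod (f j) <= K)%R) ->
  (Cmod (\csum_(0 <= j < N) f j) <= INR N * K)%R.
Proof.
move=> H; apply: Rle_trans (Cmod_csum _ _) _.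
have -> : INR N = INR (size (index_iota 0 N)) by rewrite size_iota subn0.
rewrite -rsum_const; apply: rsum_le_in => j; rewrite mem_index_iota => hj; exact: H.
Qed.

Lemma frac_le1 (j N : nat) : (j < N)%nat -> (0 <= INR j / INR N <= 1)%R.
Proof.
move=> h; have N0 : (0 < INR N)%R by apply: lt_0_INR; lia.
have j0 := pos_INR j; split; first by apply: Rmult_le_pos => //; apply/Rlt_le/Rinv_0_lt_compat.
apply/Rle_div_l => //; rewrite Rmult_1_l; apply: le_INR; lia.
Qed.

(** The first-order change is v / N^2 times the sum of F' over the grid. That sum stays bounded,
    because by periodicity the increments of F along the grid cancel and only second-order errors
    are left. *)
Lemma avg_step (F : C -> C) (r : R) : (0 < r)%R -> tay F -> (forall w, F (w + 1) = F w) ->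
  exists2 K : R, (0 <= K)%R & forall (N : nat) (z v : C), (0 < N)%nat ->
    (Cmod z <= r)%R -> (Cmod v <= r)%R ->
    (Cmod (avg N F (z + v / RtoC (INR N)) - avg N F z)%C <= K / INR N ^ 2)%R.
Proof.
move=> r0 [F' HF] per; have [K K0 HK] := HF (r + 1)%R ltac:(lra).
exists (K * r + K * r ^ 2)%R.
  by have := pow2_ge_0 r; nra.
move=> N z v N0 hz hv; have n1 : (1 <= INR N)%R by apply: (le_INR 1); lia.
have n0 : RtoC (INR N) <> 0 by move=> /RtoC_inj; lra.
pose x j := z + RtoC (INR j / INR N).
have xb j : (j < N)%nat -> (Cmod (x j) <= r + 1)%R.
  move=> hj; have := Cmod_triangle z (RtoC (INR j / INR N)); rewrite Cmod_R.
  by have := frac_le1 hj => b; rewrite Rabs_pos_eq /x; lra.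
have i0 : (0 < / INR N)%R by apply: Rinv_0_lt_compat; lra.
have i1 : (/ INR N <= 1)%R by rewrite -Rinv_1; apply: Rinv_le_contravar; lra.
pose h := v / RtoC (INR N).
have mh : Cmod h = (Cmod v * / INR N)%R.
  by rewrite Cmod_div // Cmod_R Rabs_pos_eq; lra.
have hb : (Cmod h <= r + 1)%R by rewrite mh; have := Cmod_ge_0 v; nra.
pose D := \csum_(0 <= j < N) F' (x j).
(* telescoping over the periodic grid *)
have HD : (Cmod D <= K)%R.
  have E : D * RtoC (/ INR N) = \csum_(0 <= j < N)
     (- (F (x j + RtoC (/ INR N)) - F (x j) - F' (x j) * RtoC (/ INR N))).
    have sh := cyclic_shift z N0 per.
    transitivity (\csum_(0 <= j < N) F (x j) +
      (-1 * \csum_(0 <= j < N) F (z + RtoC (INR j.+1 / INR N)) +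
       RtoC (/ INR N) * D)); first by rewrite sh /x; ring.
    rewrite -!csum_mull -!csum_add; apply: eq_bigr => j _.
    have -> : x j + RtoC (/ INR N) = z + RtoC (INR j.+1 / INR N).
      by rewrite /x S_INR /Rdiv Rmult_plus_distr_r Rmult_1_l RtoC_plus; ring.
    ring.
  have := csum_bound (N := N) (K := (K * (/ INR N) ^ 2)%R)
     (f := fun j => - (F (x j + RtoC (/ INR N)) - F (x j) - F' (x j) * RtoC (/ INR N))).
  rewrite -E Cmod_mult !Cmod_R (Rabs_pos_eq (/ INR N)); last lra.
  move=> H; have {}H : (Cmod D * / INR N <= INR N * (K * (/ INR N) ^ 2))%R.
    apply: H => j hj; have mi : Cmod (RtoC (/ INR N)) = (/ INR N)%R.
      by rewrite Cmod_R Rabs_pos_eq; lra.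
    rewrite Cmod_opp; have [_ _] := HK (x j) (RtoC (/ INR N)) (xb j hj) ltac:(rewrite mi; lra).
    by rewrite mi.
  have : (INR N * (Cmod D * / INR N) <= INR N * (INR N * (K * (/ INR N) ^ 2)))%R.
    by apply: Rmult_le_compat_l; lra.
  have -> : (INR N * (Cmod D * / INR N) = Cmod D)%R by field; lra.
  have -> : (INR N * (INR N * (K * (/ INR N) ^ 2)) = K)%R by field; lra.
  by [].
have -> : avg N F (z + h) - avg N F z =
  (D * h + \csum_(0 <= j < N) (F (x j + h) - F (x j) - F' (x j) * h)) / RtoC (INR N).
  transitivity ((h * D + \csum_(0 <= j < N) (F (x j + h) - F (x j) - F' (x j) * h)) / RtoC (INR N)); last by rewrite (Cmult_comm h).
  rewrite -csum_mull -csum_add /avg -[_ - _]/(_ + - _).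
  have -> (a b : C) : a / RtoC (INR N) + - (b / RtoC (INR N)) = (a + -1 * b) / RtoC (INR N) by field.
  rewrite -csum_mull -csum_add; congr (_ / _); apply: eq_bigr => j _.
  by rewrite (_ : z + h + _ = x j + h) /x; ring.
rewrite Cmod_div // Cmod_R (Rabs_pos_eq (INR N)); last lra.
have T := Cmod_triangle (D * h) (\csum_(0 <= j < N) (F (x j + h) - F (x j) - F' (x j) * h)).
have S2 := @csum_bound N (fun j => F (x j + h) - F (x j) - F' (x j) * h) (K * Cmod h ^ 2)
  (fun j hj => let: And3 _ _ H := HK (x j) h (xb j hj) hb in H).
rewrite Cmod_mult in T.
have v0 := Cmod_ge_0 v.
have q1 : (Cmod D * Cmod h <= K * (r * / INR N))%R.
  by apply: Rmult_le_compat => //; try apply: Cmod_ge_0; rewrite mh; apply: Rmult_le_compat_r; lra.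
have q2 : (INR N * (K * Cmod h ^ 2) <= K * r ^ 2 * / INR N)%R.
  rewrite mh; have -> : (INR N * (K * (Cmod v * / INR N) ^ 2) = K * Cmod v ^ 2 * / INR N)%R by field; lra.
  apply: Rmult_le_compat_r; first lra.
  by apply: Rmult_le_compat_l => //; apply: pow_incr.
have -> : ((K * r + K * r ^ 2) / INR N ^ 2 = (K * (r * / INR N) + K * r ^ 2 * / INR N) / INR N)%R.
  by field; lra.
by apply: Rmult_le_compat_r; lra.
Qed.

(** The shift is made in N steps of size v / N, each at a cost O(1 / N^2). This is the discrete form
    of moving the line of integration by Cauchy's theorem. *)
Lemma avg_shift (F : C -> C) (z v : C) : tay F -> (forall w, F (w + 1) = F w) ->
  exists2 K : R, (0 <= K)%R & forall N : nat, (0 < N)%nat ->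
    (Cmod (avg N F (z + v) - avg N F z)%C <= K / INR N)%R.
Proof.
move=> tF per; have z0 := Cmod_ge_0 z; have v0 := Cmod_ge_0 v.
have [K K0 HK] := @avg_step F (Cmod z + Cmod v + 1)%R ltac:(lra) tF per.
exists K => // N N0; have n1 : (1 <= INR N)%R by apply: (le_INR 1); lia.
have n0 : RtoC (INR N) <> 0 by move=> /RtoC_inj; lra.
suff H m : (m <= N)%nat ->
   (Cmod (avg N F (z + RtoC (INR m) * (v / RtoC (INR N))) - avg N F z)%C <= INR m * (K / INR N ^ 2))%R.
  have := H N (leqnn N); rewrite (_ : z + _ = z + v); last by field.
  by have -> : (INR N * (K / INR N ^ 2) = K / INR N)%R by field; lra.
elim: m => [|m IH] hm.
  rewrite /= !Cmult_0_l Cplus_0_r Rmult_0_l (_ : _ - _ = 0) ?Cmod_0; [lra | ring].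
have {}IH := IH ltac:(lia).
pose y := z + RtoC (INR m) * (v / RtoC (INR N)).
have -> : z + RtoC (INR m.+1) * (v / RtoC (INR N)) = y + v / RtoC (INR N).
  by rewrite RtoC_INR_S /y; ring.
have yb : (Cmod y <= Cmod z + Cmod v + 1)%R.
  apply: Rle_trans (Cmod_triangle _ _) _; rewrite Cmod_mult Cmod_div // !Cmod_R.
  rewrite !Rabs_pos_eq; try exact: pos_INR.
  have f1 := frac_le1 (leq_trans (ltnSn m) hm : (m < N)%nat).
  have -> : (INR m * (Cmod v / INR N) = INR m / INR N * Cmod v)%R by rewrite /Rdiv; ring.
  nra.
have S := HK N y v N0 yb ltac:(lra).
set a := avg N F _; set b := avg N F z.
have -> : a - b = (a - avg N F y) + (avg N F y - b) by ring.
apply: Rle_trans (Cmod_triangle _ _) _; rewrite /a /b.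
by rewrite S_INR -/y in IH *; lra.
Qed.

Definition ch (k : Z) (z : C) : C := Cexp (RtoC (2 * PI * IZR k) * Ci * z).

Lemma Cexp_2PI_Z (k : Z) : Cexp (RtoC (2 * PI * IZR k) * Ci) = 1.
Proof.
have E1 : Cexp (RtoC (2 * PI) * Ci) = 1.
  have -> : RtoC (2 * PI) * Ci = (0, 2 * PI)%R by apply: injective_projections => /=; ring.
  by rewrite /Cexp /= exp_0 cos_2PI sin_2PI Rmult_1_r Rmult_0_r.
have En (n : nat) : Cexp (RtoC (2 * PI * INR n) * Ci) = 1.
  have <- : Cexp (RtoC (2 * PI) * Ci) ^ n = 1 by rewrite E1 Cpow_1_l.
  by rewrite Cexp_pow RtoC_mult; congr Cexp; ring.
have [h|h] := Z_le_gt_dec 0 k.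
  by rewrite -(Z2Nat.id k h) -INR_IZR_INZ.
rewrite -[RHS](En (Z.to_nat (- k))) INR_IZR_INZ Z2Nat.id; last by lia.
rewrite opp_IZR.
have -> : (2 * PI * - IZR k = - (2 * PI * IZR k))%R by ring.
set a := RtoC _; rewrite RtoC_opp -/a.
have -> : - a * Ci = - (a * Ci) by ring.
have : Cexp (- (a * Ci)) = 1.
  have := En (Z.to_nat (- k)); rewrite INR_IZR_INZ Z2Nat.id; last by lia.
  rewrite opp_IZR (_ : (2 * PI * - IZR k = - (2 * PI * IZR k))%R); last by ring.
  by rewrite RtoC_opp -/a; have -> : - a * Ci = - (a * Ci) by ring.
move=> H; have E2 : Cexp (a * Ci) * Cexp (- (a * Ci)) = 1.
  by rewrite -Cexp_add Cplus_opp_r Cexp_0.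
by rewrite H Cmult_1_r in E2; rewrite H.
Qed.

Lemma ch_add k z w : ch k (z + w) = ch k z * ch k w.
Proof. by rewrite /ch -Cexp_add; congr Cexp; ring. Qed.

Lemma ch_addk k l z : ch (k + l) z = ch k z * ch l z.
Proof.
rewrite /ch -Cexp_add plus_IZR Rmult_plus_distr_l RtoC_plus; congr Cexp; ring.
Qed.

Lemma ch_0 z : ch 0 z = 1.
Proof. by rewrite /ch Rmult_0_r !Cmult_0_l Cexp_0. Qed.

Lemma ch_0r k : ch k 0 = 1.
Proof. by rewrite /ch Cmult_0_r Cexp_0. Qed.

Lemma ch_period k z : ch k (z + 1) = ch k z.
Proof. by rewrite ch_add {2}/ch Cmult_1_r Cexp_2PI_Z Cmult_1_r. Qed.

Lemma ch_neg k z : ch k z * ch (- k) z = 1.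
Proof. by rewrite -ch_addk Z.add_opp_diag_r ch_0. Qed.

Lemma ch_real k (x : R) : ch k (RtoC x) = (cos (2 * PI * IZR k * x), sin (2 * PI * IZR k * x))%R.
Proof.
rewrite /ch; have -> : RtoC (2 * PI * IZR k) * Ci * RtoC x = (0, 2 * PI * IZR k * x)%R.
  by apply: injective_projections => /=; ring.
by rewrite /Cexp /= exp_0 !Rmult_1_l.
Qed.

Lemma Cmod_ch k (x : R) : Cmod (ch k (RtoC x)) = 1%R.
Proof.
rewrite /ch Cmod_Cexp -exp_0; congr exp; rewrite /=; ring.
Qed.

Lemma tay_ch k : tay (ch k).
Proof. exact: tay_exp. Qed.

(** x - x^3 / 6 >= x / 3 for 0 <= x <= 2, a range that contains the arguments up to pi / 2 needed
    for frequencies below N / 2. *)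
Lemma sin_ge (x : R) : (0 <= x <= 2)%R -> (x / 3 <= sin x)%R.
Proof.
move=> [x0 x2]; have [H _] := pre_sin_bound x 0 x0 ltac:(lra).
apply: Rle_trans H; rewrite /sin_approx /sin_term /=.
have -> : (-1 * 1 * (x * (x * (x * 1)) / (1 + 1 + 1 + 1 + 1 + 1)) = - (x ^ 3 / 6))%R by field.
have -> : (1 * (x * 1 / 1) = x)%R by field.
have : (0 <= x * (4 - x ^ 2))%R by apply: Rmult_le_pos; nra.
lra.
Qed.

Lemma ch_second_difference (k : Z) (x : R) :
  ch k (RtoC x) + ch (- k) (RtoC x) - 2 = RtoC (- (4 * sin (PI * IZR k * x) ^ 2)).
Proof.
rewrite !ch_real opp_IZR.
have -> : (2 * PI * - IZR k * x = - (2 * (PI * IZR k * x)))%R by ring.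
have -> : (2 * PI * IZR k * x = 2 * (PI * IZR k * x))%R by ring.
rewrite cos_neg sin_neg cos_2a_sin.
by apply: injective_projections => /=; ring.
Qed.

(** Summation by parts, twice. The second difference with step 1 / N multiplies the k-th coefficient
    by - 4 sin^2(pi k / N), of size at least 4 (k / N)^2 for |k| < N / 2, while second differences
    of g are O(1 / N^2). The powers of N cancel, so the bound is uniform in M. *)
Lemma fourier_decay (g : C -> C) (x0 : R) : tay g -> (forall z, g (z + 1) = g z) ->
  exists2 K : R, (0 <= K)%R & forall (M : nat) (k : Z), k <> 0%Z -> (Z.abs k <= Z.of_nat M)%Z ->
    (Cmod (avg M.*2.+1 (fun z => g z * ch (- k) z)%C (RtoC x0)) <= K / IZR k ^ 2)%R.
Proof.
move=> [g' Hg] per; have r0 := Rabs_pos x0.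
have [K K0 HK] := Hg (Rabs x0 + 1)%R ltac:(lra).
exists K => // M k kn0 kM; set N := M.*2.+1; pose F z := g z * ch (- k) z.
have Nn : (0 < N)%nat by [].
have n1 : (1 <= INR N)%R by apply: (le_INR 1); lia.
have n0 : RtoC (INR N) <> 0 by move=> /RtoC_inj; lra.
pose d := (/ INR N)%R.
have d0 : (0 < d)%R by apply: Rinv_0_lt_compat; lra.
have d1 : (d <= 1)%R by rewrite /d -Rinv_1; apply: Rinv_le_contravar; lra.
have perF z : F (z + 1) = F z by rewrite /F per ch_period.
pose x j := RtoC (x0 + INR j / INR N).
have xE j : x j = RtoC x0 + RtoC (INR j / INR N) by rewrite /x RtoC_plus.
pose S := \csum_(0 <= j < N) F (x j).
have AS : avg N F (RtoC x0) = S / RtoC (INR N).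
  by rewrite /avg /S; congr (_ / _); apply: eq_bigr => j _; rewrite xE.
have S1 : S = \csum_(0 <= j < N) F (x j + RtoC d).
  have := cyclic_shift (RtoC x0) Nn perF; rewrite -[RHS]/(bigop _ _ _) => H.
  rewrite /S (eq_bigr (fun j => F (RtoC x0 + RtoC (INR j / INR N)))); last by move=> j _; rewrite xE.
  rewrite -H; apply: eq_bigr => j _; congr F.
  by rewrite xE S_INR /Rdiv Rmult_plus_distr_r Rmult_1_l RtoC_plus /d; ring.
have S2 : S = \csum_(0 <= j < N) F (x j - RtoC d).
  have := cyclic_shift (RtoC x0 - RtoC d) Nn perF => H.
  rewrite (eq_bigr (fun j => F (RtoC x0 - RtoC d + RtoC (INR j / INR N)))); last first.
    by move=> j _; rewrite xE; congr F; ring.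
  rewrite -H; apply: eq_bigr => j _; congr F.
  by rewrite xE S_INR /Rdiv Rmult_plus_distr_r Rmult_1_l RtoC_plus /d; ring.
pose D j := g (x j + RtoC d) + g (x j - RtoC d) - 2 * g (x j).
have E : (ch k (RtoC d) + ch (- k) (RtoC d) - 2) * S
  = \csum_(0 <= j < N) (D j * ch (- k) (x j)).
  transitivity (ch k (RtoC d) * S + (ch (- k) (RtoC d) * S + -2 * S)); first by ring.
  rewrite {1}S1 {1}S2 /S -!csum_mull -!csum_add; apply: eq_bigr => j _.
  rewrite /F /D [x j - _]/(x j + - RtoC d) !ch_add.
  have -> : ch (- k) (- RtoC d) = ch k (RtoC d).
    by rewrite /ch opp_IZR; congr Cexp; rewrite (_ : (2 * PI * - IZR k = - (2 * PI * IZR k))%R) ?RtoC_opp; ring.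
  have h := ch_neg k (RtoC d).
  set a := g (x j + _); set b := g (x j + _); set c := ch (- k) (x j).
  transitivity (a * c * (ch k (RtoC d) * ch (- k) (RtoC d)) +
    (b * c * (ch k (RtoC d) * ch (- k) (RtoC d)) + -2 * (g (x j) * c))); first by ring.
  by rewrite h; ring.
have DB j : (j < N)%nat -> (Cmod (D j * ch (- k) (x j))%C <= 2 * K * d ^ 2)%R.
  move=> hj; rewrite Cmod_mult Cmod_ch Rmult_1_r.
  have xb : (Cmod (x j) <= Rabs x0 + 1)%R.
    rewrite Cmod_R; have := frac_le1 hj; have := Rabs_triang x0 (INR j / INR N).
    by move=> H [? ?]; rewrite (Rabs_pos_eq (INR j / INR N)) in H; lra.
  have md : Cmod (RtoC d) = d by rewrite Cmod_R Rabs_pos_eq; lra.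
  have md' : Cmod (- RtoC d) = d by rewrite Cmod_opp md.
  have [_ _ h1] := HK (x j) (RtoC d) xb ltac:(lra).
  have [_ _ h2] := HK (x j) (- RtoC d) xb ltac:(lra).
  rewrite md in h1; rewrite md' in h2.
  have -> : D j = (g (x j + RtoC d) - g (x j) - g' (x j) * RtoC d) +
     (g (x j + - RtoC d) - g (x j) - g' (x j) * - RtoC d) by rewrite /D /Cminus; ring.
  apply: Rle_trans (Cmod_triangle _ _) _; lra.
have := csum_bound DB; rewrite -E ch_second_difference Cmod_mult Cmod_R Rabs_Ropp.
have pk : (1 <= Rabs (IZR k))%R by rewrite -abs_IZR; apply: IZR_le; lia.
have k2 : (IZR k ^ 2 = Rabs (IZR k) ^ 2)%R by rewrite pow2_abs.
have s2 : (IZR k ^ 2 * d ^ 2 <= sin (PI * IZR k * d) ^ 2)%R.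
  have P4 := PI_4; have P3 := PI2_3_2.
  have N2 : (2 * Rabs (IZR k) + 1 <= INR N)%R.
    rewrite -abs_IZR INR_IZR_INZ -mult_IZR -plus_IZR; apply: IZR_le; rewrite /N; lia.
  have kd : (Rabs (IZR k) * d <= 1 / 2)%R.
    by apply/Rle_div_l; lra.
  have kd0 : (0 <= Rabs (IZR k) * d)%R by nra.
  have H := sin_ge (x := (PI * (Rabs (IZR k) * d))%R) ltac:(split; nra).
  have Es : (sin (PI * IZR k * d) ^ 2 = sin (PI * (Rabs (IZR k) * d)) ^ 2)%R.
    case: (Rcase_abs (IZR k)) => s; [rewrite Rabs_left // | rewrite Rabs_right //].
      have -> : (PI * (- IZR k * d) = - (PI * IZR k * d))%R by ring.
      by rewrite sin_neg; ring.
    by congr (sin _ ^ 2)%R; ring.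
  rewrite Es k2 -Rpow_mult_distr; apply: pow_incr; split => //.
  nra.
have s0 := pow2_ge_0 (sin (PI * IZR k * d)).
rewrite Rabs_pos_eq; last lra.
move=> H; rewrite AS Cmod_div // Cmod_R (Rabs_pos_eq (INR N)); last lra.
apply/Rle_div_l; first lra.
have kk : (0 < IZR k ^ 2)%R by rewrite k2; nra.
have Sb := Cmod_ge_0 S.
have d2 : (0 < d ^ 2)%R by apply: pow_lt.
apply: (Rmult_le_reg_l (4 * (IZR k ^ 2 * d ^ 2))%R); first by nra.
apply: (Rle_trans _ (4 * sin (PI * IZR k * d) ^ 2 * Cmod S)).
  by apply: Rmult_le_compat_r => //; lra.
apply: Rle_trans H _.
have kr : IZR k <> 0%R by exact: not_0_IZR.
have -> : (4 * (IZR k ^ 2 * d ^ 2) * (K / IZR k ^ 2 * INR N) = INR N * (4 * K * d ^ 2))%R by field.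
by apply: Rmult_le_compat_l; [lra | nra].
Qed.

(** Representatives of all residues modulo N = 2 M + 1, chosen with |k| <= M as the decay estimate
    requires. *)
Definition zrange (M : nat) : seq Z :=
  [seq (Z.of_nat i - Z.of_nat M)%Z | i <- index_iota 0 M.*2.+1].

Lemma zrange_uniq M : uniq (zrange M).
Proof. by rewrite map_inj_uniq ?iota_uniq // => i j; lia. Qed.

Lemma mem_zrange M k : (k \in zrange M) = (Z.abs k <=? Z.of_nat M)%Z.
Proof.
apply/mapP/Z.leb_spec0 => [[i] | h].
  by rewrite mem_index_iota => /andP[_ hi] ->; lia.
exists (Z.to_nat (k + Z.of_nat M)); last by lia.
by rewrite mem_index_iota; lia.
Qed.

Lemma sub_zrange (L : seq Z) : exists M0 : nat, forall M, (M0 <= M)%nat -> {subset L <= zrange M}.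
Proof.
elim: L => [|x L [M0 H]]; first by exists 0%nat.
exists (maxn (Z.to_nat (Z.abs x)) M0) => M; rewrite geq_max => /andP[h1 h2] y.
rewrite in_cons => /orP[/eqP ->|]; last exact: H.
by rewrite mem_zrange; apply/Z.leb_spec0; lia.
Qed.

Lemma geometric_root (q : C) (N : nat) : q <> 1 -> q ^ N = 1 ->
  \csum_(0 <= i < N) q ^ i = 0.
Proof.
move=> q1 qN; apply: (@Ceq_mul_reg (q - 1)); first by move=> /Csub_eq0.
suff H n : (q - 1) * \csum_(0 <= i < n) q ^ i = q ^ n - 1 by rewrite H qN; ring.
elim: n => [|n IH]; first by rewrite big_geq //=; ring.
by rewrite csum_recr Cmult_plus_distr_l IH Cpow_S; ring.
Qed.

Lemma ch_nat (i : nat) z : ch (Z.of_nat i) z = ch 1 z ^ i.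
Proof.
rewrite /ch Cexp_pow -INR_IZR_INZ; congr Cexp.
rewrite Rmult_1_r RtoC_mult; ring.
Qed.

Lemma ch1_neq1 (j N : nat) : (0 < j < N)%nat -> ch 1 (RtoC (- (INR j / INR N))) <> 1.
Proof.
move=> /andP[j0 jN] E; have N0 : (0 < INR N)%R by apply: lt_0_INR; lia.
have J0 : (0 < INR j)%R by apply: lt_0_INR; lia.
have JN : (INR j < INR N)%R by apply: lt_INR; lia.
have E' : ch (-1) (RtoC (- (INR j / INR N))) = 1.
  by have := ch_neg 1 (RtoC (- (INR j / INR N))); rewrite E Cmult_1_l.
have := ch_second_difference 1 (- (INR j / INR N)); rewrite E E'.
have -> : 1 + 1 - 2 = 0 by ring.
move=> /RtoC_inj; rewrite Rmult_1_r.
have -> : (PI * - (INR j / INR N) = - (PI * (INR j / INR N)))%R by ring.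
rewrite sin_neg; have P := PI_RGT_0.
have q0 : (0 < INR j / INR N)%R by apply: Rdiv_lt_0_compat.
have q1 : (INR j / INR N < 1)%R by apply/Rlt_div_l; lra.
have := sin_gt_0 (PI * (INR j / INR N)) ltac:(nra) ltac:(nra); nra.
Qed.

(** Exact for each grid, by orthogonality of characters: summed over k, the powers of a nontrivial
    N-th root of unity cancel, and only the grid point [x0] itself survives. *)
Lemma fourier_inversion (g : C -> C) (x0 : C) (M : nat) : (forall z, g (z + 1) = g z) ->
  \csum_(k <- zrange M) (ch k x0 * avg M.*2.+1 (fun z => g z * ch (- k) z) x0) = g x0.
Proof.
move=> per; set N := M.*2.+1.
have n1 : (1 <= INR N)%R by apply: (le_INR 1); lia.
have n0 : RtoC (INR N) <> 0 by move=> /RtoC_inj; lra.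
pose y j := RtoC (INR j / INR N).
transitivity (\csum_(k <- zrange M) \csum_(0 <= j < N)
   (g (x0 + y j) / RtoC (INR N) * ch k (RtoC (- (INR j / INR N))))).
  apply: eq_bigr => k _; rewrite /avg /Cdiv Cmult_assoc -csum_mull Cmult_comm -csum_mull.
  apply: eq_bigr => j _; rewrite -/(y j) ch_add.
  have -> : ch k (RtoC (- (INR j / INR N))) = ch (- k) (y j).
    rewrite /ch /y opp_IZR RtoC_opp; congr Cexp.
    by rewrite (_ : (2 * PI * - IZR k = - (2 * PI * IZR k))%R) ?RtoC_opp; ring.
  have h := ch_neg k x0.
  transitivity (g (x0 + y j) / RtoC (INR N) * ch (- k) (y j) * (ch k x0 * ch (- k) x0)).
    by rewrite /Cdiv; ring.
  by rewrite h Cmult_1_r.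
rewrite exchange_big.
transitivity (\csum_(0 <= j < N)
   (g (x0 + y j) / RtoC (INR N) * (if j == 0%nat then RtoC (INR N) else 0))).
  apply: eq_big_nat => j /andP[_ hj]; rewrite csum_mull; congr (_ * _).
  rewrite big_map; set z := RtoC (- _).
  transitivity (ch (- Z.of_nat M) z * \csum_(0 <= i < N) ch 1 z ^ i).
    rewrite -csum_mull; apply: eq_bigr => i _.
    by rewrite -Z.add_opp_r ch_addk ch_nat Cmult_comm.
  have [j0|j0] := eqVneq j 0%nat.
    have z0 : z = 0 by rewrite /z j0 /= /Rdiv Rmult_0_l Ropp_0.
    rewrite z0 !ch_0r Cmult_1_l (eq_bigr (fun _ => RtoC 1)); last by move=> i _; rewrite Cpow_1_l.
    by rewrite csum_const size_iota subn0 Cmult_1_r.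
  rewrite geometric_root ?Cmult_0_r //; first by apply: ch1_neq1; lia.
  rewrite -ch_nat /ch -INR_IZR_INZ /z.
  rewrite -[RHS](Cexp_2PI_Z (- Z.of_nat j)); congr Cexp.
  rewrite opp_IZR -INR_IZR_INZ.
  have -> : (2 * PI * - INR j = (2 * PI * INR N) * - (INR j / INR N))%R by field; lra.
  by rewrite !RtoC_mult; ring.
rewrite /N csum_recl big1 /=; last by move=> j _; rewrite Cmult_0_r.
rewrite /y /= /Rdiv Rmult_0_l !Cplus_0_r.
by field.
Qed.

Lemma Cmod_triangle3 (a b c : C) : (Cmod (a - c) <= Cmod (a - b) + Cmod (b - c))%R.
Proof. by have -> : a - c = (a - b) + (b - c) by [ring]; exact: Cmod_triangle. Qed.

(** By [avg_shift] the average moves from 0 to tau at a cost O(1 / N), and quasi-periodicity turns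
    the moved k-th coefficient into [c k] times the next one. As exp(pi i k^2 tau) is [c k] times
    exp(pi i (k + 1)^2 tau), induction in both directions from 0 expresses each coefficient by the
    zeroth. The constant depends on k. *)
Lemma fourier_asymptotic (g : C -> C) (tau : C) (k : Z) :
  tay g -> (forall z, g (z + 1) = g z) ->
  (forall z, g (z + tau) = Cexp (- (2 * RtoC PI * Ci * z) - RtoC PI * Ci * tau) * g z) ->
  exists2 K : R, (0 <= K)%R & forall N : nat, (0 < N)%nat ->
    (Cmod (avg N (fun z => g z * ch (- k) z)%C 0 - eterm (sq k) tau * avg N g 0)%C
      <= K / INR N)%R.
Proof.
move=> tg per qper.
have tF j : tay (fun z => g z * ch (- j) z) by apply: tay_mul tg (tay_ch _).
have pF j z : g (z + 1) * ch (- j) (z + 1) = g z * ch (- j) z by rewrite per ch_period.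
pose c j := eterm (- (2 * IZR j + 1)) tau.
have step N j : avg N (fun z => g z * ch (- j) z) (0 + tau) =
    c j * avg N (fun z => g z * ch (- (j + 1)) z) 0.
  rewrite /avg /Cdiv Cmult_assoc -csum_mull; congr (_ * _).
  apply: eq_bigr => i _; set y := RtoC (_ / _).
  have -> : 0 + tau + y = (0 + y) + tau by ring.
  rewrite qper (_ : (- (j + 1) = - j + - (1))%Z); last by ring.
  rewrite ch_addk ch_add.
  have -> : Cexp (- (2 * RtoC PI * Ci * (0 + y)) - RtoC PI * Ci * tau)
     = ch (-1) (0 + y) * eterm (-1) tau.
    by rewrite /ch /eterm -Cexp_add; congr Cexp; rewrite RtoC_mult RtoC_mult; ring.
  have -> : c j = eterm (-1) tau * ch (- j) tau.
    rewrite /c /eterm /ch -Cexp_add; congr Cexp.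
    have -> : IZR (- j) = (- IZR j)%R := opp_IZR j.
    have -> : RtoC (- (2 * IZR j + 1)) = - (2 * RtoC (IZR j) + 1).
      by rewrite RtoC_opp RtoC_plus RtoC_mult.
    have -> : RtoC (2 * PI * - IZR j) = - (2 * RtoC PI * RtoC (IZR j)).
      by rewrite !RtoC_mult RtoC_opp; ring.
    ring.
  have -> : (- (1))%Z = (-1)%Z by [].
  ring.
have cc j : eterm (sq j) tau = c j * eterm (sq (j + 1)) tau.
  by rewrite /c eterm_mul; congr eterm; rewrite /sq plus_IZR; ring.
have c0 j : c j <> 0 by exact: eterm_neq0.
have tr j : exists2 K, (0 <= K)%R & forall N : nat, (0 < N)%nat ->
   (Cmod (c j * avg N (fun z => g z * ch (- (j + 1)) z)%C 0 -
     avg N (fun z => g z * ch (- j) z)%C 0)%C <= K / INR N)%R.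
  have [K K0 HK] := avg_shift 0 tau (tF j) (pF j); exists K => // N N0.
  by rewrite -step; exact: HK.
elim/Z.peano_ind: k => [|k [K K0 HK]|k [K K0 HK]].
- exists 0%R => [|N _]; first lra.
  have -> : avg N (fun z => g z * ch (- 0) z) 0 = avg N g 0.
    by rewrite /avg; congr (_ / _); apply: eq_bigr => i _; rewrite ch_0 Cmult_1_r.
  have -> : sq 0 = 0%R by rewrite /sq /=; ring.
  rewrite eterm_0 Cmult_1_l (_ : _ - _ = 0) ?Cmod_0; last ring.
  by rewrite /Rdiv Rmult_0_l; lra.
- have [K' K0' HK'] := tr k; have m0 := proj1 (Cmod_gt_0 _) (c0 k).
  exists ((K + K') / Cmod (c k))%R => [|N N0].
    by apply: Rmult_le_pos; [lra | apply/Rlt_le/Rinv_0_lt_compat].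
  have n1 : (0 < INR N)%R by apply: lt_0_INR; lia.
  have h1 := HK N N0; have h2 := HK' N N0; rewrite -Z.add_1_r.
  apply: (Rmult_le_reg_l (Cmod (c k))) => //.
  have -> : (Cmod (c k) * ((K + K') / Cmod (c k) / INR N) = K' / INR N + K / INR N)%R.
    by field; lra.
  rewrite -Cmod_mult.
  have -> (a b : C) : c k * (a - eterm (sq (k + 1)) tau * b) = c k * a - eterm (sq k) tau * b.
    by rewrite (cc k); ring.
  have := Cmod_triangle3 (c k * avg N (fun z => g z * ch (- (k + 1)) z) 0)
   (avg N (fun z => g z * ch (- k) z) 0) (eterm (sq k) tau * avg N g 0).
  lra.
- pose j := (k - 1)%Z; have -> : Z.pred k = j by rewrite /j; lia.
  have E : (j + 1 = k)%Z by rewrite /j; lia.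
  have [K' K0' HK'] := tr j; have m0 := Cmod_ge_0 (c j).
  exists (Cmod (c j) * K + K')%R => [|N N0]; first nra.
  have n1 : (0 < INR N)%R by apply: lt_0_INR; lia.
  have h1 := HK N N0; have h2 := HK' N N0; rewrite E in h2.
  have := Cmod_triangle3 (avg N (fun z => g z * ch (- j) z) 0)
    (c j * avg N (fun z => g z * ch (- k) z) 0) (eterm (sq j) tau * avg N g 0).
  rewrite (Cmod_sub_sym _ (c j * _)) cc E.
  have -> (a b : C) : c j * a - c j * eterm (sq k) tau * b = c j * (a - eterm (sq k) tau * b) by ring.
  rewrite Cmod_mult.
  have := Rmult_le_compat_l _ _ _ m0 h1.
  have -> : ((Cmod (c j) * K + K') / INR N = Cmod (c j) * (K / INR N) + K' / INR N)%R by field; lra.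
  lra.
Qed.

Lemma summable_tail (I : eqType) (f : I -> C) (eps : R) : summable f -> (0 < eps)%R ->
  exists L1 : seq I, forall L : seq I, uniq L -> (forall i, i \in L -> i \notin L1) ->
    (\rsum_(i <- L) Cmod (f i) < eps)%R.
Proof.
move=> [M HM] e0.
have [s Hs] := @nonneg_has_sum I (fun i => Cmod (f i)) M (fun i => Cmod_ge_0 _) HM.
have [L0 HL] := Hs (eps / 2)%R ltac:(lra); exists L0 => L u dis.
have u1 := undup_uniq L0.
have h1 := HL (undup L0) u1 (fun x h => ltac:(by rewrite mem_undup)).
have u2 : uniq (undup L0 ++ L).
  rewrite cat_uniq u1 u andbT; apply/hasPn => x /dis; by rewrite /= mem_undup.
have h2 := HL (undup L0 ++ L) u2 (fun x h => ltac:(by rewrite mem_cat mem_undup h)).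
rewrite big_cat /= in h2; move: h1 h2.
have RE r : \csum_(i <- r) RtoC (Cmod (f i)) = RtoC (\rsum_(i <- r) Cmod (f i))%R.
  by elim: r => [|i r IH]; rewrite ?big_nil ?big_cons // IH RtoC_plus.
rewrite !RE -RtoC_plus -!RtoC_minus !Cmod_R; split_Rabs; lra.
Qed.

(** The estimates of [fourier_asymptotic] are not uniform in k, so they are applied on a finite set
    [L2] fixed before the grid. The remaining part of the exact inversion formula is bounded by
    [fourier_decay], uniformly in the grid. *)
Lemma fourier_limit (g : C -> C) (tau : C) (x0 : R) (T : C) :
  tay g -> (forall z, g (z + 1) = g z) ->
  (forall z, g (z + tau) = Cexp (- (2 * RtoC PI * Ci * z) - RtoC PI * Ci * tau) * g z) ->
  has_sum (fun k => eterm (sq k) tau * ch k (RtoC x0)) T ->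
  forall eps : R, (0 < eps)%R -> exists M0 : nat, forall M, (M0 <= M)%nat ->
    (Cmod (g (RtoC x0) - avg M.*2.+1 g 0 * T)%C <= eps)%R.
Proof.
move=> tg per qper HT eps e0.
have [B0 HB0] : exists B, forall N : nat, (0 < N)%nat -> (Cmod (avg N g 0) <= B)%R.
  have [g' Hg] := tg; have [K K0 HK] := Hg 1%R ltac:(lra); exists K => N N0.
  have n1 : (1 <= INR N)%R by apply: (le_INR 1); lia.
  have n0 : RtoC (INR N) <> 0 by move=> /RtoC_inj; lra.
  rewrite /avg Cmod_div // Cmod_R (Rabs_pos_eq (INR N)); last lra.
  apply/Rle_div_l; first lra.
  rewrite Rmult_comm; apply: csum_bound => j hj; have fr := frac_le1 hj.
  have [] // := HK (0 + RtoC (INR j / INR N)) 0.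
    by rewrite Cplus_0_l Cmod_R Rabs_pos_eq; lra.
  by rewrite Cmod_0; lra.
have B0p : (0 <= B0)%R by apply: Rle_trans (Cmod_ge_0 _) (HB0 1%nat isT).
have [D D0 HD] := fourier_decay x0 tg per.
(* The errors are 2 D e from the frequencies outside [L2], B0 e from truncating [T], and e from the
   finite set. *)
pose e := (eps / (2 * D + B0 + 2))%R.
have ee : (0 < e)%R by apply: Rdiv_lt_0_compat; lra.
have [L0 HL0] := HT e ee.
have [L1 HL1] := summable_tail summable_inv_sq_Z ee.
(* 0 is included because the decay estimate concerns nonzero frequencies. *)
pose L2 := undup (0%Z :: L0 ++ L1).
pose A M k := avg M.*2.+1 (fun z => g z * ch (- k) z) (RtoC x0).
have [K K0 HK] : exists2 K : R, (0 <= K)%R & forall M : nat,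
   (Cmod (\csum_(k <- L2) (ch k (RtoC x0) * A M k) -
     avg M.*2.+1 g 0 * \csum_(k <- L2) (eterm (sq k) tau * ch k (RtoC x0)))%C <= K / INR M.*2.+1)%R.
  elim: (L2) => [|k L [K K0 IH]].
    exists 0%R => [|M]; first lra.
    rewrite !big_nil (_ : _ - _ = 0) ?Cmod_0; last ring.
    by rewrite /Rdiv Rmult_0_l; lra.
  have tF : tay (fun z => g z * ch (- k) z) by apply: tay_mul tg (tay_ch _).
  have pF z : g (z + 1) * ch (- k) (z + 1) = g z * ch (- k) z by rewrite per ch_period.
  have [K1 K10 HK1] := fourier_asymptotic k tg per qper.
  have [K2 K20 HK2] := avg_shift 0 (RtoC x0) tF pF.
  exists (K + (K1 + K2))%R => [|M]; first lra.
  have n1 : (1 <= INR M.*2.+1)%R by apply: (le_INR 1); lia.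
  rewrite !big_cons; have h := IH M; have h1 := HK1 M.*2.+1 isT; have h2 := HK2 M.*2.+1 isT.
  move: h; set X := \csum_(i <- L) _; set Y := \csum_(i <- L) _ => h.
  set b := avg _ g 0 in h h1 *.
  have -> : ch k (RtoC x0) * A M k + X - b * (eterm (sq k) tau * ch k (RtoC x0) + Y)
    = ch k (RtoC x0) * (A M k - eterm (sq k) tau * b) + (X - b * Y) by ring.
  apply: Rle_trans (Cmod_triangle _ _) _; rewrite Cmod_mult Cmod_ch Rmult_1_l.
  rewrite Cplus_0_l -/(A M k) in h2.
  have := Cmod_triangle3 (A M k) (avg M.*2.+1 (fun z => g z * ch (- k) z) 0) (eterm (sq k) tau * b).
  have -> : ((K + (K1 + K2)) / INR M.*2.+1 = K / INR M.*2.+1 + (K1 / INR M.*2.+1 + K2 / INR M.*2.+1))%R.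
    by field; lra.
  lra.
have [M1 HM1] := sub_zrange L2.
have [M2 HM2] := INR_unbounded (K / e)%R.
exists (maxn M1 M2) => M; rewrite geq_max => /andP[m1 m2].
have n1 : (1 <= INR M.*2.+1)%R by apply: (le_INR 1); lia.
have uz := zrange_uniq M; have u2 : uniq L2 by exact: undup_uniq.
rewrite -(fourier_inversion (RtoC x0) M per).
rewrite (perm_big _ (perm_sub_cat u2 uz (HM1 M m1))) big_cat /=.
rewrite -[X in X + _ - _]/(\csum_(k <- L2) (ch k (RtoC x0) * A M k)).
rewrite -[X in _ + X - _]/(\csum_(k <- [seq i <- zrange M | i \notin L2]) (ch k (RtoC x0) * A M k)).
have h1 := HK M; have h2 := HB0 M.*2.+1 isT.
have h3 := HL0 L2 u2 (fun x h => ltac:(by rewrite mem_undup in_cons mem_cat h orbT)).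
have h4 : (Cmod (\csum_(k <- [seq i <- zrange M | i \notin L2]) (ch k (RtoC x0) * A M k))%C <= 2 * D * e)%R.
  apply: Rle_trans (Cmod_csum _ _) _.
  have t := HL1 [seq i <- zrange M | i \notin L2] (filter_uniq _ uz).
  refine (Rle_trans _ _ _ (rsum_le_in
    (g := fun k => (2 * D * Cmod (RtoC (/ (1 + IZR k ^ 2))))%R) _) _).
    move=> k; rewrite mem_filter mem_undup => /andP[kL].
    rewrite mem_zrange => /Z.leb_spec0 kM.
    have k0 : k <> 0%Z by move=> k0; rewrite k0 in_cons eqxx in kL.
    rewrite Cmod_mult Cmod_ch Rmult_1_l; apply: Rle_trans (HD M k k0 kM) _.
    have kk : (1 <= IZR k ^ 2)%R by have : (1 <= k * k)%Z by [nia]; move=> /IZR_le; rewrite mult_IZR; lra.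
    rewrite Cmod_R Rabs_pos_eq; last by apply/Rlt_le/Rinv_0_lt_compat; lra.
    apply/Rle_div_l; first lra.
    have -> : (2 * D * / (1 + IZR k ^ 2) * IZR k ^ 2 = D * (2 * IZR k ^ 2 / (1 + IZR k ^ 2)))%R by field; lra.
    rewrite -{1}(Rmult_1_r D); apply: Rmult_le_compat_l => //; apply/Rle_div_r; lra.
  rewrite rsum_mull; apply: Rmult_le_compat_l; first lra.
  apply/Rlt_le/t => i; rewrite mem_filter mem_undup in_cons mem_cat !negb_or.
  by case/andP=> /and3P[].
have h5 : (K / INR M.*2.+1 <= e)%R.
  apply/Rle_div_l; first lra.
  have : (INR M2 <= INR M.*2.+1)%R by apply: le_INR; lia.
  have : (K < INR M2 * e)%R by apply/Rlt_div_l => //; lra.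
  nra.
move: h1 h3 h4; set X := \csum_(k <- L2) _; set Y := \csum_(k <- L2) _.
set Z := \csum_(k <- _) _; set b := avg _ g 0 in h2 * => h1 h3 h4.
have -> : X + Z - b * T = (X - b * Y) + (Z + b * (Y - T)) by ring.
have t1 := Cmod_triangle (X - b * Y) (Z + b * (Y - T)).
have t2 := Cmod_triangle Z (b * (Y - T)); rewrite Cmod_mult in t2.
have t3 : (Cmod b * Cmod (Y - T) <= B0 * e)%R.
  by apply: Rmult_le_compat => //; try apply: Cmod_ge_0; lra.
have : ((2 * D + B0 + 2) * e = eps)%R by rewrite /e; field; lra.
lra.
Qed.

Lemma ch_half k : ch k (RtoC (1 / 2)) = sgn k.
Proof.
have E : ch 1 (RtoC (1 / 2)) = -1.
  rewrite ch_real (_ : (2 * PI * 1 * (1 / 2) = PI)%R) ?cos_PI ?sin_PI //; field.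
elim/Z.peano_ind: k => [|k IH|k IH]; first by rewrite ch_0.
  by rewrite -Z.add_1_r ch_addk IH E sgn_add sgn_1.
rewrite -Z.sub_1_r -Z.add_opp_r ch_addk IH sgn_add sgn_opp sgn_1; congr (_ * _).
by have := ch_neg 1 (RtoC (1 / 2)); rewrite E => H; rewrite -[RHS]Cmult_1_r -H; ring.
Qed.

(* Quasi-periodic functions form a line: g is determined up to a factor, the
   limit of its averages over the grids of the unit segment. *)
Lemma theta_uniqueness (g : C -> C) (tau : C) : upper tau ->
  tay g -> (forall z, g (z + 1) = g z) ->
  (forall z, g (z + tau) = Cexp (- (2 * RtoC PI * Ci * z) - RtoC PI * Ci * tau) * g z) ->
  g 0 * T4 tau = g (RtoC (1 / 2)) * T3 tau.
Proof.
move=> ut tg per qper.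
have H3 : has_sum (fun k => eterm (sq k) tau * ch k (RtoC 0)) (T3 tau).
  by apply: has_sum_ext (ES_has_sum good3 ut) => k; rewrite ch_0r /one_c; ring.
have H4 : has_sum (fun k => eterm (sq k) tau * ch k (RtoC (1 / 2))) (T4 tau).
  by apply: has_sum_ext (ES_has_sum good4 ut) => k; rewrite ch_half; ring.
apply: Cmod_eq_of_small => eps e0.
pose S := (Cmod (T3 tau) + Cmod (T4 tau) + 1)%R.
have p3 := Cmod_ge_0 (T3 tau); have p4 := Cmod_ge_0 (T4 tau).
have ee : (0 < eps / S)%R by apply: Rdiv_lt_0_compat; rewrite /S; lra.
have [M1 h1] := fourier_limit tg per qper H3 ee.
have [M2 h2] := fourier_limit tg per qper H4 ee.
have {}h1 := h1 (maxn M1 M2) (leq_maxl _ _); have {}h2 := h2 (maxn M1 M2) (leq_maxr _ _).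
move: h1 h2; set b := avg _ g 0 => h1 h2.
(* The same grid serves at 0 and at 1 / 2, so the average [b] drops out. *)
have -> : g 0 * T4 tau - g (RtoC (1 / 2)) * T3 tau =
  (g 0 - b * T3 tau) * T4 tau - (g (RtoC (1 / 2)) - b * T4 tau) * T3 tau by ring.
apply: Rle_trans (Cmod_minus_triangle _ _) _; rewrite !Cmod_mult.
have := Rmult_le_compat_r _ _ _ p4 h1; have := Rmult_le_compat_r _ _ _ p3 h2.
have : (eps / S * S = eps)%R by rewrite /S; field; lra.
rewrite {2}/S; lra.
Qed.

(** * Inversion *)

Definition gauss (sigma z : C) (n : Z) : C :=
  Cexp (RtoC PI * Ci * sigma * ((z + RtoC (IZR n)) * (z + RtoC (IZR n)))).

Definition gsum (sigma z : C) : C := tsum (gauss sigma z).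

Lemma C_lin_bound (a n b : R) : (0 < b)%R -> (a * n - b * n ^ 2 <= a ^ 2 / (2 * b) - b / 2 * n ^ 2)%R.
Proof.
move=> b0; have := pow2_ge_0 (b * n - a); have b1 : (0 < / (2 * b))%R by apply: Rinv_0_lt_compat; lra.
move=> H; have : (0 <= (b * n - a) ^ 2 * / (2 * b))%R by apply: Rmult_le_pos; lra.
have -> : ((b * n - a) ^ 2 * / (2 * b) = b / 2 * n ^ 2 - a * n + a ^ 2 / (2 * b))%R by field; lra.
lra.
Qed.

(** A majorant for |z|, |h| <= r of the terms, their derivatives and, up to a constant, their
    second-order errors. With m = pi |sigma| (3 r + 2 |n|) bounding the slope of the exponent, the
    part m (r + 2) pays for m <= exp m, m^2 <= 2 exp m and exp(m r); the other part bounds the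
    modulus of the term. *)
Definition gauss_weight (sigma : C) (r : R) (n : Z) : R :=
  exp (PI * Cmod sigma * (3 * r + 2 * Rabs (IZR n)) * (r + 2)
     + PI * Cmod sigma * r ^ 2 + 2 * PI * Cmod sigma * r * Rabs (IZR n)
     - PI * Im sigma * IZR n ^ 2).

(** The exponent is quadratic in |n| with leading coefficient - pi Im sigma. Half of it absorbs the
    linear term by [C_lin_bound]; the rest is a theta series at height Im sigma / 2. *)
Lemma gauss_weight_summable sigma r : upper sigma ->
  summable (fun n => RtoC (gauss_weight sigma r n)).
Proof.
move=> us; have P := PI_RGT_0; rewrite /upper in us.
pose a := (PI * Cmod sigma * 2 * (r + 2) + 2 * PI * Cmod sigma * r)%R.
pose b := (PI * Im sigma)%R; have b0 : (0 < b)%R by apply: Rmult_lt_0_compat.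
pose K := exp (PI * Cmod sigma * (3 * r) * (r + 2) + PI * Cmod sigma * r ^ 2 + a ^ 2 / (2 * b)).
have [_ H] := good3; have := summable_scal (RtoC K) (H (Im sigma / 2)%R ltac:(lra)).
apply: summable_le => n; rewrite !Cmod_mult /K !Cmod_RtoC_exp Cmod_1 Rmult_1_l.
rewrite -exp_plus; apply: exp_le; rewrite /sq -(pow2_abs (IZR n)).
have := C_lin_bound a (Rabs (IZR n)) b0; rewrite /b /a; lra.
Qed.

Lemma Im_gauss_bound (sigma z : C) (r : R) (n : Z) : (Cmod z <= r)%R ->
  (Im sigma * IZR n ^ 2 - 2 * Cmod sigma * r * Rabs (IZR n) - Cmod sigma * r ^ 2
   <= Im (sigma * ((z + RtoC (IZR n)) * (z + RtoC (IZR n)))%C))%R.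
Proof.
move=> hz.
have -> : sigma * ((z + RtoC (IZR n)) * (z + RtoC (IZR n))) =
  sigma * (z * z) + RtoC (IZR n) * (2 * (sigma * z)) + RtoC (IZR n ^ 2) * sigma.
  by rewrite RtoC_pow; ring.
have E (a b c : C) : Im (a + b + c) = (Im a + Im b + Im c)%R by [].
have ER (x : R) (a : C) : Im (RtoC x * a) = (x * Im a)%R by case: a => p q /=; ring.
rewrite E !ER.
have s0 := Cmod_ge_0 sigma; have z0 := Cmod_ge_0 z.
have h1 : (Rabs (Im (sigma * (z * z))%C) <= Cmod sigma * r ^ 2)%R.
  apply: Rle_trans (Cmod_Im_le _) _; rewrite !Cmod_mult; apply: Rmult_le_compat_l => //; nra.
have h2 : (Rabs (Im (sigma * z)%C) <= Cmod sigma * r)%R.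
  apply: Rle_trans (Cmod_Im_le _) _; rewrite !Cmod_mult; exact: Rmult_le_compat_l.
have n0 := Rabs_pos (IZR n).
have h3 : (Rabs (IZR n * (2 * Im (sigma * z)%C)) <= Rabs (IZR n) * (2 * (Cmod sigma * r)))%R.
  rewrite Rabs_mult; apply: Rmult_le_compat_l => //.
  by rewrite Rabs_mult (Rabs_pos_eq 2); lra.
have := Rle_abs (- (IZR n * (2 * Im (sigma * z)%C))); have := Rle_abs (- Im (sigma * (z * z))%C).
rewrite !Rabs_Ropp; lra.
Qed.

Lemma gauss_taylor (sigma z h : C) (r : R) (n : Z) : (0 < r)%R ->
  (Cmod z <= r)%R -> (Cmod h <= r)%R ->
  let W := gauss_weight sigma r n in
  let G' := RtoC PI * Ci * sigma * (2 * (z + RtoC (IZR n))) * gauss sigma z n in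
  [/\ (Cmod (gauss sigma z n) <= W)%R, (Cmod G' <= W)%R &
   (Cmod (gauss sigma (z + h) n - gauss sigma z n - G' * h)%C
     <= (2 + PI * Cmod sigma) * W * Cmod h ^ 2)%R].
Proof.
move=> r0 hz hh W G'; have P := PI_RGT_0; have s0 := Cmod_ge_0 sigma.
have h0 := Cmod_ge_0 h; have z0 := Cmod_ge_0 z; have n0 := Rabs_pos (IZR n).
have ps : (0 <= PI * Cmod sigma)%R by nra.
pose m := (PI * Cmod sigma * (3 * r + 2 * Rabs (IZR n)))%R.
have m0 : (0 <= m)%R by apply: Rmult_le_pos; lra.
pose Q := (PI * Cmod sigma * r ^ 2 + 2 * PI * Cmod sigma * r * Rabs (IZR n)
     - PI * Im sigma * IZR n ^ 2)%R.
have WE : W = exp (m * (r + 2) + Q) by rewrite /W /gauss_weight; congr exp; rewrite /m /Q; ring.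
have GQ : (Cmod (gauss sigma z n) <= exp Q)%R.
  rewrite Cmod_Cexp; apply: exp_le; have := Im_gauss_bound sigma n hz.
  set A := (z + _) * _; rewrite -Cmult_assoc; move: (sigma * A) => B HB.
  have -> : Re (RtoC PI * Ci * B) = (- PI * Im B)%R by case: (B) => p q /=; ring.
  have := Rmult_le_compat_l PI _ _ ltac:(lra) HB; rewrite /Q; lra.
have G0 := Cmod_ge_0 (gauss sigma z n).
have nz : (Cmod (z + RtoC (IZR n)) <= r + Rabs (IZR n))%R.
  by have := Cmod_triangle z (RtoC (IZR n)); rewrite Cmod_R; lra.
have mp : (m <= exp m)%R by have := exp_ineq1_le m; lra.
split.
- apply: Rle_trans GQ _; rewrite WE; apply: exp_le; nra.
- have b1 : (Cmod (RtoC PI * Ci * sigma * (2 * (z + RtoC (IZR n)))) <= m)%R.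
    rewrite !Cmod_mult Cmod_Ci !Cmod_R !Rabs_pos_eq; try lra.
    by rewrite /m Rmult_1_r; apply: Rmult_le_compat_l; lra.
  rewrite /G' Cmod_mult; apply: Rle_trans (Rmult_le_compat _ _ _ _ (Cmod_ge_0 _) G0 b1 GQ) _.
  have e0 := exp_pos Q.
  apply: Rle_trans (Rmult_le_compat_r _ _ _ (Rlt_le _ _ e0) mp) _.
  by rewrite -exp_plus WE; apply: exp_le; nra.
- pose w := RtoC PI * Ci * sigma * (2 * (z + RtoC (IZR n)) * h + h * h).
  have E : gauss sigma (z + h) n = gauss sigma z n * Cexp w.
    by rewrite /gauss -Cexp_add; congr Cexp; rewrite /w; ring.
  have -> : gauss sigma (z + h) n - gauss sigma z n - G' * h =
     gauss sigma z n * ((Cexp w - 1 - w) + RtoC PI * Ci * sigma * (h * h)).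
    by rewrite E /G' /w; ring.
  have wm : (Cmod w <= m * Cmod h)%R.
    rewrite /w !Cmod_mult Cmod_Ci Cmod_R (Rabs_pos_eq PI) ?Rmult_1_r; last lra.
    have -> : (m * Cmod h = PI * Cmod sigma * ((3 * r + 2 * Rabs (IZR n)) * Cmod h))%R.
      by rewrite /m; ring.
    apply: Rmult_le_compat_l => //.
    apply: Rle_trans (Cmod_triangle _ _) _; rewrite !Cmod_mult Cmod_R (Rabs_pos_eq 2); last lra.
    have := Rmult_le_compat_r _ _ _ h0 nz; have := Rmult_le_compat_r _ _ _ h0 hh; lra.
  have w0 := Cmod_ge_0 w.
  have T : (Cmod (Cexp w - 1 - w) <= 2 * exp m * exp (m * r) * Cmod h ^ 2)%R.
    apply: Rle_trans (Cexp_taylor w) _.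
    have q1 : (Cmod w ^ 2 <= m ^ 2 * Cmod h ^ 2)%R by rewrite -Rpow_mult_distr; apply: pow_incr.
    have q2 : (exp (Cmod w) <= exp (m * r))%R by apply: exp_le; nra.
    have q3 := exp_sq_bound m0; have h2 := pow2_ge_0 (Cmod h).
    have q4 : (Cmod w ^ 2 <= 2 * exp m * Cmod h ^ 2)%R.
      by apply: Rle_trans q1 _; apply: Rmult_le_compat_r.
    have := Rmult_le_compat _ _ _ _ (pow2_ge_0 (Cmod w)) (Rlt_le _ _ (exp_pos _)) q4 q2; lra.
  rewrite Cmod_mult.
  have T2 : (Cmod ((Cexp w - 1 - w) + RtoC PI * Ci * sigma * (h * h))
     <= (2 + PI * Cmod sigma) * exp (m * (r + 2)) * Cmod h ^ 2)%R.
    apply: Rle_trans (Cmod_triangle _ _) _.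
    rewrite (Cmod_mult (_ * sigma)) !Cmod_mult Cmod_Ci Cmod_R (Rabs_pos_eq PI) ?Rmult_1_r; last lra.
    have e1 : (exp m * exp (m * r) <= exp (m * (r + 2)))%R.
      by rewrite -exp_plus; apply: exp_le; nra.
    have e2 : (1 <= exp (m * (r + 2)))%R by rewrite -exp_0; apply: exp_le; nra.
    have h2 := pow2_ge_0 (Cmod h).
    have := Rmult_le_compat_r _ _ _ h2 e1.
    have := Rmult_le_compat_l _ _ _ ps (Rmult_le_compat_r _ _ _ h2 e2).
    have -> : (Cmod h ^ 2 = Cmod h * Cmod h)%R by ring.
    move: T; have -> : (Cmod h ^ 2 = Cmod h * Cmod h)%R by ring.
    lra.
  apply: Rle_trans (Rmult_le_compat _ _ _ _ G0 (Cmod_ge_0 _) GQ T2) _.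
  by rewrite WE exp_plus; apply: Req_le; ring.
Qed.

Lemma gauss_summable (sigma z : C) : upper sigma -> summable (gauss sigma z).
Proof.
move=> us; have r0 : (0 < Cmod z + 1)%R by have := Cmod_ge_0 z; lra.
apply: summable_le (gauss_weight_summable (Cmod z + 1) us) => n.
have [h _ _] := @gauss_taylor sigma z 0 (Cmod z + 1) n r0 ltac:(lra) ltac:(rewrite Cmod_0; lra).
by rewrite Cmod_R Rabs_pos_eq //; apply/Rlt_le/exp_pos.
Qed.

Lemma gsum_tay (sigma : C) : upper sigma -> tay (gsum sigma).
Proof.
move=> us.
pose G' z n := RtoC PI * Ci * sigma * (2 * (z + RtoC (IZR n))) * gauss sigma z n.
exists (fun z => tsum (G' z)) => r r0.
have [M HM] := gauss_weight_summable r us.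
have W0 n : Cmod (RtoC (gauss_weight sigma r n)) = gauss_weight sigma r n.
  by rewrite Cmod_R Rabs_pos_eq //; apply/Rlt_le/exp_pos.
have M0 : (0 <= M)%R by have := HM [::] isT; rewrite big_nil.
have P := PI_RGT_0; have s0 := Cmod_ge_0 sigma.
have ps : (0 <= PI * Cmod sigma)%R by nra.
exists ((2 + PI * Cmod sigma) * M)%R => [|z h hz hh]; first nra.
have B n := gauss_taylor sigma n r0 hz hh.
have S1 : summable (G' z).
  by apply: summable_le (gauss_weight_summable r us) => n; rewrite W0; have [] := B n.
have H0 := tsumP (gauss_summable z us); have H1 := tsumP S1.
have H2 := tsumP (gauss_summable (z + h) us).
have MM : (M <= (2 + PI * Cmod sigma) * M)%R by nra.
split.
- apply: (has_sum_Cmod_le H0) => L u; apply: Rle_trans MM; apply: Rle_trans (HM L u).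
  by apply: rsum_le => n; rewrite W0; have [] := B n.
- apply: (has_sum_Cmod_le H1) => L u; apply: Rle_trans MM; apply: Rle_trans (HM L u).
  by apply: rsum_le => n; rewrite W0; have [] := B n.
- have HS := has_sum_sub (has_sum_sub H2 H0) (has_sum_scal h H1).
  rewrite (Cmult_comm _ h); apply: (has_sum_Cmod_le HS) => L u.
  have -> : ((2 + PI * Cmod sigma) * M * Cmod h ^ 2 = (2 + PI * Cmod sigma) * Cmod h ^ 2 * M)%R by ring.
  have q0 : (0 <= (2 + PI * Cmod sigma) * Cmod h ^ 2)%R.
    by apply: Rmult_le_pos; [lra | exact: pow2_ge_0].
  apply: Rle_trans (Rmult_le_compat_l _ _ _ q0 (HM L u)).
  rewrite -rsum_mull; apply: rsum_le => n; rewrite W0 (Cmult_comm h).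
  by have [_ _ b] := B n; apply: Rle_trans b _; apply: Req_le; ring.
Qed.

Lemma upper_neq0 tau : upper tau -> tau <> 0.
Proof. by rewrite /upper => h E; rewrite E /= in h; lra. Qed.

Lemma Im_inv_opp (tau : C) : tau <> 0 -> Im (- / tau) = (Im tau / (Cmod tau) ^ 2)%R.
Proof.
move=> t0; rewrite Cmod2_alt; case: tau t0 => a b t0 /=.
have : (a * a + b * b <> 0)%R.
  move=> E; apply: t0; have a0 : a = 0%R by nra.
  by have b0 : b = 0%R by [nra]; rewrite a0 b0.
by move=> h; field => E; apply: h; rewrite -[RHS]E; ring.
Qed.

Lemma upper_S tau : upper tau -> upper (- / tau).
Proof.
move=> ut; have t0 := upper_neq0 ut; rewrite /upper Im_inv_opp //.
apply: Rdiv_lt_0_compat => //; apply: pow_lt; exact/Cmod_gt_0.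
Qed.

Lemma theta_inversion tau : upper tau ->
  T3 (- / tau) * T4 tau = T2 (- / tau) * T3 tau.
Proof.
move=> ut; have t0 := upper_neq0 ut; have us := upper_S ut.
have E0 : gsum (- / tau) 0 = T3 (- / tau).
  apply: tsum_eq; apply: has_sum_ext (ES_has_sum good3 us) => n.
  by rewrite /gauss /eterm /sq /one_c Cmult_1_l; congr Cexp; rewrite RtoC_pow; ring.
have E1 : gsum (- / tau) (RtoC (1 / 2)) = T2 (- / tau).
  apply: tsum_eq; apply: has_sum_ext (ES_has_sum good2 us) => n.
  by rewrite /gauss /eterm /hsq /one_c Cmult_1_l; congr Cexp; rewrite RtoC_pow !RtoC_plus; ring.
rewrite -E0 -E1; apply: theta_uniqueness ut _ _ _; first exact: gsum_tay.
- move=> z; apply: tsum_eq.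
  apply: has_sum_ext (has_sum_reindex succK predK (tsumP (gauss_summable z us))) => n.
  by rewrite /gauss plus_IZR RtoC_plus; congr Cexp; ring.
- move=> z; apply: tsum_eq.
  apply: has_sum_ext (has_sum_scal _ (tsumP (gauss_summable z us))) => n.
  (* Expanding - (z + tau + n)^2 / tau leaves a cross term - 2 n, which this factor removes. *)
  have U : Cexp (2 * RtoC PI * Ci * RtoC (IZR n)) = 1.
    by rewrite -(Cexp_2PI_Z n); congr Cexp; rewrite !RtoC_mult; ring.
  rewrite -[RHS]Cmult_1_l -[in RHS]U /gauss -!Cexp_add; congr Cexp.
  by field.
Qed.

(** * The action of Gamma(2) on x and y *)

Lemma theta_T3 tau : upper tau -> theta tau = T3 tau.
Proof.
move=> ut; have E n : one_c n * eterm (sq n) tau =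
    Cexp (RtoC PI * Ci * RtoC (IZR n) ^ 2 * tau).
  by rewrite /one_c /eterm /sq RtoC_pow Cmult_1_l.
apply: has_sum_CSeriesZ; first exact: summable_ext E (good_summable good3 ut).
exact: has_sum_ext E (ES_has_sum good3 ut).
Qed.

Lemma x_fun_T4 tau : upper tau -> x_fun tau = - T4 tau ^ 4.
Proof.
move=> ut; have E n : sgn n * eterm (sq n) tau =
    RtoC (powerRZ (-1) n) * Cexp (RtoC PI * Ci * RtoC (IZR n) ^ 2 * tau).
  by rewrite /eterm /sq RtoC_pow.
congr (- _ ^ 4); apply: has_sum_CSeriesZ; first exact: summable_ext E (good_summable good4 ut).
exact: has_sum_ext E (ES_has_sum good4 ut).
Qed.

Lemma y_fun_T2 tau : upper tau -> y_fun tau = T2 tau ^ 4.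
Proof.
move=> ut; have E n : one_c n * eterm (hsq n) tau =
    Cexp (RtoC PI * Ci * (RtoC (IZR n) + 1 / 2) ^ 2 * tau).
  by rewrite /one_c /eterm /hsq RtoC_pow Cmult_1_l RtoC_plus RtoC_div //; lra.
congr (_ ^ 4); apply: has_sum_CSeriesZ; first exact: summable_ext E (good_summable good2 ut).
exact: has_sum_ext E (ES_has_sum good2 ut).
Qed.

Lemma x_fun_neq0 tau : upper tau -> x_fun tau <> 0.
Proof.
move=> ut; rewrite x_fun_T4 // => E; have := @Cpow_nz _ 4 (T4_neq0 ut); apply.
have -> : T4 tau ^ 4 = - (- T4 tau ^ 4) by ring.
by rewrite E; ring.
Qed.

Lemma neg_inv_deriv (tau : C) : tau <> 0 -> Cderiv (fun t => - / t) tau (/ (tau * tau)).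
Proof. by move=> t0; apply: Cderiv_eq (Cderiv_opp (Cderiv_Cinv t0)); field. Qed.

Lemma Cinv_neq0 (z : C) : z <> 0 -> / z <> 0.
Proof.
move=> z0 E; apply: C1_neq0; by rewrite -(Cinv_r z z0) E Cmult_0_r.
Qed.

Lemma kappa_neq0 : kappa <> 0.
Proof.
have P := PI_RGT_0; rewrite /kappa /Cdiv; apply: Cmult_neq_0.
  by apply: Cmult_neq_0; [move=> /RtoC_inj; lra | case; lra].
by apply: Cinv_neq0 => /RtoC_inj; lra.
Qed.

(* Logarithmic differentiation of the inversion formula for T2 / T3. *)
Lemma T4_inversion tau : upper tau -> T4 (- / tau) ^ 4 = - (tau ^ 2 * T2 tau ^ 4).
Proof.
move=> ut; have t0 := upper_neq0 ut; have us := upper_S ut.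
have D := neg_inv_deriv t0.
have D1 := Cderiv_mul (Cderiv_comp (g := fun t => - / t) (T3_deriv us) D) (T4_deriv ut).
have D2 := Cderiv_mul (Cderiv_comp (g := fun t => - / t) (T2_deriv us) D) (T3_deriv ut).
have := Cderiv_unique (Cderiv_ext ut (fun t h => theta_inversion h) D1) D2.
rewrite dT3_w // dT4_w // dT2_w // (dT3_w ut).
have I := theta_inversion ut.
have [_ k23] := w24_w23 us; have k34 := w34 ut.
move: k23 k34 I (T3_neq0 us) (T4_neq0 ut).
move: (T3 (- / tau)) (T2 (- / tau)) (T4 (- / tau)) (w2 (- / tau)) (w3 (- / tau)) (w3 tau) (w4 tau)
 (T2 tau) (T3 tau) (T4 tau) => a3 a2 a4 s2 s3 v3 v4 b2 b3 b4 k23 k34 I n3 n4 H.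
(* The theta values cancel from the differentiated formula because of the inversion formula
   itself. *)
have E : s3 / (tau * tau) + v4 = s2 / (tau * tau) + v3.
  apply: (@Ceq_mul_reg (a3 * b4)); first exact: Cmult_neq_0.
  transitivity (s3 * a3 * / (tau * tau) * b4 + a3 * (v4 * b4)); first by rewrite /Cdiv; ring.
  by rewrite H I /Cdiv; ring.
apply: (@Ceq_mul_reg kappa); first exact: kappa_neq0.
rewrite -k23; transitivity (- (tau ^ 2) * (kappa * b2 ^ 4)); last by ring.
rewrite -k34; transitivity (tau ^ 2 * ((s2 / (tau * tau) + v3) - s3 / (tau * tau) - v3)).
  by field.
by rewrite -E; field.
Qed.

Lemma x_fun_S tau : upper tau -> x_fun (- / tau) = tau ^ 2 * y_fun tau.
Proof.
move=> ut; rewrite x_fun_T4; last exact: upper_S.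
by rewrite T4_inversion // y_fun_T2 //; ring.
Qed.

Lemma S_involutive (tau : C) : tau <> 0 -> - / (- / tau) = tau.
Proof. by move=> t0; field. Qed.

Lemma y_fun_S tau : upper tau -> y_fun (- / tau) = tau ^ 2 * x_fun tau.
Proof.
move=> ut; have t0 := upper_neq0 ut; have := x_fun_S (upper_S ut).
by rewrite S_involutive // => ->; field.
Qed.

Lemma upper_shift tau (x : R) : upper tau -> upper (tau + RtoC x).
Proof. by rewrite /upper; case: tau => a b /=; lra. Qed.

Lemma x_fun_T tau : upper tau -> x_fun (tau + 2) = x_fun tau.
Proof.
move=> ut; rewrite !x_fun_T4 //; last exact: upper_shift.
congr (- _ ^ 4); apply: tsum_eq; apply: has_sum_ext (ES_has_sum good4 ut) => n.
congr (_ * _); rewrite -[LHS]Cmult_1_r -(Cexp_2PI_Z (n * n)) /eterm -Cexp_add; congr Cexp.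
by rewrite /sq mult_IZR RtoC_pow !RtoC_mult; ring.
Qed.

Lemma y_fun_T tau : upper tau -> y_fun (tau + 2) = y_fun tau.
Proof.
move=> ut; rewrite !y_fun_T2 //; last exact: upper_shift.
(* 2 (n + 1/2)^2 = 2 (n^2 + n) + 1/2, so every term acquires the factor exp(pi i / 2), which the
   fourth power removes. *)
suff -> : T2 (tau + 2) = Ci * T2 tau.
  have -> : (Ci * T2 tau) ^ 4 = (Ci * Ci) * (Ci * Ci) * T2 tau ^ 4 by ring.
  have -> : Ci * Ci = -1 by apply: injective_projections => /=; ring.
  by ring.
apply: tsum_eq; apply: has_sum_ext (has_sum_scal Ci (ES_has_sum good2 ut)) => n.
rewrite /one_c !Cmult_1_l.
have <- : Cexp (RtoC (PI / 2) * Ci) = Ci.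
  have -> : RtoC (PI / 2) * Ci = (0, PI / 2)%R by apply: injective_projections => /=; ring.
  by rewrite /Cexp /= exp_0 cos_PI2 sin_PI2 !Rmult_1_l.
rewrite -[LHS]Cmult_1_r -(Cexp_2PI_Z (n * n + n)) /eterm -!Cexp_add; congr Cexp.
have -> : RtoC (PI / 2) = RtoC PI / 2 by rewrite RtoC_div //; lra.
have -> : RtoC (hsq n) = (RtoC (IZR n) + 1 / 2) ^ 2.
  by rewrite /hsq RtoC_pow RtoC_plus RtoC_div //; lra.
by rewrite plus_IZR mult_IZR !RtoC_mult RtoC_plus RtoC_mult; field.
Qed.

Lemma upper_lin_neq0 (c d : R) (tau : C) : upper tau -> (c <> 0 \/ d <> 0)%R ->
  RtoC c * tau + RtoC d <> 0.
Proof.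
move=> ut cd; case: tau ut => a b; rewrite /upper /= => b0 [h1 h2].
have c0 : c = 0%R by have : (c * b = 0)%R by [lra]; case/Rmult_integral; lra.
by rewrite c0 in h1 cd; case: cd; lra.
Qed.

Lemma upper_U (s : R) tau : upper tau -> upper (tau / (RtoC s * tau + 1)).
Proof.
move=> ut; have t0 := upper_neq0 ut.
have n0 : RtoC s * tau + 1 <> 0 by apply: upper_lin_neq0 => //; right; lra.
have us := upper_S (upper_shift (- s) (upper_S ut)).
suff -> : tau / (RtoC s * tau + 1) = - / (- / tau + RtoC (- s)) by [].
have -> : - / tau + RtoC (- s) = - ((RtoC s * tau + 1) / tau) by rewrite RtoC_opp; field.
by move: n0; move: (RtoC s * tau + 1) => q q0; field.
Qed.

Lemma U_via_S tau : upper tau ->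
  tau / (2 * tau + 1) = - / (- / tau - 2) /\ upper (- / tau - 2).
Proof.
move=> ut; have t0 := upper_neq0 ut.
have n0 : 2 * tau + 1 <> 0 by apply: upper_lin_neq0 => //; right; lra.
split.
  have -> : - / tau - 2 = - ((2 * tau + 1) / tau) by field.
  by move: n0; move: (2 * tau + 1) => q q0; field.
by have := upper_shift (-2) (upper_S ut); rewrite RtoC_opp.
Qed.

(** The inversion - 1 / tau acts twice with a translation in between. It exchanges x and y both
    times, and the factors (- 1 / tau - 2)^2 and tau^2 combine to (2 tau + 1)^2. *)
Lemma x_fun_U tau : upper tau -> x_fun (tau / (2 * tau + 1)) = (2 * tau + 1) ^ 2 * x_fun tau.
Proof.
move=> ut; have t0 := upper_neq0 ut; have [-> us] := U_via_S ut.
rewrite x_fun_S // -(y_fun_T us).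
have -> : - / tau - 2 + 2 = - / tau by ring.
by rewrite y_fun_S //; field.
Qed.

Lemma y_fun_U tau : upper tau -> y_fun (tau / (2 * tau + 1)) = (2 * tau + 1) ^ 2 * y_fun tau.
Proof.
move=> ut; have t0 := upper_neq0 ut; have [-> us] := U_via_S ut.
rewrite y_fun_S // -(x_fun_T us).
have -> : - / tau - 2 + 2 = - / tau by ring.
by rewrite x_fun_S //; field.
Qed.

Lemma periodic_Z (f : C -> C) : (forall t, upper t -> f (t + 2) = f t) ->
  forall (m : Z) t, upper t -> f (t + RtoC (2 * IZR m)) = f t.
Proof.
move=> per; elim/Z.peano_ind => [|m IH|m IH] t ut.
- by rewrite Rmult_0_r Cplus_0_r.
- rewrite -Z.add_1_r plus_IZR.
  have -> : t + RtoC (2 * (IZR m + 1)) = (t + RtoC (2 * IZR m)) + 2.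
    by rewrite Rmult_plus_distr_l Rmult_1_r RtoC_plus; ring.
  by rewrite per ?IH //; apply: upper_shift.
- rewrite -Z.sub_1_r minus_IZR -[RHS](IH t ut).
  have -> : t + RtoC (2 * IZR m) = (t + RtoC (2 * (IZR m - 1))) + 2.
    by rewrite Rmult_minus_distr_l Rmult_1_r RtoC_minus; ring.
  by rewrite per //; apply: upper_shift.
Qed.

Lemma RtoC_m1_pow2 (k : nat) : (-1) ^ (2 * k)%nat = 1.
Proof. by rewrite Cpow_mult_r (_ : (-1) ^ 2 = 1) ?Cpow_1_l //; ring. Qed.

(* Gamma(2) is generated by tau + 2, tau / (2 tau + 1) and - 1: a Euclidean
   algorithm on the lower row, whose entries have different parities. *)
Lemma Gamma2_generated (f : C -> C) (k : nat) :
  (forall t, upper t -> f (t + 2) = f t) ->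
  (forall t, upper t -> f (t / (2 * t + 1)) = (2 * t + 1) ^ (2 * k)%nat * f t) ->
  forall a b c d : Z, in_Gamma2 a b c d -> forall t, upper t ->
    f ((RtoC (IZR a) * t + RtoC (IZR b)) / (RtoC (IZR c) * t + RtoC (IZR d)))
    = (RtoC (IZR c) * t + RtoC (IZR d)) ^ (2 * k)%nat * f t.
Proof.
move=> per invU.
(* For the inverse generator, the given rule is read at the point [t / (-2 * t + 1)]. *)
have invV s : s = 1%Z \/ s = (-1)%Z -> forall t, upper t ->
    f (t / (RtoC (2 * IZR s) * t + 1)) = (RtoC (2 * IZR s) * t + 1) ^ (2 * k)%nat * f t.
  move=> hs t ut; case: hs => ->; first by rewrite Rmult_1_r; exact: invU.
  have n0 : RtoC (2 * -1) * t + 1 <> 0 by apply: upper_lin_neq0 => //; right; lra.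
  have uv := upper_U (2 * -1) ut; have := invU _ uv.
  move: n0; have -> : RtoC (2 * -1) = -2 by congr RtoC; ring.
  move=> n0; set v := t / _.
  have -> : v / (2 * v + 1) = t by rewrite /v; field; split => //; rewrite (_ : _ + _ = 1); [exact: C1_neq0 | ring].
  have -> : 2 * v + 1 = / (-2 * t + 1) by rewrite /v; field.
  move=> ->; rewrite Cpow_inv // Cmult_assoc Cinv_r ?Cmult_1_l //; exact: Cpow_nz.
move=> a b c d; have [n hn] : exists n : nat, (Z.abs c + Z.abs d < Z.of_nat n)%Z.
  by exists (Z.to_nat (Z.abs c + Z.abs d + 1)); lia.
elim: n a b c d hn => [|n IH] a b c d hn; first by lia.
move=> [det [[a' ha] [[b' hb] [[c' hc] [d' hd]]]]] t ut.
have cd0 : RtoC (IZR c) * t + RtoC (IZR d) <> 0.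
  by apply: upper_lin_neq0 => //; right; apply: not_0_IZR; lia.
have [c0|c0] := Z.eq_dec c 0.
  rewrite c0 in det cd0 *; have [ea ed] : a = d /\ (d = 1%Z \/ d = (-1)%Z).
    have ad : (a * d = 1)%Z by lia.
    have [a1|a1] := Z.mul_eq_1 _ _ ad; rewrite a1 in ad; lia.
  have -> : (RtoC (IZR a) * t + RtoC (IZR b)) / (RtoC 0 * t + RtoC (IZR d))
     = t + RtoC (2 * IZR (b' * d)).
    rewrite ea hb !mult_IZR !RtoC_mult Cmult_0_l Cplus_0_l.
    by case: ed => ->; field.
  rewrite (periodic_Z per) // Cmult_0_l Cplus_0_l.
  by case: ed => ->; rewrite ?Cpow_1_l ?RtoC_m1_pow2 Cmult_1_l.
(* c is even and d odd, so |c| and |d| differ, and both are nonzero here. With s the sign of c d,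
   subtracting 2 s times the smaller entry from the larger one lowers its absolute value, hence also
   |c| + |d|, the measure of the induction. *)
have [s [hs hlt]] : exists s, (s = 1%Z \/ s = (-1)%Z) /\
    ((Z.abs c < Z.abs d)%Z /\ (Z.abs (d - 2 * s * c) < Z.abs d)%Z \/
     (Z.abs d < Z.abs c)%Z /\ (Z.abs (c - 2 * s * d) < Z.abs c)%Z).
  case: (Z_lt_le_dec 0 c) => h1; case: (Z_lt_le_dec 0 d) => h2;
    [exists 1%Z | exists (-1)%Z | exists (-1)%Z | exists 1%Z];
    (split; [by [left | right] | clear - h1 h2 c0 hc hd; lia]).
case: hlt => -[_ lt].
- have G : in_Gamma2 a (b - 2 * s * a) c (d - 2 * s * c).
    split; first by rewrite -det; ring.
    split; first by exists a'. split; first by exists (b' - s * a)%Z; rewrite hb; ring.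
    split; first by exists c'. by exists (d' - s * c)%Z; lia.
  have := IH _ _ _ _ _ G (t + RtoC (2 * IZR s)) (upper_shift _ ut) => H.
  have E1 : RtoC (IZR a) * t + RtoC (IZR b) =
     RtoC (IZR a) * (t + RtoC (2 * IZR s)) + RtoC (IZR (b - 2 * s * a)).
    by rewrite minus_IZR !mult_IZR RtoC_minus !RtoC_mult; ring.
  have E2 : RtoC (IZR c) * t + RtoC (IZR d) =
     RtoC (IZR c) * (t + RtoC (2 * IZR s)) + RtoC (IZR (d - 2 * s * c)).
    by rewrite minus_IZR !mult_IZR RtoC_minus !RtoC_mult; ring.
  by rewrite E1 E2 H ?(periodic_Z per) //; lia.
- have G : in_Gamma2 (a - 2 * s * b) b (c - 2 * s * d) d.
    split; first by rewrite -det; ring.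
    split; first by exists (a' - s * b)%Z; lia. split; first by exists b'.
    split; first by exists (c' - s * d)%Z; rewrite hc; ring. by exists d'.
  have m0 : RtoC (2 * IZR s) * t + 1 <> 0 by apply: upper_lin_neq0 => //; right; lra.
  have := IH _ _ _ _ _ G _ (upper_U (2 * IZR s) ut); rewrite invV //.
  have E1 : RtoC (IZR (a - 2 * s * b)) * (t / (RtoC (2 * IZR s) * t + 1)) + RtoC (IZR b)
     = (RtoC (IZR a) * t + RtoC (IZR b)) / (RtoC (2 * IZR s) * t + 1).
    by rewrite minus_IZR !mult_IZR RtoC_minus !RtoC_mult; rewrite RtoC_mult in m0; field.
  have E2 : RtoC (IZR (c - 2 * s * d)) * (t / (RtoC (2 * IZR s) * t + 1)) + RtoC (IZR d)
     = (RtoC (IZR c) * t + RtoC (IZR d)) / (RtoC (2 * IZR s) * t + 1).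
    by rewrite minus_IZR !mult_IZR RtoC_minus !RtoC_mult; rewrite RtoC_mult in m0; field.
  rewrite E1 E2.
  have quot (p q r : C) : q <> 0 -> r <> 0 -> (p / r) / (q / r) = p / q by move=> ? ?; field.
  rewrite (quot _ _ _ cd0 m0) => -> //; last by lia.
  rewrite /Cdiv Cpow_mult_l Cpow_inv // -Cmult_assoc (Cmult_assoc (/ _)) Cinv_l ?Cmult_1_l //.
  exact: Cpow_nz.
Qed.

(** * Polynomial growth at the cusps *)

Lemma exp_neg_le (x : R) : (0 <= x)%R -> (exp (- x) <= / (1 + x))%R.
Proof.
move=> x0; rewrite exp_Ropp; apply: Rinv_le_contravar; first lra.
exact: exp_ineq1_le.
Qed.

(** exp(- x) <= 1 / (1 + x) for x = pi lam Im tau, and 1 + x >= Im tau (1 + lam) when Im tau < 1, so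
    each term is at most a / Im tau times 1 / (1 + n^2). The bound is uniform in Re tau and serves
    all rational points at once. *)
Lemma ES_growth (c : Z -> C) (lam : Z -> R) (a : R) : good c lam ->
  (forall n, Cmod (c n) = 1%R) -> (forall n, 1 + IZR n ^ 2 <= a * (1 + lam n))%R ->
  exists2 K : R, (0 <= K)%R & forall tau : C, (0 < Im tau < 1)%R ->
    (Cmod (ES c lam tau) <= K / Im tau)%R.
Proof.
move=> g c1 Ha; have [l0 _] := g; have [M HM] := summable_inv_sq_Z.
have M0 : (0 <= M)%R by have := HM [::] isT; rewrite big_nil.
have a0 : (0 <= a)%R by have := Ha 0%Z; have := l0 0%Z; rewrite /=; nra.
exists (a * M)%R => [|tau [t0 t1]]; first nra.
apply: (has_sum_Cmod_le (ES_has_sum g t0)) => L u; have P := PI2_3_2.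
have -> : (a * M / Im tau = a / Im tau * M)%R by field; lra.
have q0 : (0 <= a / Im tau)%R by apply: Rmult_le_pos => //; apply/Rlt_le/Rinv_0_lt_compat.
apply: Rle_trans (Rmult_le_compat_l _ _ _ q0 (HM L u)).
rewrite -rsum_mull; apply: rsum_le => n; rewrite Cmod_mult c1 Rmult_1_l Cmod_eterm.
have L0 := l0 n; have A := Ha n; have n2 := pow2_ge_0 (IZR n).
have plt : (0 <= PI * lam n * Im tau)%R by apply: Rmult_le_pos; [nra | lra].
have -> : (- PI * lam n * Im tau = - (PI * lam n * Im tau))%R by ring.
apply: Rle_trans (exp_neg_le plt) _.
rewrite Cmod_R Rabs_pos_eq; last by apply/Rlt_le/Rinv_0_lt_compat; lra.
have k1 : (Im tau * (1 + lam n) <= 1 + PI * lam n * Im tau)%R by nra.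
have k2 : (0 < Im tau * (1 + lam n))%R by apply: Rmult_lt_0_compat; lra.
apply: Rle_trans (Rinv_le_contravar _ _ k2 k1) _.
apply: (Rmult_le_reg_l (Im tau * (1 + lam n) * (1 + IZR n ^ 2))).
  by apply: Rmult_lt_0_compat; lra.
have -> : (Im tau * (1 + lam n) * (1 + IZR n ^ 2) * / (Im tau * (1 + lam n)) = 1 + IZR n ^ 2)%R.
  by field; lra.
have -> : (Im tau * (1 + lam n) * (1 + IZR n ^ 2) * (a / Im tau * / (1 + IZR n ^ 2)) = a * (1 + lam n))%R.
  by field; lra.
exact: A.
Qed.

Lemma xy_growth : exists2 K : R, (1 <= K)%R & forall tau : C, (0 < Im tau < 1)%R ->
  (Cmod (x_fun tau) <= (K / Im tau) ^ 4)%R /\ (Cmod (y_fun tau) <= (K / Im tau) ^ 4)%R.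
Proof.
have [K4 K40 H4] := ES_growth good4 Cmod_sgn (a := 1) (fun n => ltac:(rewrite /sq; lra)).
have [K2 K20 H2] := ES_growth good2 (fun _ => Cmod_1) (a := 4) hsq_weight.
exists (K4 + K2 + 1)%R => [|tau ht]; first lra.
have [t0 t1] := ht; have i0 : (0 < / Im tau)%R by exact: Rinv_0_lt_compat.
rewrite x_fun_T4 // y_fun_T2 // Cmod_opp !Cmod_pow.
split; apply: pow_incr; split; try exact: Cmod_ge_0.
  by apply: Rle_trans (H4 _ ht) _; apply: Rmult_le_compat_r; lra.
by apply: Rle_trans (H2 _ ht) _; apply: Rmult_le_compat_r; lra.
Qed.

(** * The polynomials p_n and the functions f_n *)

Import GRing.Theory.

Definition Cratr (q : rat) : C := RtoC (ratr q).

Lemma Cratr_0 : Cratr 0%ring = 0.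
Proof. by rewrite /Cratr raddf0. Qed.
Lemma Cratr_1 : Cratr 1%ring = 1.
Proof. by rewrite /Cratr rmorph1. Qed.
Lemma Cratr_add (a b : rat) : Cratr (a + b)%ring = Cratr a + Cratr b.
Proof. by rewrite /Cratr raddfD RtoC_plus. Qed.
Lemma Cratr_opp (a : rat) : Cratr (- a)%ring = - Cratr a.
Proof. by rewrite /Cratr raddfN RtoC_opp. Qed.
Lemma Cratr_mul (a b : rat) : Cratr (a * b)%ring = Cratr a * Cratr b.
Proof. by rewrite /Cratr rmorphM RtoC_mult. Qed.
Lemma Cratr_nat (n : nat) : Cratr (n%:R)%ring = RtoC (INR n).
Proof.
elim: n => [|n IH]; first exact: Cratr_0.
by rewrite -addn1 natrD Cratr_add IH Cratr_1 addn1 RtoC_INR_S.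
Qed.

(** A common length lets the values of polynomials of different sizes be added termwise. *)
Lemma peval_wide (p : {poly rat}) (w : C) (N : nat) : (size p <= N)%nat ->
  peval p w = \csum_(0 <= k < N) (Cratr (p`_k)%ring * w ^ k).
Proof.
move=> hN; rewrite /peval -(big_mkord xpredT (fun k => Cratr (p`_k)%ring * w ^ k)).
rewrite [in RHS](big_cat_nat _ (n := size p)) //=.
rewrite [X in _ = Cplus _ X](eq_big_nat _ _ (F2 := fun=> RtoC 0)).
  by rewrite big1_eq Cplus_0_r.
by move=> k /andP[hk _]; rewrite nth_default // Cratr_0 Cmult_0_l.
Qed.

Lemma peval_add (p q : {poly rat}) (w : C) : peval (p + q)%ring w = peval p w + peval q w.
Proof.
pose N := maxn (size p) (size q).
rewrite (@peval_wide p w N) ?leq_maxl // (@peval_wide q w N) ?leq_maxr //.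
rewrite (@peval_wide _ w N); last by rewrite size_polyD.
rewrite -csum_add; apply: eq_bigr => k _; rewrite coefD Cratr_add; ring.
Qed.

Lemma peval_scale (a : rat) (p : {poly rat}) (w : C) : peval (a *: p)%ring w = Cratr a * peval p w.
Proof.
rewrite (@peval_wide _ w (size p)) ?size_scale_leq // (@peval_wide p w (size p)) //.
rewrite -csum_mull; apply: eq_bigr => k _; rewrite coefZ Cratr_mul; ring.
Qed.

Lemma peval_opp (p : {poly rat}) (w : C) : peval (- p)%ring w = - peval p w.
Proof. by rewrite -scaleN1r peval_scale Cratr_opp Cratr_1; ring. Qed.

Lemma peval_0 (w : C) : peval 0%ring w = 0.
Proof. by rewrite (@peval_wide _ w 0) ?size_poly0 // big_geq. Qed.

Lemma peval_1 (w : C) : peval 1%ring w = 1.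
Proof. by rewrite (@peval_wide _ w 1) ?size_poly1 // big_nat1 coef1 /= Cratr_1; ring. Qed.

Lemma peval_Xmul (p : {poly rat}) (w : C) : peval ('X * p)%ring w = w * peval p w.
Proof.
rewrite (@peval_wide _ w (size p).+1); last first.
  by rewrite (leq_trans (size_polyMleq _ _)) // size_polyX.
rewrite csum_recl coefXM eqxx Cratr_0 Cmult_0_l Cplus_0_l (@peval_wide p w (size p)) //.
rewrite -csum_mull; apply: eq_bigr => k _; have -> : (('X * p)`_k.+1)%ring = (p`_k)%ring by rewrite coefXM.
by rewrite Cpow_S; ring.
Qed.

Lemma peval_deriv (p : {poly rat}) (w : C) : Cderiv (peval p) w (peval (p^`())%ring w).
Proof.
apply: (Cderiv_ext_all (f := fun t => \csum_(0 <= k < (size p).+1) (Cratr (p`_k)%ring * t ^ k))).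
  by move=> t; rewrite -peval_wide.
have -> : peval (p^`())%ring w = \csum_(0 <= k < (size p).+1)
    (Cratr (p`_k)%ring * (RtoC (INR k) * w ^ k.-1 * 1)).
  rewrite csum_recl (_ : _ * (RtoC (INR 0) * _ * _) = 0) ?Cplus_0_l; last by rewrite /=; ring.
  rewrite (@peval_wide _ w (size p)); last first.
    by rewrite (leq_trans (size_poly _ _)) // leq_pred.
  apply: eq_bigr => k _; rewrite coef_deriv -mulr_natr Cratr_mul Cratr_nat [k.+1.-1]/=; ring.
apply: (Cderiv_csum (F := fun k t => Cratr (p`_k)%ring * t ^ k)
  (G := fun k t => Cratr (p`_k)%ring * (RtoC (INR k) * t ^ k.-1 * 1))) => k _.
exact: Cderiv_scal (Cderiv_pow k (Cderiv_id w)).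
Qed.

(** The recursion has order two, so the pair (p_n, p_(n-1)) is carried along. *)
Fixpoint pq (n : nat) : {poly rat} * {poly rat} :=
  if n is m.+1 then
    let: (p, q) := pq m in
    ((((m%:R + 1) ^+ 2)^-1 *: (m%:R *: ('X * p) - p^`() * ('X^2 - 'X) - 4%:R^-1 *: ('X * q)))%ring, p)
  else (1%ring, 0%ring).

Definition pseq (k : int) : {poly rat} := if k is Posz n then (pq n).1 else 0%ring.

Lemma pq_2 n : (pq n).2 = pseq (Posz n - 1)%ring.
Proof.
case: n => [|n] //.
have -> : (Posz n.+1 - 1)%ring = Posz n by lia.
by rewrite /=; case: (pq n).
Qed.

Lemma natr1_sq_neq0 (n : nat) : (((n%:R + 1) ^+ 2 : rat) != 0)%ring.
Proof. by rewrite natr1 expf_neq0 // Num.Theory.pnatr_eq0. Qed.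

Lemma pseq_step (n : nat) : pseq (Posz n + 1)%ring =
  (((n%:R + 1) ^+ 2)^-1 *: (n%:R *: ('X * pseq (Posz n)) - (pseq (Posz n))^`() * ('X^2 - 'X)
     - 4%:R^-1 *: ('X * pseq (Posz n - 1))))%ring.
Proof.
have -> : (Posz n + 1)%ring = Posz n.+1 by lia.
by rewrite -pq_2 /=; case: (pq n).
Qed.

Lemma zmod_cancel (V : zmodType) (x y z : V) : (x - y - z + y - x + z = 0)%ring.
Proof.
by rewrite (addrAC (x - y)%ring (- z)%ring y) subrK (addrAC x (- z)%ring (- x)%ring) subrr sub0r addNr.
Qed.

Lemma zmod_solve (V : zmodType) (a x y z : V) : (a + y - x + z = 0 -> a = x - y - z)%ring.
Proof.
move/eqP; rewrite addr_eq0 => /eqP h.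
have -> : (a = a + y - x + x - y)%ring by rewrite subrK addrK.
by rewrite h (addrC (- z)%ring) addrAC.
Qed.

Lemma pseq_system : p_system pseq.
Proof.
split=> //; split=> // n; rewrite pseq_step scalerA divff ?natr1_sq_neq0 // scale1r.
exact: zmod_cancel.
Qed.

Lemma p_system_unique (q : int -> {poly rat}) : p_system q ->
  forall k : int, (-1 <= k)%ring -> q k = pseq k.
Proof.
move=> [qm1 [q0 qS]].
have step n : q (Posz n + 1)%ring =
  (((n%:R + 1) ^+ 2)^-1 *: (n%:R *: ('X * q (Posz n)) - (q (Posz n))^`() * ('X^2 - 'X)
     - 4%:R^-1 *: ('X * q (Posz n - 1))))%ring.
  apply: (scalerI (natr1_sq_neq0 n)); rewrite scalerA divff ?natr1_sq_neq0 // scale1r.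
  exact: zmod_solve (qS n).
have H n : q (Posz n) = pseq (Posz n) /\ q (Posz n - 1)%ring = pseq (Posz n - 1)%ring.
  elim: n => [|n [IH1 IH2]]; first by rewrite q0 qm1.
  have -> : (Posz n.+1 - 1)%ring = Posz n by lia.
  have -> : Posz n.+1 = (Posz n + 1)%ring by lia.
  by rewrite step pseq_step IH1 IH2.
case=> [n|[|n]] h; [by case: (H n) | exact: qm1 | by exfalso; lia].
Qed.

Lemma peval_pseq_step (n : nat) (w : C) :
  RtoC (INR n.+1) ^ 2 * peval (pseq (Posz n.+1)) w =
  RtoC (INR n) * (w * peval (pseq (Posz n)) w)
  - peval (pseq (Posz n))^`()%ring w * (w ^ 2 - w)
  - / 4 * (w * peval (pseq (Posz n - 1)%ring) w).
Proof.
have -> : Posz n.+1 = (Posz n + 1)%ring by lia.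
rewrite pseq_step peval_scale; set P := pseq (Posz n); set Q := pseq (Posz n - 1)%ring.
have c4 : Cratr (4%:R^-1)%ring = / 4.
  have h : Cratr (4%:R^-1)%ring * 4 = 1.
    have -> : RtoC 4 = Cratr (4%:R)%ring by rewrite Cratr_nat; congr RtoC; rewrite /=; ring.
    by rewrite -Cratr_mul mulVf ?Cratr_1.
  apply: (@Ceq_mul_reg 4); first by move=> /RtoC_inj; lra.
  by rewrite Cmult_comm h; field.
have cn : RtoC (INR n.+1) ^ 2 * Cratr (((n%:R + 1) ^+ 2)^-1)%ring = 1.
  have -> : RtoC (INR n.+1) ^ 2 = Cratr ((n%:R + 1) ^+ 2)%ring.
    by rewrite natr1 expr2 Cratr_mul Cratr_nat; ring.
  by rewrite -Cratr_mul divff ?Cratr_1 // natr1_sq_neq0.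
rewrite Cmult_assoc cn Cmult_1_l !peval_add !peval_opp !peval_scale !peval_Xmul.
rewrite Cratr_nat c4 mulrBr peval_add peval_opp expr2 mulrA !(mulrC _ 'X)%ring !peval_Xmul.
ring.
Qed.

(** The bound deg p_n <= n is what allows x^n p_n(y / x) to be written without division by x. *)
Lemma pq_size (n : nat) : (size (pq n).1 <= n.+1)%nat /\ (size (pq n).2 <= n.+1)%nat.
Proof.
elim: n => [|n [IH1 IH2]]; first by rewrite /= size_poly1 size_poly0.
rewrite /=; case: (pq n) IH1 IH2 => p q /= IH1 IH2; split; last exact: leqW.
have sX (r : {poly rat}) : (size r <= n.+1)%nat -> (size ('X * r)%ring <= n.+2)%nat.
  by move=> h; rewrite (leq_trans (size_polyMleq _ _)) // size_polyX.
rewrite (leq_trans (size_scale_leq _ _)) // (leq_trans (size_polyD _ _)) // geq_max.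
rewrite (leq_trans (size_polyD _ _)) ?geq_max /=; last first.
  rewrite (leq_trans (size_scale_leq _ _)) ?sX //= size_polyN.
  rewrite (leq_trans (size_polyMleq _ _)) //.
  have h1 : (size (p^`())%ring <= n)%nat.
    have h0 : (size (p^`())%ring <= (size p).-1)%nat by exact: size_poly.
    by apply: leq_trans h0 _; case: (size p) IH1.
  have h2 : (size ('X^2 - 'X : {poly rat})%ring <= 3)%nat.
    by rewrite (leq_trans (size_polyD _ _)) // size_polyN size_polyX size_polyXn.
  have arith (a b m : nat) : (a <= m -> b <= 3 -> (a + b).-1 <= m.+2)%nat by lia.
  exact: arith h1 h2.
by rewrite size_polyN (leq_trans (size_scale_leq _ _)) ?sX.
Qed.

Lemma pseq_size (n : nat) : (size (pseq (Posz n)) <= n.+1)%nat.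
Proof. by case: (pq_size n). Qed.

(** As a homogeneous polynomial in x and y, f_n can be estimated from upper bounds for x and y
    alone, whereas u has in its denominator x, which may be small near a cusp. *)
Lemma f_fun_expand (n : nat) (tau : C) : upper tau ->
  f_fun pseq n tau = RtoC PI ^ (2 * n)%nat *
   \csum_(0 <= k < n.+1) (Cratr ((pseq (Posz n))`_k)%ring *
      (y_fun tau ^ k * x_fun tau ^ (n - k)%nat)).
Proof.
move=> ut; have x0 := x_fun_neq0 ut.
rewrite /f_fun (peval_wide _ (pseq_size n)) -Cmult_assoc -csum_mull; congr (_ * _).
apply: eq_big_nat => k /andP[_ hk].
have -> : x_fun tau ^ n = x_fun tau ^ k * x_fun tau ^ (n - k)%nat.
  by rewrite -Cpow_add_r; congr (_ ^ _); lia.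
rewrite /u_fun /Cdiv Cpow_mult_l Cpow_inv //.
have := @Cpow_nz _ k x0; move: (x_fun tau ^ k) => X X0.
by field.
Qed.

Lemma f_fun_growth (n : nat) (r : R) : exists (K : R) (N : nat) (delta : R), (0 < delta)%R /\
  forall v : R, (0 < v < delta)%R ->
    (Cmod (f_fun pseq n (RtoC r + Ci * RtoC v)%C) <= K * (/ v) ^ N)%R.
Proof.
have [D D1 HD] := xy_growth.
pose S := (\big[Rplus/R0]_(0 <= k < n.+1) Cmod (Cratr ((pseq (Posz n))`_k)%ring))%R.
exists (Cmod (RtoC PI ^ (2 * n)%nat) * (S * (D ^ 4) ^ n))%R, (4 * n)%nat, 1%R.
split=> [|v [v0 v1]]; first lra.
set tau := (_ + _)%C; have It : Im tau = v by rewrite /tau /=; ring.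
have ut : upper tau by rewrite /upper It.
have [hx hy] := HD tau ltac:(rewrite It; lra); rewrite It in hx hy.
rewrite f_fun_expand // Cmod_mult Rmult_assoc; apply: Rmult_le_compat_l; first exact: Cmod_ge_0.
have -> : (S * (D ^ 4) ^ n * (/ v) ^ (4 * n)%nat = ((D / v) ^ 4) ^ n * S)%R.
  rewrite pow_mult Rmult_assoc -Rpow_mult_distr Rmult_comm; congr (_ ^ _ * _)%R.
  by rewrite -Rpow_mult_distr.
apply: Rle_trans (Cmod_csum _ _) _; rewrite /S -rsum_mull.
apply: rsum_le_in => k; rewrite mem_index_iota => /andP[_ hk].
rewrite !Cmod_mult Rmult_comm; apply: Rmult_le_compat_r; first exact: Cmod_ge_0.
have -> : (((D / v) ^ 4) ^ n = ((D / v) ^ 4) ^ k * ((D / v) ^ 4) ^ (n - k)%nat)%R.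
  by rewrite -pow_add; congr (_ ^ _)%R; lia.
rewrite (Cmod_pow (y_fun tau)) (Cmod_pow (x_fun tau)).
by apply: Rmult_le_compat; try (apply: pow_le; exact: Cmod_ge_0); apply: pow_incr; split => //; exact: Cmod_ge_0.
Qed.

Lemma f_fun_T (n : nat) tau : upper tau -> f_fun pseq n (tau + 2) = f_fun pseq n tau.
Proof. by move=> ut; rewrite /f_fun /u_fun x_fun_T // y_fun_T. Qed.

Lemma f_fun_U (n : nat) tau : upper tau ->
  f_fun pseq n (tau / (2 * tau + 1)) = (2 * tau + 1) ^ (2 * n)%nat * f_fun pseq n tau.
Proof.
move=> ut; have x0 := x_fun_neq0 ut; rewrite /f_fun /u_fun x_fun_U // y_fun_U //.
have n0 : 2 * tau + 1 <> 0 by apply: upper_lin_neq0 => //; right; lra.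
have -> : (2 * tau + 1) ^ 2 * y_fun tau / ((2 * tau + 1) ^ 2 * x_fun tau) = y_fun tau / x_fun tau.
  by move: n0; move: (2 * tau + 1) => q q0; field.
by rewrite Cpow_mult_l -Cpow_mult_r multE; ring.
Qed.

(** * The Riccati equation and the derivatives of the f_n *)

Definition Aw (tau : C) : C := 2 * RtoC PI * Ci * w3 tau.

Lemma Ci_sq : Ci * Ci = -1.
Proof. by apply: injective_projections => /=; ring. Qed.

Lemma PI_C_neq0 : RtoC PI <> 0.
Proof. by move=> /RtoC_inj; have := PI_RGT_0; lra. Qed.

Lemma Ci_neq0 : Ci <> 0.
Proof. by case; lra. Qed.

Lemma theta_deriv tau : upper tau -> Cderiv theta tau (dT3 tau).
Proof.
by move=> ut; apply: Cderiv_ext ut _ (T3_deriv ut) => t h; rewrite theta_T3.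
Qed.

Lemma A_fun_Aw tau : upper tau -> A_fun tau = Aw tau.
Proof.
move=> ut; rewrite /A_fun /t_fun (is_C_derive_unique _ _ _ (theta_deriv ut)) theta_T3 //.
rewrite -/(w3 tau) /Aw.
have P := PI_C_neq0; have I := Ci_neq0; have n3 := T3_neq0 ut.
transitivity (-1 * (2 * RtoC PI * / Ci * w3 tau)); first by rewrite /w3; field.
by rewrite -Ci_sq; field.
Qed.

Definition dAw (tau : C) : C := 2 * RtoC PI * Ci * dw3 tau.

Lemma Aw_deriv tau : upper tau -> Cderiv Aw tau (dAw tau).
Proof. by move=> ut; apply: Cderiv_scal (w3_deriv ut). Qed.

(** w2 w3 + w3 w4 - w2 w4 - w3^2 factors as (w2 - w3) (w3 - w4), and both factors are [kappa] times
    the fourth power of a theta constant. *)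
Lemma riccati tau : upper tau ->
  RtoC PI * Ci * dAw tau - Aw tau * Aw tau = - (RtoC PI ^ 4 / 4 * (x_fun tau * y_fun tau)).
Proof.
move=> ut; rewrite /dAw /Aw halphen // x_fun_T4 // y_fun_T2 //.
have [_ k23] := w24_w23 ut; have k34 := w34 ut.
transitivity (4 * (Ci * Ci) * RtoC PI ^ 2 * ((w2 tau - w3 tau) * (w3 tau - w4 tau))); first by ring.
rewrite k23 k34 /kappa Ci_sq.
transitivity (- (RtoC PI ^ 4 * (Ci * Ci) / 4 * (T4 tau ^ 4 * T2 tau ^ 4))); first by field.
by rewrite Ci_sq; field.
Qed.

Lemma x_fun_deriv tau : upper tau -> Cderiv x_fun tau (4 * w4 tau * x_fun tau).
Proof.
move=> ut; apply: (Cderiv_ext (f := fun t => - T4 t ^ 4)) => //; first by move=> t h; rewrite x_fun_T4.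
apply: Cderiv_eq (Cderiv_opp (Cderiv_pow 4 (T4_deriv ut))).
rewrite x_fun_T4 // dT4_w // [_.-1]/=.
have -> : RtoC (INR 4) = 4 by congr RtoC; rewrite /=; ring.
ring.
Qed.

Lemma y_fun_deriv tau : upper tau -> Cderiv y_fun tau (4 * w2 tau * y_fun tau).
Proof.
move=> ut; apply: (Cderiv_ext (f := fun t => T2 t ^ 4)) => //; first by move=> t h; rewrite y_fun_T2.
apply: Cderiv_eq (Cderiv_pow 4 (T2_deriv ut)).
rewrite y_fun_T2 // dT2_w // [_.-1]/=.
have -> : RtoC (INR 4) = 4 by congr RtoC; rewrite /=; ring.
ring.
Qed.

(** u' / u = 4 (w2 - w4) = 4 kappa T3^4, and T3^4 = y - x by the quartic identity. *)
Lemma u_fun_deriv tau : upper tau ->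
  Cderiv u_fun tau (4 * kappa * x_fun tau * (u_fun tau ^ 2 - u_fun tau)).
Proof.
move=> ut; have x0 := x_fun_neq0 ut.
apply: Cderiv_eq (Cderiv_div x0 (y_fun_deriv ut) (x_fun_deriv ut)).
have [k24 _] := w24_w23 ut.
transitivity (4 * (w2 tau - w4 tau) * u_fun tau); first by rewrite /u_fun; field.
rewrite k24 (_ : T3 tau ^ 4 = y_fun tau - x_fun tau).
  by rewrite /u_fun; field.
by rewrite y_fun_T2 // x_fun_T4 // jacobi_quartic //; ring.
Qed.

Definition f_prev (n : nat) (tau : C) : C := if n is m.+1 then f_fun pseq m tau else 0.

(** The recurrence for f_(n+1) solved for the derivative of f_n, so that [f_fun_deriv] amounts to
    this recurrence. *)
Definition df_fun (n : nat) (tau : C) : C :=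
  (RtoC (INR n.+1) ^ 2 * f_fun pseq n.+1 tau + 2 * RtoC (INR n) * Aw tau * f_fun pseq n tau
   - (RtoC PI * Ci * dAw tau - Aw tau * Aw tau) * f_prev n tau) / (RtoC PI * Ci).

Lemma f_prev_E (n : nat) tau : upper tau ->
  RtoC PI ^ 2 * x_fun tau * f_prev n tau =
  RtoC PI ^ (2 * n)%nat * x_fun tau ^ n * peval (pseq (Posz n - 1)%ring) (u_fun tau).
Proof.
move=> ut; case: n => [|n]; first by rewrite /= peval_0; ring.
have -> : (Posz n.+1 - 1)%ring = Posz n by lia.
by rewrite /f_prev /f_fun !Cpow_mult_r !Cpow_S; ring.
Qed.

Lemma f_fun_deriv (n : nat) tau : upper tau -> Cderiv (f_fun pseq n) tau (df_fun n tau).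
Proof.
move=> ut; have x0 := x_fun_neq0 ut; have P0 := PI_C_neq0; have I0 := Ci_neq0.
have D := Cderiv_mul (Cderiv_scal (RtoC PI ^ (2 * n)%nat) (Cderiv_pow n (x_fun_deriv ut)))
  (Cderiv_comp (peval_deriv (pseq (Posz n)) (u_fun tau)) (u_fun_deriv ut)).
apply: Cderiv_eq (Cderiv_ext_all _ D); last by move=> t; rewrite /f_fun.
set P := peval (pseq _) _; set P' := peval (_^`())%ring _.
have xn : RtoC (INR n) * x_fun tau ^ n.-1 * (4 * w4 tau * x_fun tau)
    = RtoC (INR n) * (4 * w4 tau) * x_fun tau ^ n.
  by case: (n) => [|m]; [rewrite /=; ring | rewrite Cpow_S [m.+1.-1]/=; ring].
rewrite xn /df_fun riccati //.
have ye : y_fun tau = u_fun tau * x_fun tau by rewrite /u_fun; field.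
have S := peval_pseq_step n (u_fun tau); rewrite -/P -/P' in S.
have F := f_prev_E n ut; set Q := peval (pseq (Posz n - 1)%ring) (u_fun tau) in S F.
have W := w34 ut; rewrite -y_fun_T2 // in W.
(* The derivative of x^n brings in w4. Its part w3 becomes 2 n A f_n, and the part - kappa y becomes
   the term n u p_n of the recursion for the polynomials. *)
have W4 : w4 tau = w3 tau - kappa * y_fun tau by rewrite -W; ring.
have f1 : RtoC (INR n.+1) ^ 2 * f_fun pseq n.+1 tau =
  RtoC PI ^ 2 * x_fun tau * (RtoC PI ^ (2 * n)%nat * x_fun tau ^ n) *
  (RtoC (INR n) * (u_fun tau * P) - P' * (u_fun tau ^ 2 - u_fun tau) - / 4 * (u_fun tau * Q)).
  by rewrite -S /f_fun !Cpow_mult_r !Cpow_S; ring.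
have f2 : - (RtoC PI ^ 4 / 4 * (x_fun tau * y_fun tau)) * f_prev n tau =
  - (RtoC PI ^ 2 * y_fun tau / 4) * (RtoC PI ^ (2 * n)%nat * x_fun tau ^ n * Q).
  by rewrite -F; field.
rewrite f1 f2 W4 ye /Aw /kappa /f_fun -/P.
move: (RtoC PI ^ (2 * n)%nat) (x_fun tau ^ n) => Z X.
apply: (@Ceq_mul_reg (RtoC PI * Ci)); first exact: Cmult_neq_0.
set R := (X in _ = RtoC PI * Ci * (X / _)).
have -> : RtoC PI * Ci * (R / (RtoC PI * Ci)) = R by field.
rewrite /R; move: (u_fun tau) (x_fun tau) (w3 tau) (RtoC (INR n)) => u x v N.
have C2 := Ci_sq.
have E (a b : C) : RtoC PI * Ci * (a + b) = RtoC PI * Ci * a + RtoC PI * Ci * b by ring.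
rewrite E.
transitivity (Z * X * N * P * (4 * RtoC PI * Ci * v) - (Ci * Ci) * RtoC PI ^ 2 * (Z * X * N * P * (u * x))
   + (Ci * Ci) * RtoC PI ^ 2 * (Z * X * P' * (x * (u ^ 2 - u)))); first by field.
by rewrite C2; field.
Qed.

(** The derivative of [divpow] with respect to its base; the value 0 at m = 0 belongs to the
    constant. *)
Definition shiftpow (w : C) (m : nat) : C := if m is k.+1 then divpow w k else 0.

Lemma shiftpow_mul w (m : nat) : w * shiftpow w m = RtoC (INR m) * divpow w m.
Proof. by case: m => [|m] //=; rewrite ?divpow_S //; ring. Qed.

Lemma divpow_deriv (f : C -> C) (tau l : C) (m : nat) : Cderiv f tau l ->
  Cderiv (fun t => divpow (f t) m) tau (l * shiftpow (f tau) m).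
Proof.
move=> H; case: m => [|m].
  apply: (Cderiv_ext_all (f := fun=> RtoC 1)); first by move=> t; rewrite divpow_0.
  by apply: Cderiv_eq (Cderiv_const 1 tau); rewrite /=; ring.
have h := @INR_fact_C_neq0 m; have k := @INR_S_C_neq0 m.
apply: (Cderiv_ext_all (f := fun t => / RtoC (INR (fact m.+1)) * f t ^ m.+1)).
  by move=> t; rewrite /divpow /Cdiv Cmult_comm.
apply: Cderiv_eq (Cderiv_scal _ (Cderiv_pow m.+1 H)).
by rewrite [shiftpow _ _]/= /divpow RtoC_fact_S [m.+1.-1]/=; field.
Qed.

(** * The expansion of s *)

(** Coefficients of the k-th derivative in tau of the generating series of r2(n). *)
Definition r2_coef (k n : nat) : C := RtoC (INR (r2 n)) * (RtoC PI * Ci * RtoC (INR n)) ^ k.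

Lemma r2_bound (n : nat) : (INR (r2 n) <= (1 + 2 * INR n) ^ 2)%R.
Proof.
have : (r2 n <= n.*2.+1 * n.*2.+1)%nat.
  by rewrite /r2 (leq_trans (max_card _)) // card_prod !card_ord.
move=> h; have -> : ((1 + 2 * INR n) ^ 2 = INR (n.*2.+1 * n.*2.+1)%nat)%R.
  rewrite mult_INR S_INR -mul2n mult_INR [INR 2]/=; ring.
by apply: le_INR; lia.
Qed.

Lemma good_r2 (k : nat) : good (r2_coef k) INR.
Proof.
elim: k => [|k IH].
  apply: (@good_weight _ _ _ _ 4 4 summable_inv_sq_nat) => n; first exact: pos_INR.
  rewrite /r2_coef /= Cmult_1_r Cmod_R Rabs_pos_eq; last exact: pos_INR.
  have n0 := pos_INR n; have b := r2_bound n.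
  have q0 : (0 < 1 + INR n * (INR n * 1))%R by nra.
  rewrite Cmod_R Rabs_pos_eq; last by apply/Rlt_le/Rinv_0_lt_compat.
  apply/Rle_div_r => //; apply: Rle_trans (Rmult_le_compat_r _ _ _ (Rlt_le _ _ q0) b) _.
  have h1 : ((1 + 2 * INR n) ^ 2 <= 4 * (1 + INR n) ^ 2)%R by nra.
  have h2 : (1 + INR n * (INR n * 1) <= (1 + INR n) ^ 2)%R by nra.
  have := Rmult_le_compat _ _ _ _ (pow2_ge_0 _) (Rlt_le _ _ q0) h1 h2.
  by rewrite /=; lra.
have g := good_Dc IH; split; first by case: IH.
move=> v v0; have [_ H] := g; apply: summable_ext (H v v0) => n.
by rewrite /Dc /r2_coef Cpow_S; congr (_ * _); ring.
Qed.

Definition r2_series (k : nat) : C -> C := ES (r2_coef k) INR.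

Lemma r2_series_deriv (k : nat) tau : upper tau ->
  Cderiv (r2_series k) tau (r2_series k.+1 tau).
Proof.
move=> ut; apply: Cderiv_eq (ES_deriv (good_r2 k) ut).
apply: tsum_eq; apply: has_sum_ext (ES_has_sum (good_r2 k.+1) ut) => n.
by rewrite /Dc /r2_coef Cpow_S; congr (_ * _); ring.
Qed.

Definition circle_points (n : nat) : seq (Z * Z) :=
  [seq (Z.of_nat (ij.1 : 'I_(n.*2.+1)) - Z.of_nat n, Z.of_nat (ij.2 : 'I_(n.*2.+1)) - Z.of_nat n)%Z |
    ij <- enum [set ij : 'I_(n.*2.+1) * 'I_(n.*2.+1) |
      (((ij.1 : nat)%:Z - n%:Z) ^+ 2 + ((ij.2 : nat)%:Z - n%:Z) ^+ 2 == n%:Z)%ring]].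

Lemma circle_points_uniq n : uniq (circle_points n).
Proof.
rewrite map_inj_uniq ?enum_uniq // => -[i j] [k l] /= [h1 h2].
by congr pair; apply: val_inj => /=; lia.
Qed.

Lemma size_circle_points n : size (circle_points n) = r2 n.
Proof. by rewrite size_map -cardE. Qed.

Lemma mem_circle_points n (ab : Z * Z) :
  (ab \in circle_points n) = (Z.to_nat (ab.1 * ab.1 + ab.2 * ab.2) == n).
Proof.
case: ab => a b /=; apply/mapP/eqP => [[[i j]] | h].
  rewrite mem_enum inE /= => /eqP E [-> ->]; rewrite !expr2 in E; lia.
have an : (Z.abs a <= Z.of_nat n)%Z by nia.
have bn : (Z.abs b <= Z.of_nat n)%Z by nia.
have ha : (Z.to_nat (a + Z.of_nat n) < n.*2.+1)%nat by lia.
have hb : (Z.to_nat (b + Z.of_nat n) < n.*2.+1)%nat by lia.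
exists (Ordinal ha, Ordinal hb); last by congr pair => /=; lia.
rewrite mem_enum inE /=; apply/eqP; rewrite !expr2.
have -> : ((Z.to_nat (a + Z.of_nat n))%:Z - n%:Z)%ring = int_of_Z a by lia.
have -> : ((Z.to_nat (b + Z.of_nat n))%:Z - n%:Z)%ring = int_of_Z b by lia.
lia.
Qed.

(** The double series of theta^2 is grouped by the fibres of a^2 + b^2, which are the sets counted
    by [r2]. *)
Lemma theta_sq tau : upper tau -> r2_series 0 tau = T3 tau * T3 tau.
Proof.
move=> ut; apply: tsum_eq; pose p (k : Z * Z) := Z.to_nat (k.1 * k.1 + k.2 * k.2).
have H := ES_mul good3 good3 ut.
have S := summable_prod (good_summable good3 ut) (good_summable good3 ut).
have Sf : summable (fun k : Z * Z => one_c k.1 * one_c k.2 * eterm (sq k.1 + sq k.2) tau).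
  by apply: summable_ext S => k; rewrite -eterm_mul /one_c !Cmult_1_l.
apply: (has_sum_fiber (p := p) Sf H) => n.
have := @has_sum_finite _ (fun k => if p k == n then one_c k.1 * one_c k.2 * eterm (sq k.1 + sq k.2) tau else 0)
  (circle_points n) (circle_points_uniq n).
rewrite big_seq (eq_bigr (fun=> eterm (INR n) tau)) -?big_seq.
  rewrite csum_const size_circle_points /r2_coef /= Cmult_1_r; apply=> k.
  by rewrite mem_circle_points => /negbTE ->.
move=> [a b] hk; have h : p (a, b) = n by apply/eqP; rewrite -mem_circle_points.
rewrite h eqxx /one_c !Cmult_1_l; congr eterm.
rewrite -h INR_IZR_INZ Z2Nat.id; last by nia.
by rewrite /= plus_IZR !mult_IZR /sq; ring.
Qed.

(** The coefficient of z^(2k) in s. The Bessel factor contributes (- pi^2 n)^k / k!^2 = (pi i)^k (pi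
    i n)^k / k!^2, and (pi i n)^k is what k derivatives in tau produce. *)
Definition taylor_coef (k : nat) (tau : C) : C :=
  (RtoC PI * Ci) ^ k / RtoC (INR (fact k)) ^ 2 * r2_series k tau.

Lemma taylor_coef_deriv (k : nat) tau : upper tau ->
  Cderiv (taylor_coef k) tau (RtoC (INR k.+1) ^ 2 * taylor_coef k.+1 tau / (RtoC PI * Ci)).
Proof.
move=> ut; apply: Cderiv_eq (Cderiv_scal _ (r2_series_deriv k ut)).
have h := @INR_fact_C_neq0 k; have h' := @INR_S_C_neq0 k.
have P := PI_C_neq0; have I := Ci_neq0; rewrite /taylor_coef RtoC_fact_S (Cpow_S _ k).
by field.
Qed.

(** The coefficient of z^(2n) in s times exp(- A z^2). *)
Definition expansion_coef (n : nat) (tau : C) : C :=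
  \csum_(0 <= j < n.+1) (taylor_coef j tau * divpow (- Aw tau) (n - j)).

Definition expansion_prev (n : nat) (tau : C) : C :=
  if n is m.+1 then expansion_coef m tau else 0.

Lemma expansion_prevE (n : nat) tau : expansion_prev n tau =
  \csum_(0 <= j < n.+1) (taylor_coef j tau * shiftpow (- Aw tau) (n - j)).
Proof.
case: n => [|n]; first by rewrite big_nat1 /= Cmult_0_r.
rewrite csum_recr subnn [shiftpow _ 0]/= Cmult_0_r Cplus_0_r.
by apply: eq_big_nat => j /andP[_ hj]; rewrite subSn.
Qed.

Definition d_expansion_coef (n : nat) (tau : C) : C :=
  \csum_(0 <= j < n.+1)
    (RtoC (INR j.+1) ^ 2 * taylor_coef j.+1 tau / (RtoC PI * Ci) * divpow (- Aw tau) (n - j)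
     + taylor_coef j tau * (- dAw tau * shiftpow (- Aw tau) (n - j))).

Lemma expansion_coef_deriv (n : nat) tau : upper tau ->
  Cderiv (expansion_coef n) tau (d_expansion_coef n tau).
Proof.
move=> ut.
apply: (Cderiv_csum (F := fun j t => taylor_coef j t * divpow (- Aw t) (n - j))
  (G := fun j t => RtoC (INR j.+1) ^ 2 * taylor_coef j.+1 t / (RtoC PI * Ci) * divpow (- Aw t) (n - j)
     + taylor_coef j t * (- dAw t * shiftpow (- Aw t) (n - j)))) => j _.
exact: Cderiv_mul (taylor_coef_deriv j ut) (divpow_deriv _ (Cderiv_opp (Aw_deriv ut))).
Qed.

Lemma csum_raise_exponent (c : nat -> C) (w : C) (n : nat) :
  w * \csum_(0 <= j < n.+1) (c j * divpow w (n - j)%nat) =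
  \csum_(0 <= j < n.+2) (c j * (RtoC (INR (n.+1 - j)%nat) * divpow w (n.+1 - j)%nat)).
Proof.
rewrite [in RHS]csum_recr subnn [INR 0]/= !Cmult_0_l Cmult_0_r Cplus_0_r -csum_mull.
apply: eq_big_nat => j /andP[_ hj]; rewrite subSn // divpow_S; ring.
Qed.

(** With all sums in the form of [expansion_coef n.+1], the claim becomes (n + 1)^2 = j^2 + (2 n +
    1) m - m (m - 1) for m = n + 1 - j. The derivative of A occurs in [d_expansion_coef] and in the
    last term, and cancels. *)
Lemma expansion_coef_rec (n : nat) tau : upper tau ->
  RtoC (INR n.+1) ^ 2 * expansion_coef n.+1 tau =
  RtoC PI * Ci * d_expansion_coef n tau
  - (2 * RtoC (INR n) + 1) * Aw tau * expansion_coef n tau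
  + (RtoC PI * Ci * dAw tau - Aw tau * Aw tau) * expansion_prev n tau.
Proof.
move=> ut; set c := taylor_coef^~ tau; set w := - Aw tau.
pose m j := RtoC (INR (n.+1 - j)%nat).
have E1 : RtoC PI * Ci * d_expansion_coef n tau =
   \csum_(0 <= j < n.+2) (c j * (RtoC (INR j) ^ 2 * divpow w (n.+1 - j)%nat))
   - RtoC PI * Ci * dAw tau * expansion_prev n tau.
  have -> : expansion_prev n tau = \csum_(0 <= j < n.+1) (c j * shiftpow w (n - j)%nat).
    exact: expansion_prevE.
  rewrite csum_recl [INR 0]/=.
  rewrite (_ : c 0%nat * (0 ^ 2 * _) = 0) ?Cplus_0_l; last by rewrite /=; ring.
  transitivity (\csum_(0 <= i < n.+1) (c i.+1 * (RtoC (INR i.+1) ^ 2 * divpow w (n.+1 - i.+1)%nat))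
     + - (RtoC PI * Ci * dAw tau) * \csum_(0 <= j < n.+1) (c j * shiftpow w (n - j)%nat)).
    rewrite -!csum_mull -csum_add; apply: eq_bigr => j _.
    rewrite subSS -/(c j) -/(c j.+1) -/w; have P := PI_C_neq0; have I := Ci_neq0.
    by field.
  ring.
have E2 : w * expansion_coef n tau = \csum_(0 <= j < n.+2) (c j * (m j * divpow w (n.+1 - j)%nat)).
  exact: csum_raise_exponent.
have E3 : w * w * expansion_prev n tau =
   \csum_(0 <= j < n.+2) (c j * (m j - 1) * (m j * divpow w (n.+1 - j)%nat)).
  rewrite -(csum_raise_exponent (fun j => c j * (m j - 1))) expansion_prevE -Cmult_assoc.
  congr (_ * _); rewrite -csum_mull; apply: eq_big_nat => j /andP[_ hj].
  rewrite -/(c j) -/w /m subSn // RtoC_INR_S.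
  have S := shiftpow_mul w (n - j)%nat.
  transitivity (c j * (w * shiftpow w (n - j)%nat)); first ring.
  by rewrite S; ring.
rewrite E1.
transitivity (\csum_(0 <= j < n.+2) (c j * (RtoC (INR j) ^ 2 * divpow w (n.+1 - j)%nat))
  + ((2 * RtoC (INR n) + 1) * (w * expansion_coef n tau) + -1 * (w * w * expansion_prev n tau)));
  last by rewrite /w; ring.
rewrite E2 E3 /expansion_coef -/c -/w -!csum_mull -!csum_add; apply: eq_big_nat => j /andP[_ hj].
have mj : m j = RtoC (INR n) + 1 - RtoC (INR j).
  by rewrite /m minus_INR; [rewrite RtoC_minus RtoC_INR_S | lia].
by rewrite -/(c j) mj RtoC_INR_S; ring.
Qed.

(** Both sides satisfy the same recursion: the derivative of T3^2 contributes 2 pi i w3 = A, which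
    reduces (2 n + 1) A to 2 n A. The induction runs over all tau at once because its hypothesis is
    differentiated. *)
Lemma expansion_coefE (n : nat) : forall tau, upper tau ->
  expansion_coef n tau = T3 tau * T3 tau * f_fun pseq n tau /\
  expansion_prev n tau = T3 tau * T3 tau * f_prev n tau.
Proof.
elim: n => [|n IH] tau ut.
  split; last by rewrite /= Cmult_0_r.
  rewrite /expansion_coef big_nat1 subnn divpow_0 /taylor_coef theta_sq //.
  by rewrite /f_fun peval_1 /=; field.
have [IH1 IH2] := IH tau ut; split=> //.
have D1 := Cderiv_ext ut (fun t h => proj1 (IH t h)) (expansion_coef_deriv n ut).
have D2 := Cderiv_mul (Cderiv_mul (T3_deriv ut) (T3_deriv ut)) (f_fun_deriv n ut).
have E := Cderiv_unique D1 D2.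
apply: (@Ceq_mul_reg (RtoC (INR n.+1) ^ 2)); first by apply: Cpow_nz; exact: INR_S_C_neq0.
rewrite expansion_coef_rec // E IH1 IH2 dT3_w // /df_fun.
have P := PI_C_neq0; have I := Ci_neq0.
transitivity (T3 tau * T3 tau * (2 * RtoC PI * Ci * w3 tau * f_fun pseq n tau
  + (RtoC (INR n.+1) ^ 2 * f_fun pseq n.+1 tau + 2 * RtoC (INR n) * Aw tau * f_fun pseq n tau
   - (RtoC PI * Ci * dAw tau - Aw tau * Aw tau) * f_prev n tau)
  - (2 * RtoC (INR n) + 1) * Aw tau * f_fun pseq n tau
  + (RtoC PI * Ci * dAw tau - Aw tau * Aw tau) * f_prev n tau)); first by field.
by rewrite -/(Aw tau); ring.
Qed.

Definition bessel_term (w : C) (k : nat) : C :=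
  (-1) ^ k * ((w / 2) ^ 2) ^ k / RtoC (INR (fact k)) ^ 2.

Lemma fact_ge1 (k : nat) : (1 <= INR (fact k))%R.
Proof. by apply: (le_INR 1); have := lt_O_fact k; lia. Qed.

Lemma bessel_has_sum (w : C) : has_sum (bessel_term w) (J0 w).
Proof.
have S : summable (bessel_term w).
  apply: summable_le (summable_divpow ((w / 2) ^ 2)) => k.
  have h := @INR_fact_C_neq0 k; have f1 := fact_ge1 k.
  rewrite /bessel_term Cmod_div; last exact: Cpow_nz.
  rewrite Cmod_mult Cmod_pow (_ : Cmod (-1) = 1%R); last by rewrite Cmod_R Rabs_left; lra.
  rewrite pow1 Rmult_1_l Cmod_divpow !Cmod_pow Cmod_R Rabs_pos_eq; last lra.
  apply: Rmult_le_compat_l; first by apply: pow_le; apply: pow_le; exact: Cmod_ge_0.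
  by apply: Rinv_le_contravar; nra.
have H := tsumP S; rewrite -[J0 w]/(CSeries (bessel_term w)).
by rewrite (has_sum_CSeries H).
Qed.

Definition double_term (z tau : C) (nk : nat * nat) : C :=
  r2_coef nk.2 nk.1 * eterm (INR nk.1) tau *
  ((RtoC PI * Ci) ^ nk.2 / RtoC (INR (fact nk.2)) ^ 2 * (z ^ 2) ^ nk.2).

(** The root enters only through its square n, and (pi i)^2 supplies the sign (-1)^k. *)
Lemma double_term_bessel (z tau : C) (n k : nat) : double_term z tau (n, k) =
  RtoC (INR (r2 n)) * eterm (INR n) tau *
    bessel_term (2 * RtoC PI * RtoC (sqrt (INR n)) * z) k.
Proof.
have h := @INR_fact_C_neq0 k; rewrite /double_term /r2_coef /bessel_term [(n, k).1]/= [(n, k).2]/=.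
set a := RtoC PI * Ci * RtoC (INR n); set b := RtoC PI * Ci.
have -> : 2 * RtoC PI * RtoC (sqrt (INR n)) * z / 2 = RtoC PI * RtoC (sqrt (INR n)) * z by field.
have E : a ^ k * b ^ k * (z ^ 2) ^ k =
   (-1) ^ k * ((RtoC PI * RtoC (sqrt (INR n)) * z) ^ 2) ^ k.
  rewrite -!Cpow_mult_l; congr (_ ^ k).
  transitivity (RtoC PI ^ 2 * (Ci * Ci) * RtoC (INR n) * z ^ 2); first by rewrite /a /b; ring.
  have -> : RtoC (INR n) = RtoC (sqrt (INR n)) * RtoC (sqrt (INR n)).
    by rewrite -RtoC_mult sqrt_sqrt //; exact: pos_INR.
  by rewrite Ci_sq; ring.
transitivity (RtoC (INR (r2 n)) * eterm (INR n) tau * (a ^ k * b ^ k * (z ^ 2) ^ k) / RtoC (INR (fact k)) ^ 2).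
  by field.
by rewrite E; field.
Qed.

(** The decay exp(- pi n Im tau) is exp(- X)^2 with X = pi n Im tau / 2. The Bessel term has modulus
    (X Y)^k / k!^2: one factor exp(- X) beats X^k / k!, the other keeps the sum over n convergent,
    and Y^k / k! remains for the sum over k. *)
Lemma double_term_summable (z tau : C) : upper tau -> summable (double_term z tau).
Proof.
move=> ut; have P := PI_RGT_0; have v0 : (0 < Im tau)%R by [].
have [_ H] := good_r2 0; have Sa := H (Im tau / 2)%R ltac:(lra).
pose Y := (2 * PI * Cmod z ^ 2 / Im tau)%R.
have Y0 : (0 <= Y)%R.
  apply: Rmult_le_pos; last by apply/Rlt_le/Rinv_0_lt_compat.
  by apply: Rmult_le_pos; [lra | exact: pow2_ge_0].
apply: summable_le (summable_prod Sa (summable_divpow (RtoC Y))) => -[n k].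
rewrite double_term_bessel /r2_coef [_ ^ 0]/= Cmult_1_r /=.
rewrite (Cmod_mult _ (divpow _ _)) Cmod_divpow (Cmod_mult _ (bessel_term _ _)).
rewrite !(Cmod_mult (RtoC (INR (r2 n)))) Cmod_eterm Cmod_RtoC_exp !Rmult_assoc.
apply: Rmult_le_compat_l; first exact: Cmod_ge_0.
have h := @INR_fact_C_neq0 k; have f1 := fact_ge1 k; have n0 := pos_INR n.
rewrite /bessel_term Cmod_div; last exact: Cpow_nz.
rewrite Cmod_mult Cmod_pow (_ : Cmod (-1) = 1%R); last by rewrite Cmod_R Rabs_left; lra.
rewrite pow1 Rmult_1_l !Cmod_pow !Cmod_R (Rabs_pos_eq (INR _)); last lra.
rewrite (Rabs_pos_eq Y) //.
have -> : 2 * RtoC PI * RtoC (sqrt (INR n)) * z / 2 = RtoC PI * RtoC (sqrt (INR n)) * z by field.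
rewrite !Cmod_mult !Cmod_R (Rabs_pos_eq PI) ?(Rabs_pos_eq (sqrt _)); try exact: sqrt_pos; try lra.
pose X := (PI * INR n * (Im tau / 2))%R.
have X0 : (0 <= X)%R by apply: Rmult_le_pos; nra.
have -> : ((PI * sqrt (INR n) * Cmod z) ^ 2 = X * Y)%R.
  transitivity (PI ^ 2 * (sqrt (INR n) * sqrt (INR n)) * Cmod z ^ 2)%R; first ring.
  by rewrite sqrt_sqrt // /X /Y; field; lra.
have -> : (exp (- PI * (INR n * Im tau)) = exp (- X) * exp (- X))%R.
  by rewrite -exp_plus; congr exp; rewrite /X; field.
have -> : (- PI * (INR n * (Im tau / 2)) = - X)%R by rewrite /X; ring.
have eX := exp_pos (- X); rewrite Rmult_assoc; apply: Rmult_le_compat_l; first lra.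
have D : (X ^ k / INR (fact k) <= exp X)%R.
  have := divpow_sum_le (RtoC X) (L := [:: k]) isT.
  by rewrite big_seq1 Cmod_divpow Cmod_R Rabs_pos_eq.
have -> : ((X * Y) ^ k / INR (fact k) ^ 2 = X ^ k / INR (fact k) * (Y ^ k / INR (fact k)))%R.
  by rewrite Rpow_mult_distr; field; lra.
rewrite -Rmult_assoc -[X in (_ <= X)%R]Rmult_1_l; apply: Rmult_le_compat_r.
  apply: Rmult_le_pos; first exact: pow_le.
  by apply/Rlt_le/Rinv_0_lt_compat; lra.
have -> : (1 = exp (- X) * exp X)%R by rewrite -exp_plus Rplus_opp_l exp_0.
by apply: Rmult_le_compat_l; lra.
Qed.

(** One unconditional double sum is read in two orders: summed over k first it gives the terms of s,
    summed over n first the coefficients of its powers of z^2. The Cauchy product with the series of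
    exp(- A z^2) then yields the f_n. *)
Lemma expansion_has_sum (z tau : C) : upper tau -> exists S : C,
  has_sum (s_term z tau) S /\
  has_sum (fun n => f_fun pseq n tau * z ^ (2 * n)%nat)
    (Cexp (- (Aw tau * z ^ 2)) * S / (T3 tau * T3 tau)).
Proof.
move=> ut; have Sd := double_term_summable z ut; have Hd := tsumP Sd.
set S := tsum _ in Hd; exists S.
have n3 := T3_neq0 ut; split.
  apply: (has_sum_fubini Hd) => n.
  have -> : s_term z tau n = RtoC (INR (r2 n)) * eterm (INR n) tau *
     J0 (2 * RtoC PI * RtoC (sqrt (INR n)) * z) by rewrite /s_term /eterm; ring.
  apply: has_sum_ext (has_sum_scal _ (bessel_has_sum _)) => k.
  by rewrite double_term_bessel.
have inner k : has_sum (fun n => double_term z tau (n, k)) (taylor_coef k tau * (z ^ 2) ^ k).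
  have := has_sum_scal ((RtoC PI * Ci) ^ k / RtoC (INR (fact k)) ^ 2 * (z ^ 2) ^ k)
    (ES_has_sum (good_r2 k) ut).
  have -> : (RtoC PI * Ci) ^ k / RtoC (INR (fact k)) ^ 2 * (z ^ 2) ^ k * ES (r2_coef k) INR tau
     = taylor_coef k tau * (z ^ 2) ^ k by rewrite /taylor_coef /r2_series; ring.
  by apply: has_sum_ext => n; rewrite /double_term /=; ring.
have Hc := has_sum_fubini (has_sum_swap Hd) inner.
have Sc := summable_fubini (summable_swap Sd) inner.
have := has_sum_cauchy Sc (summable_divpow (- (Aw tau * z ^ 2))) Hc (has_sum_Cexp _).
move=> /(has_sum_scal (/ (T3 tau * T3 tau))).
have -> : / (T3 tau * T3 tau) * (S * Cexp (- (Aw tau * z ^ 2))) =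
   Cexp (- (Aw tau * z ^ 2)) * S / (T3 tau * T3 tau) by rewrite /Cdiv; ring.
apply: has_sum_ext => n; have [E _] := expansion_coefE n ut.
have -> : \csum_(0 <= i < n.+1) (taylor_coef i tau * (z ^ 2) ^ i *
    divpow (- (Aw tau * z ^ 2)) (n - i)%nat) = (z ^ 2) ^ n * expansion_coef n tau.
  rewrite /expansion_coef -csum_mull; apply: eq_big_nat => i /andP[_ hi].
  have -> : (z ^ 2) ^ n = (z ^ 2) ^ i * (z ^ 2) ^ (n - i)%nat.
    by rewrite -Cpow_add_r; congr (_ ^ _); lia.
  have -> : - (Aw tau * z ^ 2) = - Aw tau * z ^ 2 by ring.
  by rewrite /divpow Cpow_mult_l; have h := @INR_fact_C_neq0 (n - i)%nat; field.
by rewrite E Cpow_mult_r; field.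
Qed.

Lemma f_fun_modular (n : nat) : modular_form_Gamma2 (2 * n)%nat (f_fun pseq n).
Proof.
split; first by move=> tau ut; exists (df_fun n tau); exact: f_fun_deriv.
split; last by move=> r; exact: f_fun_growth.
by apply: Gamma2_generated => t ut; [exact: f_fun_T | exact: f_fun_U].
Qed.

Theorem theorem1 :
  (forall tau : C, upper tau ->
     @ex_derive C_AbsRing C_NormedModule theta tau /\
     theta tau <> 0 /\ x_fun tau <> 0) /\
  exists p : int -> {poly rat},
    p_system p /\
    (forall q : int -> {poly rat}, p_system q ->
       forall k : int, (-1 <= k)%ring -> q k = p k) /\
    (forall n : nat, modular_form_Gamma2 (2 * n)%nat (f_fun p n)) /\
    (forall z tau : C, upper tau ->
       @ex_series C_AbsRing C_NormedModule (s_term z tau) /\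
       @ex_series C_AbsRing C_NormedModule
         (fun n => f_fun p n tau * z ^ (2 * n)%nat) /\
       s_fun z tau = theta tau ^ 2 * Cexp (A_fun tau * z ^ 2)
                     * CSeries (fun n => f_fun p n tau * z ^ (2 * n)%nat)).
Proof.
split.
  move=> tau ut; split; first by exists (dT3 tau); exact: theta_deriv.
  by split; [rewrite theta_T3 //; exact: T3_neq0 | exact: x_fun_neq0].
exists pseq; split; first exact: pseq_system.
split; first exact: p_system_unique.
split; first exact: f_fun_modular.
move=> z tau ut; have [S [Hs Hf]] := expansion_has_sum z ut.
split; first by exists S; exact: has_sum_is_series.
split; first by eexists; exact: has_sum_is_series Hf.
rewrite /s_fun (has_sum_CSeries Hs) (has_sum_CSeries Hf) theta_T3 // A_fun_Aw //.
have n3 := T3_neq0 ut; have e0 := @Cexp_neq0 (Aw tau * z ^ 2).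
by rewrite Cexp_opp; field.
Qed.
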